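(* Let $\Gamma$ be a Coxeter graph of rank $n$ such that $m_{ij}\ge 5$ for all $i\neq j$ (the value $m_{ij}=\infty$ is allowed), with Coxeter group $W_\Gamma$ and Artin group $A_\Gamma$. Let $c=s_{\mu(1)}\cdots s_{\mu(n)}\in W_\Gamma$ be any Coxeter element, where $\mu$ is a permutation of $\{1,\dots,n\}$. Then the dual Artin group $A^*_\Gamma(c)$ is canonically isomorphic to $A_\Gamma$, i.e. the canonical epimorphism $A_\Gamma\to A^*_\Gamma(c)$, $t_i\mapsto [s_i]$, is an isomorphism.
   Context: A Coxeter graph $\Gamma$ of rank $n$ is a finite simplicial graph with vertices $1,\dots,n$ in which each edge $\{i,j\}$ carries a label $m_{ij}\in\{3,4,\dots\}\cup\{\infty\}$; if $i\ne j$ are not joined by an edge, put $m_{ij}=2$. For group elements $g,h$ and $k\in\mathbb N$, $\Pi(g,h;k)$ is the alternating product $ghg\cdots$ beginning with $g$ and with $k$ factors. The Artin group is $A_\Gamma=\langle t_1,\dots,t_n\mid \Pi(t_i,t_j;m_{ij})=\Pi(t_j,t_i;m_{ij})\text{ for all } i\neq j\text{ with } m_{ij}\neq\infty\rangle$. The Coxeter group $W_\Gamma$ is generated by $s_1,\dots,s_n$ with the corresponding relations together with $s_i^2=1$ for all $i$. Let $B_n$ be the braid group with standard generators $\sigma_1,\dots,\sigma_{n-1}$. For a group $G$, the Hurwitz action of $B_n$ on $G^n$ is given by $\sigma_i\cdot(g_1,\dots,g_n)=(g_1,\dots,g_{i-1},\,g_{i+1},\,g_{i+1}^{-1}g_ig_{i+1},\,g_{i+2},\dots,g_n)$.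 Let $\mathrm{Hur}(g_1,\dots,g_n)\subseteq G$ be the set of all elements appearing at any coordinate of some tuple in the orbit $B_n\cdot(g_1,\dots,g_n)$. The Hurwitz group $H(g_1,\dots,g_n)$ is the group with one generator $[r]$ for each $r\in \mathrm{Hur}(g_1,\dots,g_n)$ and relations $[r_2]^{-1}[r_1][r_2]=[r_2^{-1}r_1r_2]$ for all $(r_1,r_2,\dots,r_n)\in B_n\cdot(g_1,\dots,g_n)$. For a Coxeter element $c=s_{\mu(1)}\cdots s_{\mu(n)}$ the dual Artin group is $A^*_\Gamma(c):=H(s_{\mu(1)},\dots,s_{\mu(n)})$. The assignment $t_i\mapsto[s_i]$ extends to a surjective homomorphism $A_\Gamma\to A^*_\Gamma(c)$, the canonical epimorphism. *)

(* Defs.v *)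
From HB Require Import structures.
From mathcomp Require Import all_boot perm boolp classical_sets.

Set Implicit Arguments.
Unset Strict Implicit.
Unset Printing Implicit Defensive.

Local Open Scope group_scope.
Local Open Scope quotient_scope.
Local Open Scope classical_set_scope.

(* A letter (x, true) stands for x and (x, false) for x^-1. *)
Definition word (X : choiceType) := seq (X * bool).

Definition wgen (X : choiceType) (x : X) : word X := [:: (x, true)].

Definition winv (X : choiceType) (w : word X) : word X :=
  rev [seq (l.1, ~~ l.2) | l <- w].

Definition relations (X : choiceType) := word X -> word X -> Prop.

Section Presentation.
Variables (X : choiceType) (R : relations X).

Inductive pres_cong : word X -> word X -> Prop :=
  | PresRefl u : pres_cong u u
  | PresSym u v : pres_cong u v -> pres_cong v u
  | PresTrans u v w : pres_cong u v -> pres_cong v w -> pres_cong u w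
  | PresCat u u' v v' :
      pres_cong u u' -> pres_cong v v' -> pres_cong (u ++ v) (u' ++ v')
  | PresCancel x b : pres_cong [:: (x, b); (x, ~~ b)] [::]
  | PresRel u v : R u v -> pres_cong u v.

Definition pres_congb : rel (word X) := fun u v => `[< pres_cong u v >].

Lemma pres_congb_refl : reflexive pres_congb.
Proof. by move=> u; apply/asboolP; apply: PresRefl. Qed.

Lemma pres_congb_sym : symmetric pres_congb.
Proof. by move=> u v; apply/asboolP/asboolP; apply: PresSym. Qed.

Lemma pres_congb_trans : transitive pres_congb.
Proof.
by move=> v u w /asboolP uv /asboolP vw; apply/asboolP; apply: PresTrans uv vw.
Qed.

Canonical pres_equiv :=
  EquivRel pres_congb pres_congb_refl pres_congb_sym pres_congb_trans.

(* The group < X | u = v for R u v >. *)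
Definition presented := {eq_quot pres_equiv}.

HB.instance Definition _ := Choice.on presented.
HB.instance Definition _ := EqQuotient.on presented.

Definition pres_class (w : word X) : presented := \pi_presented w.

Definition pres_gen (x : X) : presented := pres_class (wgen x).

Lemma pres_classP (u v : word X) :
  pres_class u = pres_class v <-> pres_cong u v.
Proof.
by split=> [/eqmodP/asboolP // | uv]; apply/eqmodP/asboolP.
Qed.

Lemma pres_repr (w : word X) : pres_cong (repr (pres_class w)) w.
Proof. by apply/pres_classP; rewrite /pres_class reprK. Qed.

Lemma winvK : involutive (@winv X).
Proof.
move=> w; rewrite /winv map_rev revK -map_comp -[RHS]map_id.
by apply: eq_map => -[x b] /=; rewrite negbK.
Qed.

Lemma winv_cat (u v : word X) : winv (u ++ v) = winv v ++ winv u.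
Proof. by rewrite /winv map_cat rev_cat. Qed.

Lemma pres_cat_winv (w : word X) : pres_cong (w ++ winv w) [::].
Proof.
elim: w => [|[x b] w IHw]; first exact: PresRefl.
have -> : ((x, b) :: w) ++ winv ((x, b) :: w) =
    [:: (x, b)] ++ ((w ++ winv w) ++ [:: (x, ~~ b)]).
  by rewrite -cat1s winv_cat -!catA.
apply: PresTrans (PresCancel x b).
apply: (@PresCat [:: (x, b)] [:: (x, b)] _ [:: (x, ~~ b)]).
  exact: PresRefl.
by apply: (@PresCat _ [::]) => //; apply: PresRefl.
Qed.

Lemma pres_winv (u v : word X) :
  pres_cong u v -> pres_cong (winv u) (winv v).
Proof.
move=> uv.
apply: (@PresTrans _ (winv u ++ (v ++ winv v))).
  rewrite -{1}[winv u]cats0; apply: PresCat; first exact: PresRefl.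
  by apply: PresSym; apply: pres_cat_winv.
rewrite catA -{2}[winv v]cat0s; apply: PresCat; last exact: PresRefl.
apply: (@PresTrans _ (winv u ++ u)).
  by apply: PresCat; [apply: PresRefl | apply: PresSym].
by rewrite -{2}[u]winvK; apply: pres_cat_winv.
Qed.

Definition pres_mul (a b : presented) : presented :=
  pres_class (repr a ++ repr b).

Definition pres_inv (a : presented) : presented := pres_class (winv (repr a)).

Lemma pres_mulE (u v : word X) :
  pres_mul (pres_class u) (pres_class v) = pres_class (u ++ v).
Proof. by apply/pres_classP; apply: PresCat; apply: pres_repr. Qed.

Lemma pres_invE (u : word X) : pres_inv (pres_class u) = pres_class (winv u).
Proof. by apply/pres_classP; apply: pres_winv; apply: pres_repr. Qed.

Lemma pres_ind (P : presented -> Prop) :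
  (forall w, P (pres_class w)) -> forall a, P a.
Proof. by move=> Pw a; rewrite -[a]reprK; apply: Pw. Qed.

Lemma pres_mulA : associative pres_mul.
Proof.
elim/pres_ind=> u; elim/pres_ind=> v; elim/pres_ind=> w.
by rewrite !pres_mulE catA.
Qed.

Lemma pres_mul1g : left_id (pres_class [::]) pres_mul.
Proof. by elim/pres_ind=> u; rewrite pres_mulE. Qed.

Lemma pres_mulg1 : right_id (pres_class [::]) pres_mul.
Proof. by elim/pres_ind=> u; rewrite pres_mulE cats0. Qed.

Lemma pres_mulgV : right_inverse (pres_class [::]) pres_inv pres_mul.
Proof.
elim/pres_ind=> u; rewrite pres_invE pres_mulE.
by apply/pres_classP; apply: pres_cat_winv.
Qed.

Lemma pres_mulVg : left_inverse (pres_class [::]) pres_inv pres_mul.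
Proof.
elim/pres_ind=> u; rewrite pres_invE pres_mulE.
by apply/pres_classP; rewrite -{2}[u]winvK; apply: pres_cat_winv.
Qed.

HB.instance Definition _ :=
  isGroup.Build presented pres_mulA pres_mul1g pres_mulg1 pres_mulVg pres_mulgV.

Lemma pres_hom_eq (H : groupType) (f h : {multiplicative presented -> H}) :
  (forall x, f (pres_gen x) = h (pres_gen x)) -> f =1 h.
Proof.
move=> fh.
have f1 (k : {multiplicative presented -> H}) : k 1 = 1.
  by apply: (mulgI (k 1)); rewrite -gmulfM !mulg1.
have fV (k : {multiplicative presented -> H}) a : k a^-1 = (k a)^-1.
  by apply: (mulgI (k a)); rewrite -gmulfM !mulgV f1.
elim/pres_ind; elim=> [|[x b] w IHw].
  by rewrite -[pres_class [::]]/(1 : presented) !f1.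
have -> : pres_class ((x, b) :: w) = pres_class [:: (x, b)] * pres_class w.
  by rewrite -[RHS]/(pres_mul _ _) pres_mulE.
rewrite !gmulfM IHw; congr (_ * _); case: b; first exact: fh.
have -> : pres_class [:: (x, false)] = (pres_gen x)^-1.
  by rewrite -[RHS]/(pres_inv _) pres_invE.
by rewrite !fV fh.
Qed.

End Presentation.

(* The alternating product g h g ... with k factors. *)
Fixpoint alt_word (X : choiceType) (g h : word X) (k : nat) : word X :=
  if k is k'.+1 then g ++ alt_word h g k' else [::].

(* The label None stands for infinity; label is only meaningful on edges. *)
Record coxeterGraph (n : nat) := CoxeterGraph {
  edge : rel 'I_n;
  label : 'I_n -> 'I_n -> option nat;
  edge_irr : irreflexive edge;
  edge_sym : symmetric edge;
  label_sym : forall i j, edge i j -> label i j = label j i;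
  label_ge3 : forall i j k, edge i j -> label i j = Some k -> 3 <= k
}.

Definition cox_m n (Gamma : coxeterGraph n) (i j : 'I_n) : option nat :=
  if edge Gamma i j then label Gamma i j else Some 2.

Inductive artin_rel n (Gamma : coxeterGraph n) : relations 'I_n :=
  | ArtinBraid i j k : i != j -> cox_m Gamma i j = Some k ->
      artin_rel Gamma (alt_word (wgen i) (wgen j) k)
                      (alt_word (wgen j) (wgen i) k).

Inductive coxeter_rel n (Gamma : coxeterGraph n) : relations 'I_n :=
  | CoxeterBraid u v : artin_rel Gamma u v -> coxeter_rel Gamma u v
  | CoxeterInvol i : coxeter_rel Gamma (wgen i ++ wgen i) [::].

Definition artinGroup n (Gamma : coxeterGraph n) : groupType :=
  presented (artin_rel Gamma).

Definition coxeterGroup n (Gamma : coxeterGraph n) : groupType :=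
  presented (coxeter_rel Gamma).

Definition artin_gen n (Gamma : coxeterGraph n) (i : 'I_n) :
  artinGroup Gamma := pres_gen (artin_rel Gamma) i.

Definition cox_gen n (Gamma : coxeterGraph n) (i : 'I_n) :
  coxeterGroup Gamma := pres_gen (coxeter_rel Gamma) i.

(* Generators and positions are numbered from 0: sigma_i, for i : 'I_n.-1,
   acts on the positions i and i + 1 of a tuple indexed by 'I_n. *)
Inductive braid_rel (m : nat) : relations 'I_m :=
  | BraidFar (i j : 'I_m) : i.+1 < j ->
      braid_rel (wgen i ++ wgen j) (wgen j ++ wgen i)
  | BraidNear (i j : 'I_m) : j = i.+1 :> nat ->
      braid_rel (wgen i ++ wgen j ++ wgen i) (wgen j ++ wgen i ++ wgen j).

Definition braidGroup (n : nat) : groupType := presented (@braid_rel n.-1).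

Definition braid_gen (n : nat) (i : 'I_n.-1) : braidGroup n :=
  pres_gen (@braid_rel n.-1) i.

Lemma hi_subproof n (i : 'I_n.-1) : i.+1 < n.
Proof. by rewrite -ltn_predRL. Qed.

Definition lo n (i : 'I_n.-1) : 'I_n := widen_ord (leq_pred n) i.
Definition hi n (i : 'I_n.-1) : 'I_n := Ordinal (hi_subproof i).

Section Hurwitz.
Variables (G : groupType) (n : nat).
Implicit Types (g h : {ffun 'I_n -> G}) (i j : 'I_n.-1) (k : 'I_n).

Definition hurwitz_sigma i g : {ffun 'I_n -> G} :=
  [ffun k => if k == lo i then g (hi i)
             else if k == hi i then (g (hi i))^-1 * g (lo i) * g (hi i)
             else g k].

Definition hurwitz_sigmaV i g : {ffun 'I_n -> G} :=
  [ffun k => if k == lo i then g (lo i) * g (hi i) * (g (lo i))^-1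
             else if k == hi i then g (lo i)
             else g k].

Lemma lo_neq_hi i : (lo i == hi i) = false.
Proof. by rewrite -val_eqE /= ltn_eqF. Qed.

Lemma hi_neq_lo i : (hi i == lo i) = false.
Proof. by rewrite eq_sym lo_neq_hi. Qed.

Lemma hurwitz_sigmaE i g k : hurwitz_sigma i g k =
  if k == lo i then g (hi i)
  else if k == hi i then (g (hi i))^-1 * g (lo i) * g (hi i) else g k.
Proof. exact: ffunE. Qed.

Lemma hurwitz_sigmaVE i g k : hurwitz_sigmaV i g k =
  if k == lo i then g (lo i) * g (hi i) * (g (lo i))^-1
  else if k == hi i then g (lo i) else g k.
Proof. exact: ffunE. Qed.

Lemma hurwitz_sigmaK i : cancel (hurwitz_sigma i) (hurwitz_sigmaV i).
Proof.
move=> g; apply/ffunP=> k; rewrite hurwitz_sigmaVE !hurwitz_sigmaE !eqxx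
  hi_neq_lo.
case: eqP => [-> | _]; first by rewrite !mulgA mulgV mul1g mulgK.
by case: eqP => [-> | _].
Qed.

Lemma hurwitz_sigmaVK i : cancel (hurwitz_sigmaV i) (hurwitz_sigma i).
Proof.
move=> g; apply/ffunP=> k; rewrite hurwitz_sigmaE !hurwitz_sigmaVE !eqxx
  hi_neq_lo.
case: eqP => [-> // | _].
by case: eqP => [-> | _ //]; rewrite !mulgA mulVg mul1g mulgVK.
Qed.

Definition hurwitz_letter (l : 'I_n.-1 * bool) g :=
  if l.2 then hurwitz_sigma l.1 g else hurwitz_sigmaV l.1 g.

Definition hurwitz_word (w : word 'I_n.-1) g := foldr hurwitz_letter g w.

Lemma hurwitz_far i j g : i.+1 < j ->
  hurwitz_sigma i (hurwitz_sigma j g) = hurwitz_sigma j (hurwitz_sigma i g).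
Proof.
move=> ij; have ne (a b : 'I_n) : a != b :> nat -> (a == b) = false.
  by move=> /negPf; rewrite -val_eqE.
have ll : (lo i == lo j) = false by apply: ne; rewrite /= ltn_eqF // ltnW.
have lh : (lo i == hi j) = false.
  by apply: ne; rewrite /= ltn_eqF // ltnS ltnW // ltnW.
have hl : (hi i == lo j) = false by apply: ne; rewrite /= ltn_eqF.
have hh : (hi i == hi j) = false by apply: ne; rewrite /= ltn_eqF // ltnW.
apply/ffunP=> k; rewrite !hurwitz_sigmaE.
rewrite !(eq_sym (lo j)) !(eq_sym (hi j)) ll lh hl hh.
case: (k =P lo i) => [-> | _]; first by rewrite ll lh.
by case: (k =P hi i) => [-> | _]; first by rewrite hl hh.
Qed.

Lemma hurwitz_near i j g : j = i.+1 :> nat ->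
  hurwitz_sigma i (hurwitz_sigma j (hurwitz_sigma i g)) =
  hurwitz_sigma j (hurwitz_sigma i (hurwitz_sigma j g)).
Proof.
move=> ij; have hl : lo j = hi i by apply: val_inj.
have lh : (lo i == hi j) = false by rewrite -val_eqE /= ij ltn_eqF // ltnS ltnW.
have hh : (hi i == hi j) = false by rewrite -hl lo_neq_hi.
apply/ffunP=> k.
rewrite !hurwitz_sigmaE !hl !(eq_sym (hi j)) !eqxx.
rewrite !hi_neq_lo !lo_neq_hi !lh !hh.
case: (k =P lo i) => [-> | _]; first by rewrite lo_neq_hi lh.
case: (k =P hi i) => [_ | _]; first by rewrite ?invgM ?mulgA.
case: (k =P hi j) => [_ | //].
by rewrite !invgM ?invgK !mulgA ?mulgK ?mulgVK.
Qed.

Lemma hurwitz_word_cong (u v : word 'I_n.-1) :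
  pres_cong (@braid_rel n.-1) u v ->
  forall g, hurwitz_word u g = hurwitz_word v g.
Proof.
elim=> {u v} [//|u v _ IH g|u v w _ IHu _ IHv g
  |u u' v v' _ IHu _ IHv g|i b g|u v].
- by rewrite IH.
- by rewrite IHu.
- by rewrite /hurwitz_word !foldr_cat -!/(hurwitz_word _ _) IHv IHu.
- by case: b; rewrite /hurwitz_word /hurwitz_letter /=
    ?hurwitz_sigmaK ?hurwitz_sigmaVK.
- by case=> i j ij g; [apply: hurwitz_far | apply: hurwitz_near].
Qed.

Definition hurwitz_act (b : braidGroup n) g : {ffun 'I_n -> G} :=
  hurwitz_word (repr (b : presented (@braid_rel n.-1))) g.

Lemma hurwitz_actE (w : word 'I_n.-1) g :
  hurwitz_act (pres_class (@braid_rel n.-1) w) g = hurwitz_word w g.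
Proof. by apply: hurwitz_word_cong; apply: pres_repr. Qed.

Lemma hurwitz_act_gen i g : hurwitz_act (braid_gen i) g = hurwitz_sigma i g.
Proof. exact: hurwitz_actE. Qed.

Lemma hurwitz_act1 g : hurwitz_act 1 g = g.
Proof. exact: hurwitz_actE. Qed.

Lemma hurwitz_actM (b c : braidGroup n) g :
  hurwitz_act (b * c) g = hurwitz_act b (hurwitz_act c g).
Proof.
by rewrite [b * c]/(pres_mul _ _) hurwitz_actE /hurwitz_word foldr_cat.
Qed.

Definition hurwitz_orbit g : set {ffun 'I_n -> G} :=
  [set h | exists b : braidGroup n, h = hurwitz_act b g].

Definition Hur g : set G :=
  [set r | exists2 h, hurwitz_orbit g h & exists k, r = h k].

(* r1 and r2 are the first two coordinates of a tuple h of the orbit, and r is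
   the element r2^-1 r1 r2 of Hur g; the condition i = 0 selects these
   coordinates, so that there is no relation when n < 2. *)
Inductive hurwitz_rel g : relations (Hur g : Type) :=
  | HurwitzRel h i (r1 r2 r : Hur g) :
      hurwitz_orbit g h -> i = 0 :> nat ->
      val r1 = h (lo i) -> val r2 = h (hi i) ->
      val r = (val r2)^-1 * val r1 * val r2 ->
      hurwitz_rel (winv (wgen r2) ++ wgen r1 ++ wgen r2) (wgen r).

Definition hurwitzGroup g : groupType := presented (@hurwitz_rel g).

Definition hurwitz_gen g (r : Hur g) : hurwitzGroup g :=
  pres_gen (@hurwitz_rel g) r.

Lemma Hur_self g k : g k \in Hur g.
Proof.
rewrite inE; exists g; last by exists k.
by exists 1; rewrite hurwitz_act1.
Qed.

Lemma hurwitz_orbit_act g h b :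
  hurwitz_orbit g h -> hurwitz_orbit g (hurwitz_act b h).
Proof. by case=> c ->; exists (b * c); rewrite hurwitz_actM. Qed.

Lemma Hur_conj g h i :
  hurwitz_orbit g h -> (h (hi i))^-1 * h (lo i) * h (hi i) \in Hur g.
Proof.
move=> gh; rewrite inE; exists (hurwitz_act (braid_gen i) h).
  exact: hurwitz_orbit_act.
by exists (hi i); rewrite hurwitz_act_gen ffunE hi_neq_lo eqxx.
Qed.

End Hurwitz.

Section DualArtin.
Variables (n : nat) (Gamma : coxeterGraph n) (mu : {perm 'I_n}).

Definition coxeter_tuple : {ffun 'I_n -> coxeterGroup Gamma} :=
  [ffun k => cox_gen Gamma (mu k)].

(* The dual Artin group of c = s_(mu 0) ... s_(mu (n - 1)). *)
Definition dualArtinGroup : groupType := hurwitzGroup coxeter_tuple.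

Lemma cox_gen_Hur (i : 'I_n) : cox_gen Gamma i \in Hur coxeter_tuple.
Proof. by have := Hur_self coxeter_tuple (mu^-1 i); rewrite ffunE permKV. Qed.

(* The generator [s_i]. *)
Definition dual_gen (i : 'I_n) : dualArtinGroup :=
  hurwitz_gen (exist _ (cox_gen Gamma i) (cox_gen_Hur i)).

(* The canonical epimorphism is the unique homomorphism with this property. *)
Definition is_canonical (phi : artinGroup Gamma -> dualArtinGroup) :=
  forall i : 'I_n, phi (artin_gen Gamma i) = dual_gen i.

End DualArtin.

(* Main.v *)
Require Import Defs.
From HB Require Import structures.
From mathcomp Require Import all_boot all_order all_algebra algC cyclotomic perm.
From mathcomp Require Import boolp classical_sets zify ring.

(* The inverse [s_i] |-> t_i exists as soon as two coordinates of Hurwitz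
   translates of (s_1, ..., s_n) which agree in W also agree after the same
   braids are applied to (t_1, ..., t_n).

   In the universal Coxeter group U = Z/2 * ... * Z/2 a coordinate of a Hurwitz
   translate has a normal form V, a word without repeated letters. The braids act on
   U preserving the cyclic order of the ends of its tree, so that V, seen as an
   arc in the punctured disc, does not cross itself; moreover V determines the
   coordinate in every group. Planarity forces all long alternating subwords of
   V on the same two letters a, b to turn in the same direction, with lengths
   differing by at most 2, and every letter a to have at most one partner b
   with such a subword of length >= m_ab - 1. The m-th power of the half twist about
   a and b, which fixes (t_1, ..., t_n) by the braid relation, replaces the
   subwords of length L on {a, b} by ones of length 2m - L; hence one may assume
   L <= m + 1 throughout. Shortening subwords of length m + 1 to m - 1 then gives
   a word of W in which the only possible braid moves exchange full alternating
   subwords of length m. Such a word is reduced by Tits' theorem, and by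
   Matsumoto's theorem two V with the same value in W differ only by L |-> 2m - L
   and an exchange of a and b. Two V which differ at a pair {a, b} turn in
   opposite directions there, and a half twist power makes them agree. *)

Set Implicit Arguments.
Unset Strict Implicit.
Unset Printing Implicit Defensive.

Local Open Scope group_scope.

(** The bound m >= 5 acts mainly through one inequality. Once V contains an alternating subword on
    {a, b} of length >= m - 1, every maximal alternating subword on {a, b} whose two ends turn in
    the same direction has length >= m - 3 >= 2. Lengths 0 and 1 are thereby excluded: two adjacent
    letters outside {a, b} lie on the same side of the line through a and b, and an isolated a or b
    lies between letters on different sides. Uniqueness of partners and the rigidity of the blocks
    of V follow from these two facts.

    That V determines the coordinate in every group is not formal, since U forgets the signs of
    exponents and cancels squares. Doubling every strand embeds the free group into U, and planarity
    of the doubled arc shows that the free word of a coordinate has no two equal neighbouring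
    letters, whatever their signs.

    Two inductions remain: a half twist power that makes a word with a subword of length >= m + 2
    smaller, and one that reduces the number of blocks in which two normalized words with the same
    value in W differ. *)

Section MorphTheory.
Variables (G H : groupType) (phi : {multiplicative G -> H}).

Lemma morph1 : phi 1 = 1.
Proof. by apply: (mulgI (phi 1)); rewrite -gmulfM !mulg1. Qed.

Lemma morphV a : phi a^-1 = (phi a)^-1.
Proof. by apply: (mulgI (phi a)); rewrite -gmulfM !mulgV morph1. Qed.

End MorphTheory.

(** * Homomorphisms out of presented groups and Hurwitz moves on sequences *)

Section PresentedLift.
Variables (X : choiceType) (R : relations X) (H : groupType) (f : X -> H).

Definition word_eval (w : word X) : H :=
  foldr (fun l r => (if l.2 then f l.1 else (f l.1)^-1) * r) 1 w.

Lemma word_eval_cat u v : word_eval (u ++ v) = word_eval u * word_eval v.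
Proof. by elim: u => [|l u IHu] /=; rewrite ?mul1g // IHu mulgA. Qed.

Lemma word_eval_winv w : word_eval (winv w) = (word_eval w)^-1.
Proof.
elim: w => [|[x b] w IHw]; first by rewrite invg1.
rewrite -cat1s winv_cat word_eval_cat IHw word_eval_cat invgM; congr (_ * _).
by case: b; rewrite /= !mulg1 ?invgK.
Qed.

Hypothesis fR : forall u v, R u v -> word_eval u = word_eval v.

Lemma word_eval_cong u v : pres_cong R u v -> word_eval u = word_eval v.
Proof.
elim=> // {u v} [u v w _ -> //|u u' v v' _ IHu _ IHv|x b].
  by rewrite !word_eval_cat IHu IHv.
by case: b; rewrite /= mulg1 ?mulgV ?mulVg.
Qed.

Definition pres_lift_fun (a : presented R) : H := word_eval (repr a).

Lemma pres_lift_class w : pres_lift_fun (pres_class R w) = word_eval w.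
Proof. exact/word_eval_cong/pres_repr. Qed.

Lemma pres_lift_gen x : pres_lift_fun (pres_gen R x) = f x.
Proof. by rewrite pres_lift_class /= mulg1. Qed.

Lemma pres_classM u v :
  pres_class R (u ++ v) = pres_class R u * pres_class R v.
Proof. by rewrite -[RHS]/(pres_mul _ _) pres_mulE. Qed.

Lemma pres_lift_morph : {morph pres_lift_fun : a b / a * b}.
Proof.
elim/pres_ind=> u; elim/pres_ind=> v.
by rewrite -pres_classM !pres_lift_class word_eval_cat.
Qed.

Lemma pres_lift :
  exists phi : {multiplicative presented R -> H},
    forall x, phi (pres_gen R x) = f x.
Proof.
pose M := isMultiplicative.Build _ _ pres_lift_fun pres_lift_morph.
pose phi : {multiplicative presented R -> H} := HB.pack pres_lift_fun M.
by exists phi => x; apply: pres_lift_gen.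
Qed.

End PresentedLift.

Lemma pres_class_eval (X : choiceType) (R : relations X) (w : word X) :
  pres_class R w = word_eval (pres_gen R) w.
Proof.
elim: w => [//|[x b] w IHw].
rewrite -cat1s pres_classM IHw; congr (_ * _); case: b => //.
by rewrite -[RHS]/(pres_inv _) pres_invE.
Qed.

Lemma word_eval_morph (X : choiceType) (G H : groupType)
  (phi : {multiplicative G -> H}) (f : X -> G) w :
  phi (word_eval f w) = word_eval (phi \o f) w.
Proof.
by elim: w => [|[x []] w IHw] /=; rewrite ?morph1 // gmulfM ?morphV IHw.
Qed.

Fixpoint alt (T : Type) (x y : T) k : seq T :=
  if k is k'.+1 then x :: alt y x k' else [::].

Fixpoint galt (G : groupType) (x y : G) k : G :=
  if k is k'.+1 then x * galt y x k' else 1.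

Definition gprod (G : groupType) (g : nat -> G) (w : seq nat) : G :=
  foldr (fun x r => g x * r) 1 w.

Section GProd.
Variables (G : groupType).
Implicit Types g : nat -> G.

Lemma gprod_cat g u v : gprod g (u ++ v) = gprod g u * gprod g v.
Proof. by elim: u => [|x u IHu] /=; rewrite ?mul1g // IHu mulgA. Qed.

Lemma gprod_alt g x y k : gprod g (alt x y k) = galt (g x) (g y) k.
Proof. by elim: k x y => //= k IHk x y; rewrite IHk. Qed.

Lemma gprod_morph (H : groupType) (phi : {multiplicative G -> H}) g w :
  phi (gprod g w) = gprod (phi \o g) w.
Proof. by elim: w => [|x w IHw] /=; rewrite ?morph1 // gmulfM IHw. Qed.

Lemma word_eval_alt (X : choiceType) (f : X -> G) x y k :
  word_eval f (alt_word (wgen x) (wgen y) k) = galt (f x) (f y) k.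
Proof. by elim: k x y => [//|k IHk] x y; rewrite word_eval_cat IHk /= mulg1. Qed.

End GProd.

Section Hz.
Variable G : groupType.
Implicit Types g : nat -> G.

(* The moves [(k, false)] and [(k, true)] are sigma_k and its inverse. *)
Definition hz (kb : nat * bool) g : nat -> G := fun l =>
  let k := kb.1 in
  if kb.2 then
    if l == k then g k * g k.+1 * (g k)^-1 else if l == k.+1 then g k else g l
  else
    if l == k then g k.+1 else if l == k.+1 then (g k.+1)^-1 * g k * g k.+1
    else g l.

Definition hzs (mv : seq (nat * bool)) g := foldl (fun g kb => hz kb g) g mv.

Definition mvinv (mv : seq (nat * bool)) :=
  rev [seq (kb.1, ~~ kb.2) | kb <- mv].

Lemma hzs_cat mv mv' g : hzs (mv ++ mv') g = hzs mv' (hzs mv g).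
Proof. exact: foldl_cat. Qed.

Lemma hzK k b : cancel (hz (k, b)) (hz (k, ~~ b)).
Proof.
move=> g; apply/funext => l; rewrite /hz /= !eqxx.
have kk : (k.+1 == k) = false by rewrite gtn_eqF.
case: b => /=; rewrite ?eqxx kk; case: eqP => [->|_]; rewrite ?kk //.
- by case: eqP => [->|//]; rewrite !mulgA mulVg mul1g mulgVK.
- by rewrite !mulgA mulgV mul1g mulgK.
- by case: eqP => [->|].
Qed.

Lemma hzsK mv g : hzs (mvinv mv) (hzs mv g) = g.
Proof.
elim: mv g => [//|[k b] mv IHmv] g.
by rewrite /mvinv map_cons rev_cons -cats1 hzs_cat IHmv /= hzK.
Qed.

Lemma mvinvK : involutive mvinv.
Proof.
move=> mv; rewrite /mvinv map_rev revK -map_comp -[RHS]map_id.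
by apply: eq_map => -[k b] /=; rewrite negbK.
Qed.

Lemma hzsVK mv g : hzs mv (hzs (mvinv mv) g) = g.
Proof. by rewrite -{1}[mv]mvinvK hzsK. Qed.

End Hz.

Lemma hz_morph (G H : groupType) (phi : {multiplicative G -> H}) kb g :
  phi \o hz kb g = hz kb (phi \o g).
Proof.
by apply/funext => l; rewrite /hz /=; case: kb.2; case: (l == kb.1) => //;
  case: (l == kb.1.+1); rewrite // ?gmulfM ?morphV.
Qed.

(** Naturality of the braid action: a coordinate is a fixed word in the entries of the tuple. This
    is the bridge between [ucox], the free group, W and arbitrary groups. *)
Lemma hzs_morph (G H : groupType) (phi : {multiplicative G -> H}) mv g :
  phi \o hzs mv g = hzs mv (phi \o g).
Proof. by elim: mv g => [//|kb mv IHmv] g /=; rewrite IHmv hz_morph. Qed.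

(** * The universal Coxeter group and its cyclic order *)

Inductive square_rel : relations nat :=
  | SquareRel x : square_rel (wgen x ++ wgen x) [::].

Definition ucox : groupType := presented square_rel.

Definition us (x : nat) : ucox := pres_gen square_rel x.

Lemma us_sq x : us x * us x = 1.
Proof.
by rewrite -[us x]/(pres_class _ _) -pres_classM; apply/pres_classP/PresRel.
Qed.

Lemma usV x : (us x)^-1 = us x.
Proof. by apply: mulg1_eq; apply: us_sq. Qed.

Lemma us_lift (H : groupType) (f : nat -> H) :
  (forall x, f x * f x = 1) ->
  exists phi : {multiplicative ucox -> H}, forall x, phi (us x) = f x.
Proof.
by move=> fsq; apply: pres_lift => _ _ [x] /=; rewrite mulg1 fsq.
Qed.

(** Van der Waerden's trick: letters act on words without repeated neighbours, and the orbit of the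
    empty word yields the normal form together with its uniqueness. *)
Definition mulL (x : nat) (w : seq nat) :=
  if w is y :: w' then if x == y then w' else x :: w else [:: x].

Definition sqfree := sorted (fun x y : nat => x != y).

Lemma mulL_sqfree x w : sqfree w -> sqfree (mulL x w).
Proof.
case: w => [//|y w] /= ryw; case: eqP => [_|/eqP nxy /=]; last by rewrite nxy.
exact: path_sorted ryw.
Qed.

Lemma mulLK x w : sqfree w -> mulL x (mulL x w) = w.
Proof.
case: w => [|y w] /=; first by rewrite eqxx.
case: eqP => [<-|_ _ /=]; last by rewrite eqxx.
by case: w => [//|z w] /= /andP[/negPf -> _].
Qed.

Definition actw (u : word nat) (w : seq nat) := foldr (fun l => mulL l.1) w u.

Lemma actw_sqfree u w : sqfree w -> sqfree (actw u w).
Proof. by move=> rw; elim: u => //= l u IHu; apply: mulL_sqfree. Qed.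

Lemma actw_cong u v : pres_cong square_rel u v ->
  forall w, sqfree w -> actw u w = actw v w.
Proof.
elim=> // {u v} [u v _ IH w rw|u v x _ IHu _ IHv w rw
  |u u' v v' _ IHu _ IHv w rw|x b w rw|u v].
- by rewrite IH.
- by rewrite IHu ?IHv.
- rewrite /actw !foldr_cat -!/(actw _ _) IHv // IHu //.
  exact: actw_sqfree.
- by rewrite /= mulLK.
- by case=> x w rw /=; rewrite mulLK.
Qed.

Definition nf (u : ucox) : seq nat := actw (repr (u : presented square_rel)) [::].

Lemma nf_class w : nf (pres_class square_rel w) = actw w [::].
Proof. exact/actw_cong/erefl/pres_repr. Qed.

Lemma nf_sqfree u : sqfree (nf u).
Proof. exact: actw_sqfree. Qed.

Lemma nf_us x u : nf (us x * u) = mulL x (nf u).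
Proof.
elim/pres_ind: u => w.
by rewrite -[us x]/(pres_class _ _) -pres_classM !nf_class.
Qed.

Lemma nf1 : nf 1 = [::].
Proof. exact: nf_class. Qed.

Lemma gprod_mulL x w : gprod us (mulL x w) = us x * gprod us w.
Proof.
by case: w => [//|y w] /=; case: eqP => [->|//]; rewrite mulgA us_sq mul1g.
Qed.

Lemma nfK u : gprod us (nf u) = u.
Proof.
elim/pres_ind: u => w; rewrite nf_class pres_class_eval.
elim: w => [//|[x b] w IHw] /=; rewrite gprod_mulL IHw.
by case: b; rewrite // -/(us x) usV.
Qed.

Lemma nf_gprod w : sqfree w -> nf (gprod us w) = w.
Proof.
elim: w => [_|x w IHw rxw]; first exact: nf1.
rewrite /= nf_us IHw; last exact: path_sorted rxw.
by case: w rxw {IHw} => [//|y w] /= /andP[/negPf ->].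
Qed.

Lemma gprod_rev w : gprod us (rev w) = (gprod us w)^-1.
Proof.
elim: w => [|x w IHw]; first by rewrite invg1.
by rewrite rev_cons -cats1 gprod_cat IHw /= mulg1 invgM usV.
Qed.

Lemma sqfree_catl u v : sqfree (u ++ v) -> sqfree u.
Proof. by case: u => [//|a u]; rewrite /sqfree /= cat_path => /andP[]. Qed.

Lemma sqfree_catr u v : sqfree (u ++ v) -> sqfree v.
Proof.
by case: u => [//|a u]; rewrite /sqfree /= cat_path => /andP[_ /path_sorted].
Qed.

Lemma sqfree_rev w : sqfree (rev w) = sqfree w.
Proof.
by rewrite /sqfree rev_sorted; apply: eq_sorted => x y /=; rewrite eq_sym.
Qed.

(* The endpoint of the empty word sits at the base point 0, the side x of the
   fundamental polygon at x.+1. *)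
Definition hd (w : seq nat) := if w is x :: _ then x.+1 else 0.

Definition kc (o : bool) (x y z : nat) : bool :=
  let c x y z := [|| (x < y < z), (y < z < x) | (z < x < y)] in
  if o then c x y z else c z y x.

Lemma kc_rot o x y z : kc o x y z = kc o y z x.
Proof. by rewrite /kc; case: o; lia. Qed.

Lemma kc_asym o x y z : kc o x y z -> kc o x z y = false.
Proof. by rewrite /kc; case: o; lia. Qed.

Lemma kc_opp o x y z : kc (~~ o) x y z = kc o z y x.
Proof. by rewrite /kc; case: o. Qed.

Lemma kc_neq o x y z : kc o x y z -> [/\ x != y, y != z & x != z].
Proof. by rewrite /kc => h; split; move: h; case: o; lia. Qed.

Lemma kc_total o x y z : x != y -> y != z -> x != z -> kc o x y z || kc o x z y.
Proof. by rewrite /kc; case: o; lia. Qed.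

(* Multiplying by a suitable [p] moves the branching point of the three ends to
   the origin, where their order is read off from the first letters. *)
Definition cyc (o : bool) (u v w : ucox) : Prop :=
  exists p, kc o (hd (nf (p * u))) (hd (nf (p * v))) (hd (nf (p * w))).

Lemma cyc_mul o g u v w : cyc o (g * u) (g * v) (g * w) <-> cyc o u v w.
Proof.
split=> [] [p hp]; first by exists (p * g); rewrite -!mulgA.
by exists (p * g^-1); rewrite -!mulgA !mulKg.
Qed.

Lemma cyc_rot o u v w : cyc o u v w <-> cyc o v w u.
Proof.
by split=> [] [p hp]; exists p; [rewrite -kc_rot | rewrite kc_rot].
Qed.

Lemma cyc_opp o u v w : cyc (~~ o) u v w <-> cyc o w v u.
Proof.
by split=> [] [p hp]; exists p; [rewrite -kc_opp | rewrite kc_opp].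
Qed.

Lemma hd_eq_cons w x : hd w = x.+1 -> exists w', w = x :: w'.
Proof. by case: w => [//|y w] [->]; exists w. Qed.

Lemma nf_cat w a u : sqfree (rcons w a) -> hd (nf u) != a.+1 ->
  nf (gprod us (rcons w a) * u) = rcons w a ++ nf u.
Proof.
move=> rwa hu; rewrite -{1}[u]nfK -gprod_cat; apply: nf_gprod.
have := nf_sqfree u; case: (nf u) hu => [|b v] /=; first by rewrite cats0.
move=> hb pb; case: w rwa => [_|c w] /=.
  by rewrite eq_sym -eqSS hb.
by rewrite cat_path => -> /=; rewrite last_rcons eq_sym -eqSS hb.
Qed.

(** Three ends with distinct first letters branch at the origin, and the branching point of three
    ends of a tree is unique: if [p] ends in the letter [a], only an end beginning with [a] can
    cancel against it, so at least two of the three translates begin with the first letter of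
    [p]. *)
Lemma median_uniq o u v w p :
  kc o (hd (nf u)) (hd (nf v)) (hd (nf w)) ->
  kc true (hd (nf (p * u))) (hd (nf (p * v))) (hd (nf (p * w))) ||
  kc false (hd (nf (p * u))) (hd (nf (p * v))) (hd (nf (p * w))) -> p = 1.
Proof.
move=> /kc_neq[uv vw uw] hp.
have {hp}[puv pvw puw] : [/\ hd (nf (p * u)) != hd (nf (p * v)),
    hd (nf (p * v)) != hd (nf (p * w)) & hd (nf (p * u)) != hd (nf (p * w))].
  by case/orP: hp => /kc_neq.
have := nf_sqfree p; rewrite -[p in p = 1]nfK; case/lastP Ep : (nf p) => [//|q a].
move=> rqa; move: puv pvw puw; rewrite -[p]nfK Ep.
have hdc x y : hd (rcons q a ++ x) = hd (rcons q a ++ y) by case: (q).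
case: (eqVneq (hd (nf u)) a.+1) => [ua|/(nf_cat rqa)->].
  case: (eqVneq (hd (nf v)) a.+1) => [va|/(nf_cat rqa)->].
    by rewrite ua va eqxx in uv.
  case: (eqVneq (hd (nf w)) a.+1) => [wa|/(nf_cat rqa)->].
    by rewrite ua wa eqxx in uw.
  by move=> _ /eqP[]; apply: hdc.
case: (eqVneq (hd (nf v)) a.+1) => [va|/(nf_cat rqa)->]; last first.
  by move=> /eqP[]; apply: hdc.
case: (eqVneq (hd (nf w)) a.+1) => [wa|/(nf_cat rqa)->].
  by rewrite va wa eqxx in vw.
by move=> _ _ /eqP[]; apply: hdc.
Qed.

Lemma cyc_hd o u v w : hd (nf u) != hd (nf v) -> hd (nf v) != hd (nf w) ->
  hd (nf u) != hd (nf w) ->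
  cyc o u v w <-> kc o (hd (nf u)) (hd (nf v)) (hd (nf w)).
Proof.
move=> uv vw uw; split=> [[p hp]|h]; last by exists 1; rewrite !mul1g.
have /orP[//|h] := kc_total o uv vw uw.
have p1 : p = 1.
  rewrite kc_rot -kc_rot in h; apply: (@median_uniq (~~ o) u v w).
    by rewrite kc_opp -kc_rot.
  by move: hp; case: (o) => ->; rewrite ?orbT.
by move: hp; rewrite p1 !mul1g.
Qed.

Lemma cyc_asym o u v w : cyc o u v w -> cyc o u w v -> False.
Proof.
move=> [p hp] /(cyc_mul _ p); have [uv vw uw] := kc_neq hp.
by rewrite cyc_hd // 1?eq_sym // (kc_asym hp).
Qed.

Lemma cyc_neq o u v w : cyc o u v w -> [/\ u <> v, v <> w & u <> w].
Proof.
by case=> p /kc_neq[uv vw uw]; split=> [e|e|e]; subst; rewrite eqxx in uv vw uw.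
Qed.

Lemma size_nf_us x u : size (nf (us x * u)) <= (size (nf u)).+1.
Proof. by rewrite nf_us; case: (nf u) => //= y w; case: eqP => //= _; lia. Qed.

Lemma size_nf_us_hd x u : hd (nf u) = x.+1 ->
  (size (nf (us x * u))).+1 = size (nf u).
Proof. by rewrite nf_us => /hd_eq_cons[w ->] /=; rewrite eqxx. Qed.

(** As long as two ends share a first letter, stripping it shortens both and lengthens the third by
    at most one letter, so the total length drops. *)
Lemma cyc_total o u v w : u <> v -> v <> w -> u <> w ->
  cyc o u v w \/ cyc o u w v.
Proof.
have [n] := ubnP (size (nf u) + size (nf v) + size (nf w)).
elim: n u v w => // n IHn u v w lt_n uv vw uw.
have step x u' v' w' : u' <> v' -> hd (nf u') = x.+1 -> hd (nf v') = x.+1 ->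
    size (nf (us x * u')) + size (nf (us x * v')) + size (nf (us x * w')) <
    size (nf u') + size (nf v') + size (nf w').
  move=> _ /size_nf_us_hd <- /size_nf_us_hd <-; have := size_nf_us x w'; lia.
have main x : size (nf (us x * u)) + size (nf (us x * v)) + size (nf (us x * w)) <
    size (nf u) + size (nf v) + size (nf w) -> cyc o u v w \/ cyc o u w v.
  move=> lt; rewrite -(cyc_mul _ (us x)) -(cyc_mul _ (us x) u w).
  by apply: IHn; [lia|..]; move/mulgI.
have hd0 u' : hd (nf u') = 0 -> u' = 1.
  by move=> h0; rewrite -[LHS]nfK; move: h0; case: (nf u').
have share u' v' : u' <> v' -> hd (nf u') = hd (nf v') ->
    exists x, hd (nf u') = x.+1 /\ hd (nf v') = x.+1.
  move=> ne e; case E : (hd (nf u')) => [|x]; last by exists x; rewrite -e.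
  by case: ne; rewrite (hd0 _ E) (hd0 v') // -e.
case: (eqVneq (hd (nf u)) (hd (nf v))) => [/(share _ _ uv)[x [eu ev]]|huv].
  exact/(main x)/step.
case: (eqVneq (hd (nf v)) (hd (nf w))) => [/(share _ _ vw)[x [ev ew]]|hvw].
  by apply/(main x); have := @step x v w u vw ev ew; lia.
case: (eqVneq (hd (nf u)) (hd (nf w))) => [/(share _ _ uw)[x [eu ew]]|huw].
  by apply/(main x); have := @step x u w v uw eu ew; lia.
rewrite !cyc_hd // 1?eq_sym //; exact/orP/kc_total.
Qed.

Lemma hz_sq (G : groupType) (g : nat -> G) kb :
  (forall x, g x * g x = 1) -> forall x, hz kb g x * hz kb g x = 1.
Proof.
move=> gsq x; have cj (a b : G) : a * a = 1 -> b * a * b^-1 * (b * a * b^-1) = 1.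
  by move=> a2; rewrite !mulgA mulgVK -(mulgA b a a) a2 mulg1 mulgV.
rewrite /hz; case: kb.2; case: eqP => // _; rewrite ?cj //; case: eqP => // _ //.
by rewrite -{2 4}[g kb.1.+1]invgK cj.
Qed.

Lemma hz_lift kb : exists phi : {multiplicative ucox -> ucox},
  phi \o us = hz kb us.
Proof.
have [phi phiE] := us_lift (hz_sq kb us_sq).
by exists phi; apply/funext.
Qed.

Section HzOrder.
Variables (i : nat) (phi : {multiplicative ucox -> ucox}).
Hypothesis phiE : phi \o us = hz (i, true) us.

Let phi_us x : phi (us x) =
  if x == i then us i * us i.+1 * us i else if x == i.+1 then us i else us x.
Proof. by rewrite -[phi _]/((phi \o us) x) phiE /hz /= usV. Qed.

(** Since [phi] sends i to i (i+1) i, i+1 to i and fixes the other letters, only a word beginning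
    with i+1 can change its first letter, and then to i. *)
Lemma hz_hd u :
  (hd (nf (phi u)) = hd (nf u) /\
   (hd (nf u) = i.+1 -> exists v, nf (phi u) = [:: i, i.+1 & v])) \/
  (hd (nf u) = i.+2 /\
   exists2 v, nf (phi u) = i :: v & (hd v != i.+1) && (hd v != i.+2)).
Proof.
rewrite -[u in phi u]nfK; move: (nf_sqfree u); elim: (nf u) => [_|x w IHw] /=.
  by left; rewrite morph1 nf1.
move=> rxw; have rw : sqfree w by apply: path_sorted rxw.
rewrite gmulfM phi_us; move: IHw => /(_ rw).
set v := nf (phi _) => IHw.
have e1 : (i.+1 == i) = false by lia.
have e2 : (i == i.+1) = false by lia.
have hwx : hd w != x.+1 by case: (w) rxw => //= y ? /andP[]; rewrite eqSS eq_sym.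
case: (eqVneq x i) => [xi|xi].
  subst x; left; rewrite -!mulgA !nf_us -/v.
  suff [v' ->] : exists v', mulL i (mulL i.+1 (mulL i v)) = [:: i, i.+1 & v'].
    by split => // _; exists v'.
  case: IHw => [[hv _]|[_ [v' -> /andP[h1 h2]]]].
    case: (v) hv => [|y v'] /=; first by rewrite e1 /= e2; eexists.
    move=> hy; have -> : (i == y) = false by apply: contraNF hwx => /eqP->; rewrite -hy.
    by rewrite /= e1 /= e2; eexists.
  rewrite /= eqxx; case: v' h1 h2 => [|y v'] /=; first by rewrite e2; eexists.
  by rewrite !eqSS => h1 h2; rewrite eq_sym (negPf h2) /= e2; eexists.
case: (eqVneq x i.+1) => [xi1|xi1].
  subst x; rewrite nf_us -/v.
  case: IHw => [[hv hi]|[hw]]; last by rewrite hw eqxx in hwx.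
  case: (eqVneq (hd w) i.+1) => [/hi[v' ->]|hwi].
    by left; rewrite /= eqxx; split=> // /eqP; rewrite eqSS gtn_eqF.
  right; split=> //; exists v; last by rewrite hv hwi hwx.
  case: (v) hv => [|y v'] //= hy; case: eqP => // iy; by rewrite -hy iy eqxx in hwi.
left; rewrite nf_us -/v.
have -> : mulL x v = x :: v.
  have : hd v != x.+1.
    by case: IHw => [[-> _]//|[_ [v' -> _]]] /=; rewrite eqSS eq_sym.
  by case: (v) => //= y v'; rewrite eqSS eq_sym => /negPf ->.
by split=> // -[/eqP]; rewrite (negPf xi).
Qed.

(** The keys of i and i+1 are neighbours, so an end moved from i+1 to i keeps its place unless
    another end begins with i. In that case stripping the common letter i puts the latter at i+1,
    the third end at i and the moved end at neither, again in the right order. *)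
Lemma hz_cyc u v w : cyc true u v w -> cyc true (phi u) (phi v) (phi w).
Proof.
have phiM x y : phi (x * y) = phi x * phi y by apply: gmulfM.
case=> p; move: (p * u) (p * v) (p * w) (phiM p u) (phiM p v) (phiM p w).
move=> a b c ea eb ec h.
apply/(cyc_mul _ (phi p)); rewrite -ea -eb -ec.
move: a b c h {ea eb ec p u v w}.
(* The three first letters are distinct, so at most one end changes its first letter; a rotation
   makes it [a]. *)
suff main a b c : kc true (hd (nf a)) (hd (nf b)) (hd (nf c)) ->
    hd (nf b) = hd (nf (phi b)) -> hd (nf c) = hd (nf (phi c)) ->
    (hd (nf c) = i.+1 -> exists v, nf (phi c) = [:: i, i.+1 & v]) ->
    cyc true (phi a) (phi b) (phi c).
  move=> a b c h.
  case: (hz_hd b) => [[hb hb']|[hb _]].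
    case: (hz_hd c) => [[hc hc']|[hc hc']]; first exact: main.
    case: (hz_hd a) => [[ha ha']|[ha ha']]; last first.
      by have [_ _] := kc_neq h; rewrite ha hc eqxx.
    by rewrite -cyc_rot; rewrite -kc_rot in h; apply: (main c a b).
  case: (hz_hd c) => [[hc hc']|[hc _]]; last first.
    by have [_] := kc_neq h; rewrite hb hc eqxx.
  case: (hz_hd a) => [[ha ha']|[ha ha']]; last first.
    by have [] := kc_neq h; rewrite ha hb eqxx.
  by rewrite cyc_rot; rewrite kc_rot in h; apply: (main b c a).
move=> h hb hc hc'.
case: (hz_hd a) => [[ha _]|[ha [v av /andP[v1 v2]]]].
  by exists 1; rewrite !mul1g ha -hb -hc.
have [ab bc ac] := kc_neq h.
case: (eqVneq (hd (nf c)) i.+1) => [ci|ci].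
  have [v' cv] := hc' ci; rewrite -cyc_rot.
  exists (us i); rewrite !nf_us av cv /= !eqxx.
  case Eb : (nf (phi b)) => [|y v''] /=; first by move: v1 v2; rewrite /kc; lia.
  have -> : (i == y) = false.
    by apply: contraNF bc => /eqP e; rewrite hb Eb -e ci.
  by move: v1 v2; rewrite /= /kc; lia.
exists 1; rewrite !mul1g av -hb -hc /=.
have : hd (nf b) != i.+1.
  apply/eqP => bi; move: h; rewrite ha bi /kc; lia.
by move: h ab ac ci bc; rewrite ha /kc; lia.
Qed.

Lemma hz_cyc_iff u v w : cyc true (phi u) (phi v) (phi w) <-> cyc true u v w.
Proof.
split=> [h|]; last exact: hz_cyc.
have [uv vw uw] := cyc_neq h.
have [//|h'] := @cyc_total true u v w (fun e => uv (congr1 phi e))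
  (fun e => vw (congr1 phi e)) (fun e => uw (congr1 phi e)).
by case: (cyc_asym h (hz_cyc h')).
Qed.

End HzOrder.

Lemma hzV_cyc_iff i (phi : {multiplicative ucox -> ucox}) u v w :
  phi \o us = hz (i, false) us ->
  cyc true (phi u) (phi v) (phi w) <-> cyc true u v w.
Proof.
move=> phiE; have [psi psiE] := hz_lift (i, true).
rewrite -(hz_cyc_iff psiE).
have psiK x : psi (phi x) = x.
  rewrite -[x]nfK !gprod_morph; congr (gprod _ _).
  by rewrite phiE hz_morph psiE; apply: (hzK i true).
by rewrite !psiK.
Qed.

(* The arcs from [a] to [b] and from [c] to [d] cross. *)
Definition crossing (a b c d : ucox) : Prop :=
  cyc true a c b /\ cyc true b d a \/ cyc true a d b /\ cyc true b c a.

(** The arc of [u] runs from 1 to [u]; the pairs [w], [w * u] are the other lifts of the same arc to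
    the tree. *)
Definition noncrossing (u : ucox) : Prop :=
  forall w, ~ crossing 1 u w (w * u).

Lemma crossing_mul g a b c d :
  crossing (g * a) (g * b) (g * c) (g * d) <-> crossing a b c d.
Proof. by rewrite /crossing !cyc_mul. Qed.

Lemma noncrossing_hz kb (phi : {multiplicative ucox -> ucox}) u :
  phi \o us = hz kb us -> noncrossing u -> noncrossing (phi u).
Proof.
case: kb => i b phiE ncu w cr.
have [psi psiE] := hz_lift (i, ~~ b).
have cycE x y z : cyc true (psi x) (psi y) (psi z) <-> cyc true x y z.
  by case: (b) psiE => /= psiE; [exact: hzV_cyc_iff psiE | exact: hz_cyc_iff psiE _ _ _].
have psiK x : psi (phi x) = x.
  rewrite -[x]nfK !gprod_morph; congr (gprod _ _).
  by rewrite phiE hz_morph psiE; case: (b); [apply: (hzK i false) | apply: (hzK i true)].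
apply: (ncu (psi w)).
by case: cr => -[/cycE h1 /cycE h2]; [left | right]; move: h1 h2;
  rewrite gmulfM psiK morph1.
Qed.

Lemma nf_inv u : nf u^-1 = rev (nf u).
Proof.
by rewrite -{1}[u]nfK -gprod_rev nf_gprod // sqfree_rev nf_sqfree.
Qed.

Lemma nf_mulr w l : nf (w * us l) = rev (mulL l (rev (nf w))).
Proof.
by rewrite -nf_inv -nf_us -nf_inv invgM invgK usV.
Qed.

Lemma hd_mulr w l : hd (nf w) != 0 -> nf w != [:: l] ->
  hd (nf (w * us l)) = hd (nf w).
Proof.
rewrite nf_mulr; case/lastP: (nf w) => [//|v y] _; rewrite rev_rcons /=.
case: v => [|x v]; first by case: (eqVneq l y) => [->|_]; rewrite ?eqxx.
by move=> _; case: ifP => _; rewrite ?revK // rev_cons -rev_rcons revK.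
Qed.

Lemma cyc_kc o u v w : cyc o u v w -> hd (nf u) != hd (nf v) ->
  hd (nf v) != hd (nf w) -> hd (nf u) != hd (nf w) ->
  kc o (hd (nf u)) (hd (nf v)) (hd (nf w)).
Proof. by move=> h uv vw uw; apply/cyc_hd. Qed.

Lemma nf_us1 x : nf (us x) = [:: x].
Proof. by rewrite -[us x]mulg1 nf_us nf1. Qed.

Lemma hd_neq0 u : u <> 1 -> hd (nf u) != 0.
Proof. by rewrite -{1}[u]nfK; case: (nf u). Qed.

Lemma split_hd u x : hd (nf u) = x.+1 ->
  exists2 v, u = us x * v & hd (nf v) != x.+1.
Proof.
move=> hx; exists (us x * u); first by rewrite mulgA us_sq mul1g.
have := nf_sqfree u; rewrite nf_us; have [w ->] := hd_eq_cons hx.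
by rewrite /= eqxx; case: w => //= y w /andP[]; rewrite eqSS eq_sym.
Qed.

Lemma usK x u : us x * (us x * u) = u.
Proof. by rewrite mulgA us_sq mul1g. Qed.

Lemma noncrossing_us l : noncrossing (us l).
Proof.
(* The edge from [w] to [w * us l] reversed is the edge based at [w * us l]; this turns the second
   kind of crossing into the first. *)
suff main w : cyc true 1 w (us l) -> cyc true (us l) (w * us l) 1 -> False.
  move=> w [[]|[h1 h2]]; first exact: main.
  by apply: (main (w * us l)); rewrite // -mulgA us_sq mulg1.
move=> h1 h2; have [w1 wl _] := cyc_neq h1.
have hw : hd (nf w) != 0 by apply: hd_neq0 => /esym.
case: (eqVneq (hd (nf w)) l.+1) => [/split_hd[z wz hz]|hl].
  move: h1 h2; rewrite wz -!mulgA => /(cyc_mul _ (us l)) + /(cyc_mul _ (us l)).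
  rewrite !usK us_sq mulg1 => h1 h2.
  have z1 : z <> 1 by move=> z1; case: wl; rewrite wz z1 mulg1.
  have hz0 := hd_neq0 z1.
  have zl : hd (nf (z * us l)) = hd (nf z).
    by apply: hd_mulr => //; apply: contraNneq hz => ->.
  have := cyc_kc h1; have := cyc_kc h2; rewrite zl nf1 nf_us1 /=.
  by move: hz hz0; rewrite /kc; lia.
have zl : hd (nf (w * us l)) = hd (nf w).
  by apply: hd_mulr => //; apply: contraNneq hl => ->.
have := cyc_kc h1; have := cyc_kc h2; rewrite zl nf1 nf_us1 /=.
by move: hl hw; rewrite /kc; lia.
Qed.

(** The base case for doubled strands. The keys of [a] and [a.+1] are neighbours, so that no other
    letter fits between them; this settles each case once common prefixes are stripped. *)
Lemma noncrossing_pair a : noncrossing (us a * us a.+1).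
Proof.
set b := a.+1; set u := us a * us b.
have ab : (a == b) = false by rewrite /b; lia.
have nu : nf u = [:: a; b] by rewrite nf_us nf_us1 /= ab.
have nba : nf (us b * us a) = [:: b; a] by rewrite nf_us nf_us1 /= eq_sym ab.
have au : us a * u = us b by rewrite usK.
have hdu w : hd (nf w) != 0 -> hd (nf w) != b.+1 -> nf w <> [:: a] ->
    hd (nf (w * u)) = hd (nf w).
  move=> w0 wb /eqP wa; have e := hd_mulr w0 wa.
  rewrite mulgA hd_mulr ?e //; apply: contraNneq wb => e'.
  by rewrite -e e'.
have hdu' w : hd (nf w) != 0 -> hd (nf w) != b.+1 -> hd (nf w) != a.+1 ->
    hd (nf (w * u)) = hd (nf w).
  by move=> w0 wb wa; apply: hdu => // e; rewrite e eqxx in wa.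
move=> w [[h1 h2]|[h1 h2]].
  have [w1 wu _] := cyc_neq h1.
  have hw : hd (nf w) != 0 by apply: hd_neq0 => /esym.
  case: (eqVneq (hd (nf w)) b.+1) => [wb|wb].
    by have := cyc_kc h1; rewrite nf1 nu wb /= /b /kc; lia.
  case: (eqVneq (hd (nf w)) a.+1) => [/split_hd[z wz hz]|wa]; last first.
    have := cyc_kc h1; have := cyc_kc h2; rewrite hdu' // nf1 nu /=.
    by move: hw wa; rewrite /kc; lia.
  move: h1 h2; rewrite wz -!mulgA => /(cyc_mul _ (us a)) + /(cyc_mul _ (us a)).
  rewrite !usK mulg1 => h1 h2.
  case: (eqVneq (hd (nf z)) b.+1) => [/split_hd[y zy hy]|zb]; last first.
    have := cyc_kc h1; rewrite !nf_us1 /= -/b.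
    by move: zb hz; rewrite /b /kc; lia.
  move: h1 h2; rewrite zy -!mulgA => /(cyc_mul _ (us b)) + /(cyc_mul _ (us b)).
  rewrite !usK us_sq => h1 h2.
  have [_ y1 _] := cyc_neq h1; have hy0 := hd_neq0 y1.
  have := cyc_kc h1; rewrite nba nf1 /= => /(_ _ hy0 isT).
  rewrite eq_sym => /(_ hy) kc1.
  have hya : hd (nf y) != a.+1 by move: kc1; rewrite /b /kc; lia.
  have := cyc_kc h2; rewrite hdu' // nba nf1 /=.
  by move: hy hy0 kc1; rewrite /kc; lia.
have [_ w1 _] := cyc_neq h2.
have hw := hd_neq0 w1.
have [wu1 _ _] := cyc_neq h1.
case: (eqVneq (hd (nf w)) b.+1) => [wb|wb].
  have hwu : hd (nf (w * u)) = b.+1.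
    have wab : hd (nf (w * us a)) = b.+1.
      by rewrite hd_mulr ?wb //; apply/eqP => e; move: wb; rewrite e /= /b; lia.
    rewrite /u mulgA hd_mulr ?wab //; apply/eqP => e; case: wu1.
    by rewrite /u mulgA -[w * us a]nfK e /= mulg1 us_sq.
  by have := cyc_kc h1; rewrite hwu nf1 nu /= /b /kc; lia.
case: (eqVneq (hd (nf w)) a.+1) => [/split_hd[z wz hz]|wa]; last first.
  have := cyc_kc h1; have := cyc_kc h2; rewrite hdu' // nf1 nu /=.
  by move: hw wa; rewrite /kc; lia.
move: h1 h2; rewrite wz -!mulgA => /(cyc_mul _ (us a)) + /(cyc_mul _ (us a)).
rewrite !usK mulg1 => h1 h2.
case: (eqVneq (hd (nf z)) b.+1) => [/split_hd[y zy hy]|zb]; last first.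
  case: (eqVneq (hd (nf z)) 0) => [z0|z0]; last first.
    have := cyc_kc h1; rewrite !nf_us1 hdu' //= -/b.
    by move: zb hz; rewrite /b /kc; lia.
  have z1 : z = 1 by rewrite -[z]nfK; case: (nf z) z0.
  move: h1; rewrite z1 mul1g => /(cyc_mul _ (us a)).
  rewrite us_sq au => /cyc_kc; rewrite nf1 nf_us1 nu /=.
  by rewrite /b /kc; lia.
move: h1 h2; rewrite zy -!mulgA => /(cyc_mul _ (us b)) + /(cyc_mul _ (us b)).
rewrite !usK us_sq => h1 h2.
have [y1 _ _] := cyc_neq h2; have hy0 := hd_neq0 (fun e => y1 (esym e)).
have := cyc_kc h2; rewrite nba nf1 /= => kc2.
case: (eqVneq (nf y) [:: a]) => [ya|ya]; last first.
  have := cyc_kc h1; rewrite hdu //; last exact/eqP.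
  by rewrite nba nf1 /=; move: kc2 hy hy0; rewrite /kc; lia.
move: h1; rewrite -[y]nfK ya /= mulg1 au => /(cyc_mul _ (us b)).
rewrite mulgA us_sq mul1g mulg1 => /cyc_kc; rewrite nf1 !nf_us1 /=.
by rewrite /b /kc; lia.
Qed.

(** * Non-crossing words *)

Section Alt.
Variable T : Type.
Implicit Types x y : T.

Lemma alt_cat x y p q : alt x y (p + q) =
  alt x y p ++ (if odd p then alt y x q else alt x y q).
Proof. by elim: p x y => [//|p IHp] x y /=; rewrite IHp; case: (odd p). Qed.

Lemma size_alt x y p : size (alt x y p) = p.
Proof. by elim: p x y => [//|p IHp] x y /=; rewrite IHp. Qed.

Lemma altS x y p : alt x y p.+1 = rcons (alt x y p) (if odd p then y else x).
Proof. by rewrite -addn1 alt_cat -cats1; case: (odd p). Qed.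

Lemma rev_alt x y p : rev (alt x y p) = if odd p then alt x y p else alt y x p.
Proof.
elim: p x y => [//|p IHp] x y.
by rewrite {1}altS rev_rcons IHp /=; case: (odd p).
Qed.

End Alt.

Definition cycw o (P Q R : seq nat) :=
  cyc o (gprod us P) (gprod us Q) (gprod us R).

Lemma cycw_hd o P Q R : sqfree P -> sqfree Q -> sqfree R ->
  kc o (hd P) (hd Q) (hd R) -> cycw o P Q R.
Proof. by move=> rP rQ rR h; exists 1; rewrite !mul1g !nf_gprod. Qed.

Lemma cycw_cons o a P Q R : cycw o P Q (a :: R) -> cycw o (a :: P) (a :: Q) R.
Proof. by rewrite /cycw /= => h; apply/(cyc_mul _ (us a)); rewrite !usK. Qed.

Lemma sqfree_cons x w : sqfree w -> hd w != x.+1 -> sqfree (x :: w).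
Proof. by case: w => [//|y w] rw; rewrite /= eqSS eq_sym => ->. Qed.

(* [P] follows [a b a ...] for exactly [p] letters and then leaves it by turning
   off on the side determined by [o]. *)
Definition lev o (a b : nat) p (P : seq nat) :=
  sqfree P /\ exists2 Z, P = alt a b p ++ Z &
    kc o (if odd p then b else a).+1 (hd Z) (if odd p then a else b).+1.

Lemma levS o a b p P : lev o a b p.+1 P ->
  exists2 P', P = a :: P' & lev o b a p P'.
Proof.
case=> rP [Z ZP]; rewrite ZP in rP *; move=> k; exists (alt b a p ++ Z) => //.
split; first exact: path_sorted rP.
by exists Z => //; move: k => /=; case: (odd p).
Qed.

Lemma lev_hd o a b p P : lev o a b p P -> 0 < p -> hd P = a.+1.
Proof. by case=> _ [Z -> _]; case: p. Qed.

Lemma lev_mono o a b p p' P P' Q Z : a != b -> p < p' -> lev o a b p P ->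
  sqfree P' -> P' = alt a b p' ++ Z -> sqfree Q -> hd Q = b.+1 -> cycw o P' P Q.
Proof.
elim: p p' a b P P' Q => [|p IHp] [//|p'] a b P P' Q ab lt_p hP rP' eP' rQ hQ.
  have [rP [Z' eP k]] := hP; apply: cycw_hd => //.
  by rewrite eP' hQ eP.
have [P1 -> hP1] := levS hP; rewrite eP' /=; apply: cycw_cons.
rewrite eP' in rP'; apply: (IHp p' b a) => //; first by rewrite eq_sym.
- exact: path_sorted rP'.
- by apply: sqfree_cons; rewrite // hQ eqSS eq_sym.
Qed.

Lemma lev_opp o a b p p' P P' Q : a != b -> lev o a b p P ->
  lev (~~ o) a b p' P' -> sqfree Q -> hd Q = b.+1 -> cycw o P' P Q.
Proof.
elim: p p' a b P P' Q => [|p IHp] [|p'] a b P P' Q ab hP hP' rQ hQ.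
- case: hP => rP [Z eP]; case: hP' => rP' [Z' eP'] /=; rewrite kc_opp => k' k.
  apply: cycw_hd => //; rewrite eP eP' hQ /=; move: k k' ab; rewrite /kc.
  by case: (o); lia.
- case: (hP) => rP [Z eP] k; apply: cycw_hd => //; first by case: hP'.
  by rewrite (lev_hd hP') // hQ eP.
- case: (hP') => rP' [Z' eP'] /=; rewrite kc_opp => k.
  apply: cycw_hd => //; first by case: hP.
  by rewrite (lev_hd hP) // hQ eP' /= -kc_rot.
have [P1 -> hP1] := levS hP; have [P1' -> hP1'] := levS hP'.
apply: cycw_cons; apply: (IHp p' b a) => //; first by rewrite eq_sym.
by apply: sqfree_cons; rewrite // hQ eqSS eq_sym.
Qed.

Section Planar.
Variable V : seq nat.
Hypotheses (Vsq : sqfree V) (Vnc : noncrossing (gprod us V)).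

(* [P] and [Q] are the two ends of the arc [V] seen from one of its vertices. *)
Definition chord (P Q : seq nat) := rev P ++ Q = V \/ rev Q ++ P = V.

Lemma chord_sym P Q : chord P Q -> chord Q P.
Proof. by case; [right | left]. Qed.

Lemma crossing_sym a b c d : crossing a b c d -> crossing b a c d.
Proof. by case=> -[]; [right | left]. Qed.

Lemma crossing_symr a b c d : crossing a b c d -> crossing a b d c.
Proof. by case; [right | left]. Qed.

(** The ends of [V] seen from one of its vertices are 1 and [V] translated by one element, so all
    chords are lifts of a single arc. *)
Lemma chord_nocross P Q P' Q' : chord P Q -> chord P' Q' ->
  ~ crossing (gprod us P') (gprod us Q') (gprod us P) (gprod us Q).
Proof.
suff main A B A' B' : rev A ++ B = V -> rev A' ++ B' = V ->
    ~ crossing (gprod us A') (gprod us B') (gprod us A) (gprod us B).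
  case=> h [] h' cr.
  - exact: (main _ _ _ _ h h').
  - exact/(main _ _ _ _ h h')/crossing_sym.
  - exact/(main _ _ _ _ h h')/crossing_symr.
  - exact/(main _ _ _ _ h h')/crossing_sym/crossing_symr.
move=> AB AB'; move: (Vnc) => /(_ ((gprod us A')^-1 * gprod us A)) nc cr.
apply: nc; apply/(crossing_mul (gprod us A')).
have key C D : rev C ++ D = V -> gprod us C * gprod us V = gprod us D.
  by move=> <-; rewrite gprod_cat gprod_rev mulVKg.
by rewrite mulg1 (key _ _ AB') -!mulgA mulVKg (key _ _ AB) mulVKg.
Qed.

Lemma chord_nocyc o P Q P' Q' : chord P Q -> chord P' Q' ->
  cycw o P' P Q' -> cycw o Q' Q P' -> False.
Proof.
move=> c c' h1 h2; apply: (chord_nocross c c').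
case: o h1 h2 => h1 h2; first by left.
by right; split; apply/(@cyc_opp false).
Qed.

(** Ends read outwards that turn in the same direction leave the axis ... a b a b ... on opposite
    sides, so the arc crosses the axis. An arc following the axis further at both ends is then
    crossed. *)
Lemma chord_lev_nested o a b i j i' j' P Q P' Q' : a != b ->
  chord P Q -> lev o a b i P -> lev o b a j Q ->
  chord P' Q' -> lev o a b i' P' -> lev o b a j' Q' -> i < i' -> j < j' -> False.
Proof.
move=> ab c hP hQ c' hP' hQ' ii jj; apply: (@chord_nocyc o _ _ _ _ c c').
  case: (hP') => rP' [Z eP' _]; apply: (lev_mono ab ii hP rP' eP').
    by case: hQ'.
  exact/(lev_hd hQ')/(leq_ltn_trans _ jj).
case: (hQ') => rQ' [Z eQ' _]; rewrite eq_sym in ab.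
apply: (lev_mono ab jj hQ rQ' eQ'); first by case: hP'.
exact/(lev_hd hP')/(leq_ltn_trans _ ii).
Qed.

(** Both arcs cross the axis, in opposite directions, along overlapping stretches. *)
Lemma chord_lev_opp o a b i j i' j' P Q P' Q' : a != b ->
  chord P Q -> lev o a b i P -> lev o b a j Q ->
  chord P' Q' -> lev (~~ o) a b i' P' -> lev (~~ o) b a j' Q' ->
  0 < i' -> 0 < j' -> False.
Proof.
move=> ab c hP hQ c' hP' hQ' ii jj; apply: (@chord_nocyc o _ _ _ _ c c').
  apply: (lev_opp ab hP hP'); first by case: hQ'.
  exact: lev_hd hQ' jj.
rewrite eq_sym in ab; apply: (lev_opp ab hQ hQ'); first by case: hP'.
exact: lev_hd hP' ii.
Qed.

(** Both arcs have their two ends on one and the same side of the axis; overlapping and shifted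
    against each other, they cross. *)
Lemma chord_lev_mixed o a b i j i' j' P Q P' Q' : a != b ->
  chord P Q -> lev o a b i P -> lev (~~ o) b a j Q ->
  chord P' Q' -> lev o a b i' P' -> lev (~~ o) b a j' Q' ->
  i < i' -> j' < j -> 0 < j' -> False.
Proof.
move=> ab c hP hQ c' hP' hQ' ii jj j0; apply: (@chord_nocyc o _ _ _ _ c c').
  case: (hP') => rP' [Z eP' _]; apply: (lev_mono ab ii hP rP' eP').
    by case: hQ'.
  exact: lev_hd hQ' j0.
case: (hQ) => rQ [Z eQ _]; rewrite eq_sym in ab.
apply/cyc_rot/cyc_rot; rewrite -cyc_opp.
apply: (lev_mono ab jj hQ' rQ eQ); first by case: hP'.
exact/(lev_hd hP')/(leq_ltn_trans _ ii).
Qed.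

(* A maximal alternating subword of length [L], [X] and [Y] being read outwards
   from its two ends, whose ends turn off on the sides [o] and [o']. *)
Definition syl o o' (a b L : nat) (X Y : seq nat) :=
  [/\ V = rev X ++ alt a b L ++ Y, kc o b.+1 (hd X) a.+1 &
      kc o' (if odd L then b else a).+1 (hd Y) (if odd L then a else b).+1].

Lemma syl_chord o o' a b L X Y p : syl o o' a b L X Y -> p <= L ->
  exists P Q, chord P Q /\
    if odd p then lev o a b p P /\ lev o' b a (L - p) Q
    else lev o b a p P /\ lev o' a b (L - p) Q.
Proof.
case=> eV kX kY le_p; exists (rev (alt a b p) ++ X).
exists ((if odd p then alt b a (L - p) else alt a b (L - p)) ++ Y).
have eV' : rev (rev (alt a b p) ++ X) ++
    (if odd p then alt b a (L - p) else alt a b (L - p)) ++ Y = V.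
  by rewrite rev_cat revK eV -!catA; congr (_ ++ _); rewrite catA -alt_cat subnKC.
split; first by left.
have rQ := sqfree_catr (etrans (congr1 sqfree eV') Vsq).
have rP : sqfree (rev (alt a b p) ++ X).
  by rewrite -sqfree_rev; apply: sqfree_catl (etrans (congr1 sqfree eV') Vsq).
rewrite rev_alt; move: rP rQ; rewrite rev_alt.
case: ifP => op rP rQ; split; split=> //; [exists X|exists Y|exists X|exists Y] => //;
  rewrite ?op // oddB // op; move: kY; by case: (odd L).
Qed.

(** If the directions differed, the arc would have both ends on one side of the axis and would cross
    its own translate along the axis. The two cuts, at L - 1 and at 0 or 1, are chosen of equal
    parity so that both chords are read along the axis with the same letters; they are distinct
    because L >= 3. *)
Lemma syl_same_dir o o' a b L X Y : a != b -> syl o o' a b L X Y -> 3 <= L ->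
  o = o'.
Proof.
move=> ab s L3; case: (eqVneq o o') => // /negPf oo'.
have eo : o' = ~~ o by case: (o) (o') oo' => -[].
rewrite {}eo {oo'} in s; exfalso.
have [|P' [Q' [c' h']]] := @syl_chord _ _ _ _ _ _ _ L.-1 s; first lia.
case: (boolP (odd L)) => oL; last first.
  have [|P [Q [c h]]] := @syl_chord _ _ _ _ _ _ _ 1 s; first lia.
  move: h h'; have -> : odd L.-1 = true by lia.
  move=> /= [hP hQ] [hP' hQ'].
  by apply: (chord_lev_mixed ab c hP hQ c' hP' hQ'); lia.
have [|P [Q [c h]]] := @syl_chord _ _ _ _ _ _ _ 0 s; first lia.
move: h h'; have -> : odd L.-1 = false by lia.
move=> /= [hP hQ] [hP' hQ']; rewrite eq_sym in ab.
by apply: (chord_lev_mixed ab c hP hQ c' hP' hQ'); lia.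
Qed.

Definition thr o a b L := exists X Y, syl o o a b L X Y.

Lemma thr_base o a b L : thr o a b L ->
  exists P Q, [/\ chord P Q, lev o a b L P & lev o b a 0 Q].
Proof.
case=> X [Y /syl_chord/(_ (leq0n _))[P [Q [c [hP hQ]]]]].
by exists Q, P; split; [apply: chord_sym | rewrite -[L]subn0 | ].
Qed.

(** If L' >= L + 3, two consecutive cuts lie strictly between L and L', one of each parity. The one
    matching the starting letter makes the longer subword extend beyond the shorter one at both
    ends. *)
Lemma thr_window o a b L L' : a != b -> thr o a b L ->
  thr o a b L' \/ thr o b a L' -> L' <= L + 2.
Proof.
move=> ab /thr_base[P [Q [c hP hQ]]] h; rewrite leqNgt; apply/negP => lt_L.
have [i' oi' /andP[i1 i2]] : exists2 i', odd i' = true & L < i' < L'.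
  case: (boolP (odd L)) => oL; [exists L.+2 | exists L.+1] => //=; lia.
have [i'' oi'' /andP[j1 j2]] : exists2 i', odd i' = false & L < i' < L'.
  case: (boolP (odd L)) => oL; [exists L.+1 | exists L.+2] => //=; lia.
case: h => -[X [Y s]].
  have [|P' [Q' [c']]] := @syl_chord _ _ _ _ _ _ _ i' s; first lia.
  rewrite oi' => -[hP' hQ'].
  by apply: (chord_lev_nested ab c hP hQ c' hP' hQ'); lia.
have [|P' [Q' [c']]] := @syl_chord _ _ _ _ _ _ _ i'' s; first lia.
rewrite oi'' => -[hP' hQ'].
by apply: (chord_lev_nested ab c hP hQ c' hP' hQ'); lia.
Qed.

Lemma thr_dir o o' a b L L' : a != b -> thr o a b L ->
  thr o' a b L' \/ thr o' b a L' -> 2 <= L' -> o = o'.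
Proof.
move=> ab /thr_base[P [Q [c hP hQ]]] h L2; case: (eqVneq o o') => // oo'.
have eo : o' = ~~ o by case: (o) (o') oo' => -[].
rewrite {}eo {oo'} in h; exfalso.
case: h => -[X [Y s]].
  have [|P' [Q' [c' [hP' hQ']]]] := @syl_chord _ _ _ _ _ _ _ 1 s; first lia.
  by apply: (chord_lev_opp ab c hP hQ c' hP' hQ'); lia.
have [|P' [Q' [c' [hP' hQ']]]] := @syl_chord _ _ _ _ _ _ _ 1 s; first lia.
by apply: (chord_lev_opp ab c hP hQ (chord_sym c') hQ' hP'); lia.
Qed.

End Planar.

(** Moves and automorphisms act from different sides: by naturality [phi] maps the tuple
    [hzs mv' us] to [hzs (mv ++ mv') us], so prepending moves amounts to applying [phi]. *)
Lemma hzs_lift mv : exists phi : {multiplicative ucox -> ucox},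
  phi \o us = hzs mv us /\ forall u, noncrossing u -> noncrossing (phi u).
Proof.
elim: mv => [|kb mv [psi [psiE psi_nc]]].
  have [phi phiE] := us_lift us_sq; exists phi; split; first exact/funext.
  move=> u; rewrite -[u]nfK gprod_morph; congr (noncrossing (gprod _ _)).
  exact/esym/funext.
have [phi phiE] := hz_lift kb.
pose f x := phi (psi x).
have fM : {morph f : x y / x * y} by move=> x y; rewrite /f !gmulfM.
pose F : {multiplicative ucox -> ucox} := HB.pack f (isMultiplicative.Build _ _ f fM).
exists F; split; last by move=> u nu; apply/(noncrossing_hz phiE)/psi_nc.
by rewrite /= -phiE -hzs_morph -psiE.
Qed.

Lemma noncrossing_value mv l : noncrossing (hzs mv us l).
Proof.
have [phi [<- phi_nc]] := hzs_lift mv.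
exact/phi_nc/noncrossing_us.
Qed.

Lemma not_sorted (T : Type) (r : rel T) s : ~~ sorted r s ->
  exists p x y q, s = p ++ [:: x, y & q] /\ ~~ r x y.
Proof.
elim: s => [//|x [//|y s] IHs] /=; rewrite negb_and => /orP[nr|/IHs].
  by exists [::], x, y, s.
by case=> p [z [t [q [-> nr]]]]; exists (x :: p), z, t, q.
Qed.

Lemma sorted_adj (T : Type) (r : rel T) p x y q :
  sorted r (p ++ [:: x, y & q]) -> r x y.
Proof.
by case: p => [|z p] /=; [case/andP | rewrite cat_path => /andP[_ /and3P[]]].
Qed.

Lemma strip_prefix (T : eqType) (z : T) q :
  exists j q', q = nseq j z ++ q' /\ ohead q' != Some z.
Proof.
elim: q => [|y q [j [q' [-> hq']]]]; first by exists 0, [::].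
case: (eqVneq y z) => [->|yz]; first by exists j.+1, q'.
by exists 0, (y :: nseq j z ++ q').
Qed.

Lemma strip_suffix (T : eqType) (z : T) q :
  exists j q', q = q' ++ nseq j z /\ ohead (rev q') != Some z.
Proof.
have [j [q' [e hq']]] := strip_prefix z (rev q).
exists j, (rev q'); rewrite revK; split=> //.
by rewrite -[q]revK e rev_cat rev_nseq.
Qed.

(* Cabling: every strand of the free group is doubled, which embeds it into the
   universal Coxeter group by x_k |-> s_(2k) s_(2k+1). *)
Definition cable (G : groupType) (g : nat -> G) : nat -> G :=
  fun l => g l.*2 * g l.*2.+1.

Definition cable_mv (kb : nat * bool) : seq (nat * bool) :=
  let k := kb.1.*2 in
  let m := [:: (k.+1, true); (k, true); (k.+2, true); (k.+1, true)] in
  if kb.2 then m else mvinv m.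

Definition cable_mvs (mv : seq (nat * bool)) := flatten [seq cable_mv kb | kb <- mv].

Lemma cable_hz_true (G : groupType) (g : nat -> G) k :
  cable (hzs (cable_mv (k, true)) g) = hz (k, true) (cable g).
Proof.
apply/funext => l; rewrite /hzs /cable /= /hz /=.
case: (eqVneq l k) => [->|lk].
  have n1 i j : i != j -> (i == j) = false by move/negPf.
  rewrite !eqxx; do ![rewrite n1 ?eqxx; last by lia].
  by rewrite !invgM !mulgA; do ![rewrite mulgVK].
case: (eqVneq l k.+1) => [->|lk1].
  rewrite !doubleS !eqxx; have n1 i j : i != j -> (i == j) = false by move/negPf.
  by do ![rewrite n1 ?eqxx; last by lia].
have n1 i j : i != j -> (i == j) = false by move/negPf.
by do ![rewrite n1; last by lia].
Qed.

Lemma cable_hz (G : groupType) (g : nat -> G) kb :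
  cable (hzs (cable_mv kb) g) = hz kb (cable g).
Proof.
case: kb => k [|]; first exact: cable_hz_true.
rewrite -{2}[g](hzsVK (cable_mv (k, true))) cable_hz_true.
by rewrite (hzK k true).
Qed.

Lemma cable_hzs (G : groupType) (g : nat -> G) mv :
  cable (hzs (cable_mvs mv) g) = hzs mv (cable g).
Proof.
elim: mv g => [//|kb mv IHmv] g.
by rewrite /cable_mvs /= hzs_cat IHmv cable_hz.
Qed.

Definition free_grp : groupType := presented (fun _ _ : word nat => False).
Definition fgen (x : nat) : free_grp := pres_gen _ x.

Lemma free_lift (H : groupType) (f : nat -> H) :
  exists phi : {multiplicative free_grp -> H}, phi \o fgen = f.
Proof.
have [phi phiE] : exists phi : {multiplicative free_grp -> H},
    forall x, phi (fgen x) = f x by apply: pres_lift.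
by exists phi; apply/funext.
Qed.

Definition freely_reduced (e : word nat) :=
  sorted (fun l l' : nat * bool => (l.1 != l'.1) || (l.2 == l'.2)) e.

Lemma freely_reduced_adj p l l' q : freely_reduced (p ++ [:: l, l' & q]) ->
  (l.1 != l'.1) || (l.2 == l'.2).
Proof. exact: sorted_adj. Qed.

Lemma free_reduced_word (f : free_grp) :
  exists2 e, f = word_eval fgen e & freely_reduced e.
Proof.
have ex : exists n, `[< exists2 e, f = word_eval fgen e & size e = n >].
  elim/pres_ind: f => w; exists (size w); apply/asboolP; exists w => //.
  exact: pres_class_eval.
have [n /asboolP[e fe se] min] := ex_minnP ex.
exists e => //; apply/negPn/negP => /not_sorted[p [[x b] [[y c] [q [eq]]]]].
rewrite negb_or negbK /= => /andP[/eqP exy nbc]; subst y.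
suff /min : `[< exists2 e, f = word_eval fgen e & size e = size (p ++ q) >].
  by rewrite -se eq !size_cat /=; lia.
apply/asboolP; exists (p ++ q) => //; rewrite fe eq !word_eval_cat /=.
congr (_ * _); rewrite mulgA -[RHS]mul1g; congr (_ * _).
by case: b c nbc {fe eq} => [] [] //= _; rewrite ?mulgV ?mulVg.
Qed.

Definition cable_word (e : word nat) : seq nat :=
  flatten [seq (if l.2 then [:: l.1.*2; l.1.*2.+1] else [:: l.1.*2.+1; l.1.*2])
          | l <- e].

Lemma cable_wordE e : word_eval (cable us) e = gprod us (cable_word e).
Proof.
elim: e => [//|[x b] e IHe]; rewrite /cable_word /= gprod_cat -IHe.
by congr (_ * _); case: b; rewrite /= mulg1 // /cable invgM !usV.
Qed.

Lemma cable_word_hd e :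
  hd (cable_word e) = if e is (x, b) :: _ then (x.*2 + ~~ b).+1 else 0.
Proof. by case: e => [//|[x []] e] /=; rewrite ?addn0 ?addn1. Qed.

Lemma cable_word_sqfree e : freely_reduced e -> sqfree (cable_word e).
Proof.
elim: e => [//|[x b] e IHe] re; have re' : freely_reduced e by apply: path_sorted re.
rewrite /cable_word /= -/(cable_word e).
have hx y : hd (cable_word e) = y.+1 -> (y == if b then x.*2.+1 else x.*2) = false.
  rewrite cable_word_hd; case: (e) re => [//|[z c] e'] /= /andP[/= xz _] [<-].
  by apply/negP => /eqP; move: xz; case: (b) (c) => [] []; lia.
move: (IHe re') hx; case: (cable_word e) => [|y w] rw hx.
  by case: (b) => /=; rewrite andbT; lia.
have := hx y erefl; move: rw; rewrite /sqfree.
by case: (b) => /= -> /=; rewrite andbT; lia.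
Qed.

(** A maximal run of one signed letter x, of length r >= 2, becomes an alternating subword of length
    2r >= 4 on the doubled letters 2x, 2x+1. No other key lies between these two, so both ends leave
    the axis on the same side, which [syl_same_dir] forbids. *)
Lemma cable_nosquare e : freely_reduced e ->
  noncrossing (gprod us (cable_word e)) -> sqfree [seq l.1 | l <- e].
Proof.
move=> re nc; have sq := cable_word_sqfree re.
rewrite /sqfree sorted_map; apply/negPn/negP => /not_sorted[p [[x b] [[y c] [q [eq]]]]].
rewrite negbK /= => /eqP exy; subst y.
have bc : b = c.
  by move: re; rewrite eq => /freely_reduced_adj; rewrite /= eqxx => /eqP.
subst c.
have [i [p' [ep hp]]] := strip_suffix (x, b) p.
have [j [q' [eq' hq]]] := strip_prefix (x, b) q.
pose r := i + j.+2.
have ee : e = p' ++ nseq r (x, b) ++ q'.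
  by rewrite eq ep eq' /r nseqD /= -!catA.
pose a := if b then x.*2 else x.*2.+1; pose a' := if b then x.*2.+1 else x.*2.
have cn k : cable_word (nseq k (x, b)) = alt a a' k.*2.
  elim: k => [//|k IHk]; rewrite doubleS /= -IHk /cable_word /=.
  by rewrite /a /a'; case: (b).
have cc u v : cable_word (u ++ v) = cable_word u ++ cable_word v.
  by rewrite /cable_word map_cat flatten_cat.
have hY : [&& hd (cable_word q') != a.+1 & hd (cable_word q') != a'.+1].
  rewrite cable_word_hd; case: q' hq ee {eq'} => [//|[z c] q'] /= hq ee.
  have zx : z != x.
    apply/eqP => zx; subst z; case: (eqVneq c b) => [cb|cb].
      by rewrite cb eqxx in hq.
    move: re; rewrite ee /r addnS -addn1 nseqD /= -!catA catA => /freely_reduced_adj.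
    by rewrite /= eqxx /= eq_sym (negPf cb).
  by move: zx; rewrite /a /a'; case: (b) (c) => [] []; lia.
have hX : [&& hd (rev (cable_word p')) != a.+1 & hd (rev (cable_word p')) != a'.+1].
  case/lastP: p' hp ee {ep} => [//|p' [z c]]; rewrite rev_rcons /= => hp ee.
  have zx : z != x.
    apply/eqP => zx; subst z; case: (eqVneq c b) => [cb|cb].
      by rewrite cb eqxx in hp.
    move: re; rewrite ee /r addnS -cats1 -!catA /= => /freely_reduced_adj.
    by rewrite /= eqxx /= (negPf cb).
  have -> : hd (rev (cable_word (rcons p' (z, c)))) = (z.*2 + c).+1.
    by rewrite -cats1 cc rev_cat; case: (c); rewrite ?addn0 ?addn1.
  by move: zx; rewrite /a /a'; case: (b) (c) => [] [] /=; lia.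
have s : syl (cable_word e) b (~~ b) a a' r.*2 (rev (cable_word p')) (cable_word q').
  rewrite /syl odd_double revK ee !cc cn; split=> //.
    by move: hX; rewrite /a /a' /kc; case: (b) => /=; lia.
  by move: hY; rewrite /a /a' /kc; case: (b) => /=; lia.
have aa' : a != a' by rewrite /a /a'; case: (b); lia.
have r3 : 3 <= r.*2 by rewrite /r; lia.
by have := syl_same_dir sq nc aa' s r3; case: (b).
Qed.

Lemma hz_const (G : groupType) (h : G) mv : hzs mv (fun=> h) = fun=> h.
Proof.
elim: mv => [//|[k b] mv IHmv] /=; have -> // : hz (k, b) (fun=> h) = fun=> h.
apply/funext => l; rewrite /hz /= mulgK mulVg mul1g.
by case: b; do 2![case: ifP => // _].
Qed.

(** The free word of the coordinate has no two equal neighbours even after its signs are dropped, so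
    forgetting the signs gives the normal form in [ucox]. Hence it is a single letter, and only its
    sign remains. *)
Lemma value_gen_uniq mv l l' : hzs mv us l = us l' ->
  forall (G : groupType) (g : nat -> G), hzs mv g l = g l'.
Proof.
move=> el; have [e fe re] := free_reduced_word (hzs mv fgen l).
have evE (G : groupType) (g : nat -> G) : hzs mv g l = word_eval g e.
  have [phi phiE] := free_lift g.
  by rewrite -phiE -hzs_morph /= fe word_eval_morph.
have nc : noncrossing (gprod us (cable_word e)).
  rewrite -cable_wordE -evE -cable_hzs.
  have [phi [phiE phi_nc]] := hzs_lift (cable_mvs mv).
  by rewrite -phiE /cable /= -gmulfM; apply/phi_nc/noncrossing_pair.
have sqe := cable_nosquare re nc.
have {}nc : [seq l.1 | l <- e] = [:: l'].
  rewrite -(nf_gprod sqe) -nf_us1 -el evE; congr nf.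
  elim: e {fe re nc sqe evE} => [//|[x b] e IHe] /=; rewrite IHe.
  by case: b; rewrite ?usV.
case: e nc evE {fe re sqe} => [//|[x b] [|//]] /= [->] evE G g.
rewrite evE; case: b evE => evE; rewrite /= mulg1 //.
(* A constant tuple is fixed by all moves; an entry different from its own inverse rules out the
   negative sign. *)
have := evE ucox (fun=> us 0 * us 1); rewrite hz_const /= mulg1 invgM !usV.
by move/(congr1 nf); rewrite !nf_us !nf_us1.
Qed.

(* Undoing [mv'] reduces the comparison of two values to the case where one of
   them is a generator. *)
Lemma value_uniq mv mv' l l' : hzs mv us l = hzs mv' us l' ->
  forall (G : groupType) (g : nat -> G), hzs mv g l = hzs mv' g l'.
Proof.
move=> e G g; have [phi [phiE _]] := hzs_lift (mvinv mv').
have gen : hzs (mvinv mv' ++ mv) us l = us l'.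
  rewrite hzs_cat -phiE -hzs_morph /= e.
  by rewrite -[phi _]/((phi \o hzs mv' us) l') hzs_morph phiE hzsVK.
have := value_gen_uniq gen (hzs mv' g).
by rewrite hzs_cat hzsK.
Qed.

(** * Powers of half twists *)

Section Galt.
Variables (G : groupType) (x y : G).

Lemma galtSS k : galt x y k.+2 = x * y * galt x y k.
Proof. by rewrite /= mulgA. Qed.

Lemma galtSr k : galt x y k.+1 = galt x y k * (if odd k then y else x).
Proof.
suff gen (u v : G) : galt u v k.+1 = galt u v k * (if odd k then v else u) by [].
elim: k u v => [|k IHk] u v; first by rewrite /= mulg1 mul1g.
by have := IHk v u; rewrite /= => ->; rewrite mulgA; case: (odd k).
Qed.

End Galt.

Section HalfTwist.
Variables (a b : nat).

(* The half twist about a disc containing the punctures [a] and [b] only. *)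
Definition half_twist (G : groupType) (g : nat -> G) : nat -> G := fun l =>
  let z := g a * (g b)^-1 in
  if l == a then g a * g b * (g a)^-1 else if l == b then g a
  else if a < l < b then z * g l * z^-1 else g l.

End HalfTwist.

Arguments half_twist a b {G} g l.

Fixpoint half_twist_mv (a d : nat) : seq (nat * bool) :=
  if d is d'.+1 then
    rcons ((a + d'.+1, false) :: half_twist_mv a d') (a + d'.+1, true)
  else [:: (a, true)].

Lemma hzs_half_twist (G : groupType) (g : nat -> G) a d :
  hzs (half_twist_mv a d) g = half_twist a (a + d).+1 g.
Proof.
have nE i j : i != j -> (i == j) = false by move/negPf.
elim: d g => [|d IHd] g.
  rewrite addn0; apply/funext => l; rewrite /hzs /= /hz /half_twist /=.
  case: (l == a) => //; case: (l == a.+1) => //.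
  by have -> : (a < l < a.+1) = false by lia.
rewrite [half_twist_mv _ _]/= -cats1 -cat_cons hzs_cat /= IHd.
set j := a + d.+1; have -> : (a + d).+1 = j by rewrite /j addnS.
apply/funext => l; rewrite /hz /half_twist /=.
case: (eqVneq l a) => [->|la].
  by do ![rewrite nE ?eqxx; last by rewrite /j; lia].
case: (eqVneq l j.+1) => [->|lj1].
  by do ![rewrite nE ?eqxx; last by rewrite /j; lia].
case: (eqVneq l j) => [->|lj].
  do ![rewrite nE ?eqxx; last by rewrite /j; lia].
  have -> : a < j < j.+1 by rewrite /j; lia.
  have -> : (a < j.+1 < j) = false by lia.
  by rewrite !invgM !invgK !mulgA.
do ![rewrite nE ?eqxx; last by rewrite /j; lia].
have -> : (a < l < j.+1) = (a < l < j) by lia.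
by [].
Qed.

Lemma hzs_flatten_nseq (G : groupType) (g : nat -> G) mv k :
  hzs (flatten (nseq k mv)) g = iter k (hzs mv) g.
Proof.
elim: k g => [//|k IHk] g.
by rewrite [flatten _]/= hzs_cat IHk iterSr.
Qed.

Definition twist_mv a b k : seq (nat * bool) :=
  flatten (nseq k (half_twist_mv a (b - a.+1))).

Lemma hzs_twist_mv (G : groupType) (g : nat -> G) a b k : a < b ->
  hzs (twist_mv a b k) g = iter k (half_twist a b) g.
Proof.
move=> ab; rewrite hzs_flatten_nseq; apply: eq_iter => h.
by rewrite hzs_half_twist -addSn subnKC.
Qed.

Section TwistIter.
Variables (G : groupType) (g : nat -> G) (a b : nat).
Hypothesis ab : a < b.

Let P := galt (g a) (g b).
Let Q := galt (g b) (g a).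

(** The conjugator of the points in between is [P k * (Q k)^-1], so the whole k-th power acts
    trivially once the braid relation [P k = Q k] holds. *)
Lemma iter_half_twist k l : iter k (half_twist a b) g l =
  if l == a then P k.+1 * (P k)^-1
  else if l == b then P k * (P k.+1)^-1 * P 2
  else if a < l < b then (P k * (Q k)^-1) * g l * (P k * (Q k)^-1)^-1 else g l.
Proof.
have nE i j : i != j -> (i == j) = false by move/negPf.
elim: k l => [|k IHk] l.
  case: eqP => [->|_]; first by rewrite /P /= !mulg1 invg1 mulg1.
  case: eqP => [->|_]; first by rewrite /P /= !mulg1 mul1g mulKg.
  by rewrite /P /Q /= invg1 !mulg1 invg1 mul1g mulg1 if_same.
rewrite iterS /half_twist !IHk !eqxx.
have -> : (b == a) = false by lia.
have P2 n : P n.+2 = P 2 * P n by rewrite /P galtSS /= mulg1.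
have QE : Q k.+1 = Q k * ((P k.+1)^-1 * P k.+2).
  by rewrite /P /Q galtSr [galt _ _ k.+2]galtSr mulKg /=; case: (odd k).
move: (P2 k) QE; move: (P 2) (P k) (P k.+1) (P k.+2) (Q k) (Q k.+1).
move=> p2 p p' p'' q q' -> ->.
have pE : p' * p^-1 * (p * p'^-1 * p2) = p2.
  by rewrite !mulgA mulgVK mulgV mul1g.
case: (l == a); first by rewrite pE invgM invgK !mulgA.
case: (l == b); first by rewrite invgM !mulgA mulgVK.
case: (a < l < b) => //.
by rewrite !invgM !invgK !mulgA !mulgVK.
Qed.

Lemma iter_half_twist_id k : P k = Q k -> iter k (half_twist a b) g = g.
Proof.
move=> PQ; apply/funext => l; rewrite iter_half_twist.
have PS : P k.+1 = g a * P k by rewrite PQ.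
case: (eqVneq l a) => [->|_]; first by rewrite PS mulgK.
case: (eqVneq l b) => [->|_].
  by rewrite PS invgM mulVKg /P /= mulg1 mulKg.
by rewrite PQ mulgV invg1 mulg1 mul1g if_same.
Qed.

End TwistIter.

(** The generating tuple after a power of the half twist, where [q] is the same power of the
    rotation [us a * us b]. *)
Definition utwist a b (q : ucox) : nat -> ucox := fun l =>
  if (l == a) || (l == b) then q * us l
  else if a < l < b then q * us l * q^-1 else us l.

Lemma utwist1 a b : utwist a b 1 = us.
Proof.
by apply/funext => l; rewrite /utwist invg1 mulg1 !mul1g !if_same.
Qed.

Lemma half_twist_utwist a b q : a < b -> us a * q * us a = q^-1 ->
  commute (us a * us b) q ->
  half_twist a b (utwist a b q) = utwist a b (us a * us b * q).
Proof.
move=> ab aqa qc; apply/funext => l; rewrite /half_twist /utwist !eqxx orbT /=.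
have aq : us a * q = q^-1 * us a by rewrite -aqa -!mulgA us_sq mulg1.
have zE : q * us a * (q * us b)^-1 = us a * us b.
  by rewrite invgM usV !mulgA -(mulgA q) -qc mulgK.
case: (eqVneq l a) => [->|la] /=.
  rewrite invgM usV; have -> : us a * q^-1 = q * us a.
    by rewrite -aqa !mulgA us_sq mul1g.
  rewrite -!mulgA; congr (_); rewrite !mulgA -(mulgA q (us a) q) aq !mulgA.
  by rewrite mulgV mul1g -!mulgA.
case: (eqVneq l b) => [->|lb] /=.
  by rewrite qc -!mulgA us_sq mulg1.
by case: (a < l < b); rewrite // zE !invgM !mulgA.
Qed.

Section UTwist.
Variables (a b : nat).
Hypothesis ab : a < b.
Let rho := us a * us b.

Lemma rotV : rho^-1 = us b * us a.
Proof. by rewrite /rho invgM !usV. Qed.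

Lemma rot_conj k : us a * rho ^+ k * us a = (rho ^+ k)^-1.
Proof.
have ja x : us a * x * us a = x ^ us a by rewrite conjgE usV mulgA.
by rewrite ja conjXg -ja -expVgn rotV /rho mulgA us_sq mul1g.
Qed.

Lemma rot_conjV k : us a * (rho ^+ k)^-1 * us a = rho ^+ k.
Proof. by rewrite -rot_conj !mulgA us_sq mul1g -mulgA us_sq mulg1. Qed.

Lemma iter_utwist k q : us a * q * us a = q^-1 -> commute rho q ->
  iter k (half_twist a b) (utwist a b q) = utwist a b (rho ^+ k * q).
Proof.
move=> aqa qc; elim: k => [|k IHk]; first by rewrite mul1g.
rewrite iterS IHk half_twist_utwist //; first by rewrite expgS mulgA.
  have aq : q * us a = us a * q^-1 by rewrite -aqa !mulgA us_sq mul1g.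
  have ar := rot_conj k.
  have ra : us a * rho ^+ k = (rho ^+ k)^-1 * us a by rewrite -ar -!mulgA us_sq mulg1.
  rewrite mulgA ra -!mulgA (mulgA (us a)) aqa -invgM; congr (_^-1).
  by apply: commute_sym; apply/commute_sym/commuteX/commute_sym.
by apply: commuteM => //; apply: commuteX.
Qed.

(** The sign is the one for which the twist cancels against subwords turning in the direction [o],
    instead of being appended to them. *)
Definition urot (o : bool) m : ucox := if o then (rho ^+ m)^-1 else rho ^+ m.

Lemma utwist_value o m : exists mv,
  hzs mv us = utwist a b (urot o m) /\
  forall (G : groupType) (g : nat -> G),
    galt (g a) (g b) m = galt (g b) (g a) m -> hzs mv g = g.
Proof.
case: o; last first.
  exists (twist_mv a b m); split=> [|G g gm]; rewrite hzs_twist_mv //.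
    rewrite -{1}(utwist1 a b) iter_utwist ?mulg1 ?invg1 ?us_sq //.
    exact: commute1.
  exact: iter_half_twist_id.
exists (mvinv (twist_mv a b m)); split=> [|G g gm].
  rewrite -[RHS](hzsK (twist_mv a b m)) hzs_twist_mv // iter_utwist.
  - by rewrite mulgV utwist1.
  - by rewrite invgK rot_conjV.
  - by apply/commuteV/commuteX.
by rewrite -{1}(iter_half_twist_id ab gm) -hzs_twist_mv // hzsK.
Qed.

End UTwist.

(** * Reduced words of Coxeter groups *)

Section ReflRep.
Import GRing.Theory Num.Theory.
Local Open Scope ring_scope.

Variable M : nat -> nat -> option nat.
Hypothesis Msym : forall x y, M x y = M y x.
Hypothesis Mge2 : forall x y m : nat, x != y -> M x y = Some m -> (2 <= m)%N.

(** For an infinite label any number that is neither zero nor a root of unity would do. The label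
    [Some 0] falls under the same default; it does not occur between distinct letters. *)
Definition root_param (o : option nat) : algC :=
  if o is Some m.+1 then sval (C_prim_root_exists (ltn0Sn m)) else 2%:R.

(* [1 + qc x y] and [1 + qc y x] play the role of the off-diagonal entries of a
   Cartan matrix: their product is 2 + q + q^-1 with q = [qc x y], so the product
   of the reflections [rr x] and [rr y] has eigenvalues q and q^-1. *)
Definition qc (x y : nat) : algC :=
  if (x < y)%N then root_param (M x y) else (root_param (M x y))^-1.

Lemma root_param_unit x y m : x != y -> M x y = Some m ->
  m.-primitive_root (root_param (M x y)).
Proof.
move=> xy Mxy; have := Mge2 xy Mxy; rewrite Mxy; case: m {Mxy} => [//|m] _ /=.
by case: (C_prim_root_exists _).
Qed.

Lemma root_param_neq0 x y : x != y -> root_param (M x y) != 0.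
Proof.
move=> xy; case E : (M x y) => [m|]; last by rewrite /= pnatr_eq0.
rewrite -E; apply/eqP => z0; have h := root_param_unit xy E.
have := prim_expr_order h; have := prim_order_gt0 h; rewrite z0.
by case: m {E h z0} => // m _; rewrite expr0n /= => /esym/eqP; rewrite oner_eq0.
Qed.

Lemma qcV x y : x != y -> qc y x = (qc x y)^-1.
Proof.
by rewrite /qc (Msym y x) neq_ltn => /orP[] h; rewrite h ltnNge ltnW //= invrK.
Qed.

Lemma qc_neq0 x y : x != y -> qc x y != 0.
Proof.
by move=> xy; rewrite /qc; case: ifP => _; rewrite ?invr_eq0 root_param_neq0.
Qed.

Lemma qc_order x y m : x != y -> M x y = Some m -> qc x y ^+ m = 1.
Proof.
move=> xy Mxy; have := prim_expr_order (root_param_unit xy Mxy).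
by rewrite /qc; case: ifP => _ h; rewrite ?exprVn h ?invr1.
Qed.

Lemma qc_finite x y k : x != y -> (0 < k)%N -> qc x y ^+ k = 1 ->
  exists2 m, M x y = Some m & (m <= k)%N.
Proof.
move=> xy k0 qk; have : root_param (M x y) ^+ k = 1.
  move: qk; rewrite /qc; case: ifP => // _; rewrite exprVn => /(congr1 GRing.inv).
  by rewrite invrK invr1.
case E : (M x y) => [m|].
  rewrite -E => /eqP; have h := root_param_unit xy E; rewrite -(prim_order_dvd h).
  by move=> mk; exists m => //; apply: dvdn_leq.
move=> /= /eqP; rewrite -natrX pnatr_eq1 => /eqP.
have := ltn_expl k (isT : (1 < 2)%N); lia.
Qed.

Lemma qc_neq1 x y : x != y -> qc x y != 1.
Proof.
move=> xy; apply/eqP => q1.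
by have [] := qc_finite xy (isT : (0 < 1)%N) q1 => m /(Mge2 xy); lia.
Qed.

(** The contragredient representation: [p] lists the values of a functional on the simple roots. *)
Definition rr (i : nat) (p : nat -> algC) : nat -> algC :=
  fun k => if k == i then - p i else p k + (1 + qc k i) * p i.

Lemma rrK i p : rr i (rr i p) = p.
Proof.
apply/funext => k; rewrite /rr eqxx; case: eqP => [->|_]; first by rewrite opprK.
by rewrite mulrN addrK.
Qed.

Section Pair.
Variables x y : nat.
Hypothesis xy : x != y.
Let q := qc x y.
Let step p := rr x (rr y p).
Let u (p : nat -> algC) := p x + q * p y.
Let v (p : nat -> algC) := p x + p y.

Let stepE p : [/\ step p x = - (p x + (1 + q) * p y),
  step p y = - p y + (1 + q^-1) * (p x + (1 + q) * p y) &
  forall k, k != x -> k != y -> step p k =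
    p k + (1 + qc k y) * p y + (1 + qc k x) * (p x + (1 + q) * p y)].
Proof.
rewrite /step /rr !eqxx (negPf xy) eq_sym (negPf xy) (qcV xy); split=> // k kx ky.
by rewrite (negPf kx) (negPf ky).
Qed.

Let uE p : u (step p) = q * u p.
Proof.
have [sx sy _] := stepE p; rewrite /u sx sy; have := qc_neq0 xy; rewrite -/q.
move=> q0; field.
by [].
Qed.

Let vE p : v (step p) = q^-1 * v p.
Proof.
have [sx sy _] := stepE p; rewrite /v sx sy; have := qc_neq0 xy; rewrite -/q.
move=> q0; field.
by [].
Qed.

Lemma step_iter_u p k : u (iter k step p) = q ^+ k * u p.
Proof. by elim: k => [|k IHk]; rewrite ?mul1r // iterS uE IHk exprS mulrA. Qed.

Let step_iter_v p k : v (iter k step p) = q^-1 ^+ k * v p.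
Proof. by elim: k => [|k IHk]; rewrite ?mul1r // iterS vE IHk exprS mulrA. Qed.

(* [u] and [v] are eigenvectors of the step; every other coordinate becomes
   invariant after subtracting a combination of them. *)
Lemma step_iter_id m p : M x y = Some m -> iter m step p = p.
Proof.
move=> Mxy; have qm := qc_order xy Mxy.
have um : u (iter m step p) = u p by rewrite step_iter_u qm mul1r.
have vm : v (iter m step p) = v p by rewrite step_iter_v exprVn qm invr1 mul1r.
have q0 : q != 0 := qc_neq0 xy.
have q1 : q - 1 != 0 by rewrite subr_eq0 qc_neq1.
have yE p' : p' y = (u p' - v p') / (q - 1) by rewrite /u /v; field.
have ym : iter m step p y = p y by rewrite yE um vm -yE.
have xm : iter m step p x = p x by have := vm; rewrite /v ym => /addIr.
apply/funext => k; case: (eqVneq k x) => [->//|kx].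
case: (eqVneq k y) => [->//|ky].
pose E := 1 + qc k x; pose F := 1 + qc k y + E * (1 + q).
pose al := (F - E) / (q - 1); pose be := E - al.
pose w (p' : nat -> algC) := p' k - al * u p' / (q - 1) + be * v p' * q / (q - 1).
have wE p' : w (step p') = w p'.
  have [_ _ sk] := stepE p'; rewrite /w uE vE sk // /be /al /F /E /u /v.
  by field; rewrite q0 q1.
have wm : w (iter m step p) = w p.
  by elim: (m) => [//|m' IHm]; rewrite iterS wE.
by move: wm; rewrite /w um vm => /addIr/addIr.
Qed.

Lemma step_order k : (0 < k)%N -> (forall p, iter k step p = p) ->
  exists2 m, M x y = Some m & (m <= k)%N.
Proof.
move=> k0 id_k; apply: qc_finite => //.
(* The indicator function of [x] has [u] equal to 1, so the eigenvalue can be read off. *)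
have := step_iter_u (fun l => (l == x)%:R) k; rewrite id_k /u eqxx.
by rewrite eq_sym (negPf xy) mulr0 addr0 mulr1 => <-.
Qed.

End Pair.

End ReflRep.

Section NatCoxeter.
Variable M : nat -> nat -> option nat.
Hypothesis Msym : forall x y, M x y = M y x.
Hypothesis Mge2 : forall x y m : nat, x != y -> M x y = Some m -> 2 <= m.

Inductive ncox_rel : relations nat :=
  | NcoxBraid (x y m : nat) : x != y -> M x y = Some m ->
      ncox_rel (alt_word (wgen x) (wgen y) m) (alt_word (wgen y) (wgen x) m)
  | NcoxSquare x : ncox_rel (wgen x ++ wgen x) [::].

Definition ncox : groupType := presented ncox_rel.
Definition ws (x : nat) : ncox := pres_gen ncox_rel x.

Lemma ws_sq x : ws x * ws x = 1.
Proof.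
rewrite -[ws x]/(pres_class _ _) -pres_classM.
exact/pres_classP/PresRel/NcoxSquare.
Qed.

Lemma wsV x : (ws x)^-1 = ws x.
Proof. by apply: mulg1_eq; apply: ws_sq. Qed.

Lemma ws_braid (x y m : nat) : x != y -> M x y = Some m ->
  galt (ws x) (ws y) m = galt (ws y) (ws x) m.
Proof.
move=> xy Mxy; rewrite -!word_eval_alt -!pres_class_eval.
exact/pres_classP/PresRel/NcoxBraid.
Qed.

Notation wp := (gprod ws).

Lemma wp_class (u : word nat) : wp [seq l.1 | l <- u] = pres_class ncox_rel u.
Proof.
rewrite pres_class_eval; elim: u => [//|[x b] u IHu] /=.
by rewrite IHu; case: b; rewrite // -/(ws x) wsV.
Qed.

Lemma wp_eq_cong u v : wp u = wp v ->
  pres_cong ncox_rel [seq (x, true) | x <- u] [seq (x, true) | x <- v].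
Proof.
move=> uv; apply/pres_classP; rewrite -!wp_class -!map_comp.
by rewrite !map_id_in.
Qed.

Lemma wp_rev u : wp (rev u) = (wp u)^-1.
Proof.
elim: u => [|x u IHu]; first by rewrite invg1.
by rewrite rev_cons -cats1 gprod_cat IHu /= mulg1 invgM wsV.
Qed.

Lemma map_alt_word (x y : nat) k :
  [seq l.1 | l <- alt_word (wgen x) (wgen y) k] = alt x y k.
Proof. by elim: k x y => [//|k IHk] x y /=; rewrite IHk. Qed.

Lemma rr_word_cong u v : wp u = wp v -> forall p,
  foldr (rr M) p u = foldr (rr M) p v.
Proof.
suff main u' v' : pres_cong ncox_rel u' v' -> forall p,
    foldr (rr M) p [seq l.1 | l <- u'] = foldr (rr M) p [seq l.1 | l <- v'].
  move=> /wp_eq_cong/main; rewrite -!map_comp.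
  by rewrite !map_id_in.
elim=> // {u v u' v'} [u v w _ IHu _ IHv p|u u' v v' _ IHu _ IHv p|x b p|u v].
- by rewrite IHu.
- by rewrite !map_cat !foldr_cat IHv IHu.
- by rewrite /= rrK.
case=> [x y m xy Mxy|x] p; last by rewrite /= rrK.
rewrite !map_alt_word.
have revK w p' : foldr (rr M) (foldr (rr M) p' w) (rev w) = p'.
  by elim: w p' => [//|z w IHw] p'; rewrite rev_cons foldr_rcons /= rrK IHw.
have altE k p' : foldr (rr M) p' (alt x y k.*2) =
    iter k (fun p => rr M x (rr M y p)) p'.
  by elim: k p' => [//|k IHk] p'; rewrite doubleS /= IHk.
(* [x y x ...] followed by the reverse of [y x y ...] is [(x y)^m] *)
have := altE m (foldr (rr M) p (alt y x m)).
rewrite (step_iter_id Msym Mge2 xy _ Mxy) -addnn alt_cat foldr_cat.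
have <- : rev (alt y x m) = if odd m then alt y x m else alt x y m.
  by rewrite rev_alt.
by rewrite revK.
Qed.

(** The sole purpose of the representation: the order of a product of two generators is not smaller
    than the label, which cannot be read off the presentation. *)
Lemma ws_order (x y k : nat) : x != y -> 0 < k -> galt (ws x) (ws y) k.*2 = 1 ->
  exists2 m, M x y = Some m & m <= k.
Proof.
move=> xy k0; rewrite -gprod_alt -[1]/(wp [::]) => /rr_word_cong eq.
apply: (step_order Msym Mge2 xy k0) => p; rewrite -[RHS](eq p).
by elim: k {k0 eq} => [//|k IHk]; rewrite iterS IHk doubleS.
Qed.

Lemma wp_parity u v : wp u = wp v -> odd (size u) = odd (size v).
Proof.
suff main u' v' : pres_cong ncox_rel u' v' -> odd (size u') = odd (size v').
  by move=> /wp_eq_cong/main; rewrite !size_map.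
elim=> // {u v u' v'} [u v w _ -> //|u u' v v' _ IHu _ IHv|u v].
  by rewrite !size_cat !oddD IHu IHv.
case=> [x y m _ _|//].
by rewrite -(size_map fst) -[in RHS](size_map fst) !map_alt_word !size_alt.
Qed.

(** The reflections attached to the letters of [w]: the i-th one is the i-th letter conjugated by
    the prefix before it, and multiplying by it on the left deletes that letter. *)
Fixpoint refs (w : seq nat) : seq ncox :=
  if w is x :: w' then ws x :: [seq ws x * t * ws x | t <- refs w'] else [::].

Lemma refs_cat u v :
  refs (u ++ v) = refs u ++ [seq wp u * t * (wp u)^-1 | t <- refs v].
Proof.
elim: u => [|x u IHu] /=.
  by rewrite -[LHS]map_id; apply: eq_map => t; rewrite mul1g invg1 mulg1.
rewrite IHu map_cat -!map_comp; congr (_ :: _ ++ _); apply: eq_map => t /=.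
by rewrite invgM wsV !mulgA.
Qed.

Lemma galt_wsV x y k : (galt (ws x) (ws y) k)^-1 =
  if odd k then galt (ws x) (ws y) k else galt (ws y) (ws x) k.
Proof. by rewrite -gprod_alt -wp_rev rev_alt; case: odd; rewrite gprod_alt. Qed.

Lemma galt_add x y p q : galt (ws x) (ws y) (p + q) = galt (ws x) (ws y) p *
  (if odd p then galt (ws y) (ws x) q else galt (ws x) (ws y) q).
Proof.
by rewrite -gprod_alt alt_cat gprod_cat gprod_alt; case: odd; rewrite gprod_alt.
Qed.

Lemma refs_alt x y m :
  refs (alt x y m) = [seq galt (ws x) (ws y) i.*2.+1 | i <- iota 0 m].
Proof.
elim: m => [//|m IHm]; rewrite altS -cats1 refs_cat IHm -[m.+1]addn1 iotaD map_cat.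
congr (_ ++ _); suff e : wp (alt x y m) * ws (if odd m then y else x) *
    (wp (alt x y m))^-1 = galt (ws x) (ws y) m.*2.+1 by rewrite [LHS]/= e add0n.
have eS : wp (alt x y m) * (if odd m then ws y else ws x) = galt (ws x) (ws y) m.+1.
  by rewrite -addn1 galt_add gprod_alt; case: odd; rewrite /= mulg1.
have -> : ws (if odd m then y else x) = if odd m then ws y else ws x by case: odd.
rewrite eS gprod_alt galt_wsV -addnn -addSn galt_add /=.
by case: (odd m).
Qed.

Lemma galt_refl_braid (x y m i : nat) : x != y -> M x y = Some m -> i < m ->
  galt (ws y) (ws x) i.*2.+1 = galt (ws x) (ws y) (m - i.+1).*2.+1.
Proof.
move=> xy Mxy lt_i; set j := m - i.+1.
have oE k : odd k.*2.+1 by rewrite /= odd_double.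
have e : i.*2.+1 + j.*2.+1 = m + m by rewrite /j; lia.
have := galt_add y x i.*2.+1 j.*2.+1; rewrite oE e galt_add.
have -> : (if odd m then galt (ws x) (ws y) m else galt (ws y) (ws x) m) =
    (galt (ws y) (ws x) m)^-1.
  by rewrite galt_wsV (ws_braid xy Mxy) if_same; case: odd.
rewrite mulgV => /esym/mulg1_eq <-.
by rewrite galt_wsV oE.
Qed.

Lemma refs_alt_braid (x y m : nat) : x != y -> M x y = Some m ->
  refs (alt y x m) = rev (refs (alt x y m)).
Proof.
move=> xy Mxy; rewrite !refs_alt; apply: (@eq_from_nth _ 1) => [|i].
  by rewrite size_rev !size_map.
rewrite size_map size_iota => lt_i.
rewrite nth_rev ?size_map ?size_iota // !(nth_map 0) ?size_iota ?nth_iota ?add0n //;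
  try lia.
exact: galt_refl_braid.
Qed.

Definition refl_parity w t := odd (count_mem t (refs w)).

Lemma count_conj (g t : ncox) s :
  count_mem t [seq g * r * g^-1 | r <- s] = count_mem (g^-1 * t * g) s.
Proof.
rewrite count_map; apply: eq_count => r /=.
by apply/eqP/eqP => [<-|->]; rewrite !mulgA ?mulgV ?mul1g ?mulgK // mulVg mul1g mulgVK.
Qed.

Lemma refl_parity_cat u v t : refl_parity (u ++ v) t =
  refl_parity u t (+) refl_parity v ((wp u)^-1 * t * wp u).
Proof. by rewrite /refl_parity refs_cat count_cat oddD count_conj. Qed.

(** The two sides of a braid relation list the same reflections in opposite orders, and [x x] lists
    one reflection twice; so the parity depends only on the group element. *)
Lemma refl_parity_eq u v : wp u = wp v -> refl_parity u =1 refl_parity v.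
Proof.
suff main u' v' : pres_cong ncox_rel u' v' ->
    refl_parity [seq l.1 | l <- u'] =1 refl_parity [seq l.1 | l <- v'].
  by move=> /wp_eq_cong/main; rewrite -!map_comp !map_id_in.
elim=> // {u v u' v'} [u v _ IH t|u v w _ IHu _ IHv t|u u' v v' cu IHu _ IHv t
  |x b t|u v].
- by rewrite IH.
- by rewrite IHu.
- rewrite !map_cat !refl_parity_cat IHu IHv !wp_class.
  by move/pres_classP: cu => ->.
- rewrite /refl_parity /= ws_sq mul1g; by case: (ws x == t).
case=> [x y m xy Mxy|x] t; rewrite /refl_parity.
  by rewrite !map_alt_word (refs_alt_braid xy Mxy) count_rev.
by rewrite /= ws_sq mul1g; case: (ws x == t).
Qed.

Definition wreduced w := forall v, wp v = wp w -> size w <= size v.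

Lemma refs_delete w t : t \in refs w ->
  exists p y q, w = p ++ y :: q /\ t * wp w = wp (p ++ q).
Proof.
elim: w t => [//|x w IHw] t /=; rewrite inE => /orP[/eqP->|/mapP[r /IHw]].
  by exists [::], x, w; rewrite /= mulgA ws_sq mul1g.
case=> p [y [q [-> rw]]] ->; exists (x :: p), y, q; split=> //=.
by rewrite -rw -!mulgA (mulgA (ws x) (ws x)) ws_sq mul1g.
Qed.

Lemma wreduced_uniq w : wreduced w -> uniq (refs w).
Proof.
move=> rw; apply/negPn/negP.
suff main w' : ~~ uniq (refs w') -> exists2 v, wp v = wp w' & size v < size w'.
  by move=> /main[v /rw]; lia.
elim: w' => [//|x w' IHw] /=; rewrite negb_and negbK => /orP[/mapP[r rw' er]|].
  have xr : ws x \in refs w'.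
    suff -> : ws x = r by [].
    apply: (mulgI (ws x)); apply: (mulIg (ws x)); rewrite -er.
    by rewrite ws_sq mul1g.
  have [p [y [q [ew e]]]] := refs_delete xr.
  by exists (p ++ q); rewrite ?e // ew /= !size_cat /=; lia.
rewrite map_inj_uniq; last by move=> r s /mulIg/mulgI.
by move=> /IHw[v ev lt]; exists (x :: v); rewrite /= ?ev.
Qed.

(** The reflection [ws x] heads the list of the reduced word [x :: v], where it occurs once. By
    invariance of the parity it occurs among the reflections of [w]. *)
Lemma wexchange w x v : wreduced w -> wp w = wp (x :: v) -> size v < size w ->
  exists p y q, w = p ++ y :: q /\ ws x * wp w = wp (p ++ q).
Proof.
move=> rw e lt; apply: refs_delete.
have rv : wreduced (x :: v).
  by move=> v'; rewrite -e => /rw; rewrite /=; lia.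
have := refl_parity_eq e (ws x); rewrite /refl_parity.
rewrite (count_uniq_mem _ (wreduced_uniq rv)) (count_uniq_mem _ (wreduced_uniq rw)).
by rewrite [in RHS]/= inE eqxx /=; case: (_ \in _).
Qed.

Inductive flip : seq nat -> seq nat -> Prop :=
  | Flip p (x y m : nat) q : x != y -> M x y = Some m ->
      flip (p ++ alt x y m ++ q) (p ++ alt y x m ++ q).

Inductive flips : seq nat -> seq nat -> Prop :=
  | FlipsRefl u : flips u u
  | FlipsStep u v w : flip u v -> flips v w -> flips u w.

Lemma flips_trans u v w : flips u v -> flips v w -> flips u w.
Proof. by elim=> // {u v} u v u' f _ IH /IH; apply: FlipsStep. Qed.

Lemma flips_cons x u v : flips u v -> flips (x :: u) (x :: v).
Proof.
elim=> [w|{u v} u v w f _ IH]; first exact: FlipsRefl.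
by apply: FlipsStep IH; case: f => p a b m q ab Mab; apply: (@Flip (x :: p)).
Qed.

(** Take a reduced expression with the longest alternating prefix on x and y, and exchange in the
    letter that does not start it. If the deleted letter lies beyond the prefix, the prefix grows,
    against maximality; if it lies inside, at position i, then the product of the two generators has
    order at most i + 1, and so the prefix contains a full braid word. *)
Lemma two_descents (w : seq nat) (x y : nat) u v : wreduced w -> x != y ->
  wp w = wp (x :: u) -> size u < size w -> wp w = wp (y :: v) ->
  size v < size w ->
  exists m z, [/\ M x y = Some m, wp (alt x y m ++ z) = wp w &
    m + size z = size w].
Proof.
move=> rw xy eu su ev sv.
pose E k := exists z : seq nat, (wp (alt x y k ++ z) = wp w \/ wp (alt y x k ++ z) = wp w)
  /\ k + size z = size w.
have E0 : exists k, `[< E k >].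
  by exists 0; apply/asboolP; exists w; split; [left |].
have Eb k : `[< E k >] -> k <= size w by case/asboolP => z [_ <-]; lia.
have [k /asboolP[z [ez sz]] kmax] := ex_maxnP E0 Eb.
have main (a b : nat) : a != b -> (exists v', wp w = wp (b :: v') /\ size v' < size w) ->
    (forall z', wp (alt b a k.+1 ++ z') = wp w -> k.+1 + size z' = size w -> False) ->
    wp (alt a b k ++ z) = wp w ->
    exists m z', [/\ M a b = Some m, wp (alt a b m ++ z') = wp w &
      m + size z' = size w].
  move=> ab [v' [ev' sv']] bmax eab.
  have rab : wreduced (alt a b k ++ z).
    by move=> w'; rewrite eab => /rw; rewrite size_cat size_alt sz.
  have [||p [c [q [epq epq']]]] := @wexchange _ b v' rab; first by rewrite eab.
    by rewrite size_cat size_alt sz.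
  have spq : size p + (size q).+1 = k + size z.
    by have := congr1 size epq; rewrite !size_cat size_alt /= => ->.
  case: (leqP k (size p)) => [le_k|lt_k].
    have ep : p = alt a b k ++ drop k p.
      have := congr1 (take k) epq; rewrite [LHS]take_size_cat ?size_alt //.
      rewrite take_cat; case: ltnP => [_ ->|ge_k ->]; first by rewrite cat_take_drop.
      have -> : k = size p by lia.
      by rewrite subnn take0 drop_size !cats0.
    case: (bmax (drop k p ++ q)); last by rewrite size_cat size_drop; lia.
    by rewrite /= catA -ep -epq' mulgA ws_sq mul1g eab.
  have ep : p = alt a b (size p).
    have := congr1 (take (size p)) epq; rewrite [RHS]take_size_cat // => <-.
    rewrite -(subnKC (ltnW lt_k)) alt_cat -catA take_size_cat ?size_alt //.
  set i := size p in ep lt_k *.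
  have eb : ws b * wp p * ws c = wp p.
    move: epq'; rewrite epq !gprod_cat /= !mulgA => /mulIg.
    by [].
  have ec : wp p * ws c = galt (ws a) (ws b) i.+1.
    have := congr1 (take i.+1) epq; rewrite take_cat size_alt.
    have -> : take i.+1 (p ++ c :: q) = rcons p c.
      by rewrite -cat_rcons take_size_cat // size_rcons.
    case: ltnP => hk.
      rewrite -{1}(subnKC (ltnW hk)) alt_cat take_size_cat ?size_alt // => e.
      by rewrite -gprod_alt e -cats1 gprod_cat /= mulg1.
    have -> : k = i.+1 by lia.
    rewrite subnn take0 cats0 => e.
    by rewrite -gprod_alt e -cats1 gprod_cat /= mulg1.
  have ord : galt (ws b) (ws a) i.+1.*2 = 1.
    have -> : i.+1.*2 = i.+2 + i by lia.
    have e : galt (ws b) (ws a) i.+2 = galt (ws a) (ws b) i.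
      by rewrite -[LHS]/(ws b * galt (ws a) (ws b) i.+1) -ec mulgA eb ep gprod_alt.
    by rewrite galt_add e /= negbK -galt_wsV mulgV.
  have [m Mba le_m] : exists2 m, M b a = Some m & m <= i.+1.
    by apply: ws_order ord; rewrite 1?eq_sym.
  exists m, ((if odd m then alt b a (k - m) else alt a b (k - m)) ++ z).
  rewrite Msym catA -alt_cat subnKC; last by lia.
  split=> //; rewrite size_cat; case: odd; rewrite size_alt; lia.
have bnd a b z' : (a = x /\ b = y) \/ (a = y /\ b = x) ->
    wp (alt b a k.+1 ++ z') = wp w -> k.+1 + size z' = size w -> False.
  move=> ab e se; suff /kmax : `[< E k.+1 >] by lia.
  by apply/asboolP; exists z'; split=> //; case: ab e => -[-> ->]; [right | left].
case: ez => ez.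
  apply: (main x y) ez => //; first by exists v.
  by move=> z'; apply: bnd; left.
have yx : y != x by rewrite eq_sym.
have bxy z' := @bnd y x z' (or_intror (conj erefl erefl)).
have [m [z' [Mm em sm]]] := main y x yx (ex_intro _ u (conj eu su)) bxy ez.
exists m, z'; rewrite Msym; split=> //.
by rewrite -em !gprod_cat !gprod_alt (ws_braid xy) // Msym.
Qed.

(** When the first letters differ, [two_descents] provides two expressions, one with each first
    letter, that are related by a single flip; the tails are compared by induction. *)
Lemma matsumoto u v : wreduced u -> wreduced v -> wp u = wp v -> flips u v.
Proof.
have tl x w : wreduced (x :: w) -> wreduced w.
  by move=> r w' e; have := r (x :: w'); rewrite /= e; apply.
have [n] := ubnP (size u); elim: n u v => // n IHn u v lt_n ru rv e.
have suv : size u = size v by have := ru _ (esym e); have := rv _ e; lia.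
case: u v ru rv lt_n e suv => [|x u] [|y v] // ru rv lt_n e.
  by move=> _; apply: FlipsRefl.
case=> suv.
case: (eqVneq x y) => [exy|xy].
  subst y; apply: flips_cons; apply: IHn => //; first exact: tl ru.
    exact: tl rv.
  by move: e => /= /mulgI.
have [||m [z [Mm ez sz]]] := two_descents ru xy erefl _ e; rewrite //= ?suv //.
have redz w : wp w = wp (x :: u) -> size w = (size u).+1 -> wreduced w.
  by move=> ew sw w'; rewrite ew sw => /ru.
have m2 := Mge2 xy Mm; case: m m2 Mm ez sz => [//|m] _ Mm ez sz.
have ez' : wp (alt y x m.+1 ++ z) = wp (x :: u).
  by rewrite -ez !gprod_cat !gprod_alt (ws_braid xy Mm).
have r1 : wreduced (alt x y m.+1 ++ z).
  by apply: redz => //; rewrite size_cat size_alt.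
have r2 : wreduced (alt y x m.+1 ++ z).
  by apply: redz => //; rewrite size_cat size_alt.
apply: (@flips_trans _ (alt x y m.+1 ++ z)).
  apply: flips_cons; apply: IHn => //; [exact: tl ru | exact: tl r1 |].
  by move: ez => /= /mulgI.
apply: (@flips_trans _ (alt y x m.+1 ++ z)).
  exact/(FlipsStep (Flip [::] z xy Mm))/FlipsRefl.
apply: flips_cons; apply: IHn; [by rewrite size_cat size_alt; move: sz lt_n => /=; lia
  | exact: tl r2 | exact: tl rv |].
by move: ez'; rewrite e /= => /mulgI.
Qed.

(** If [x :: w] were not reduced while [w] is, parity and exchange would give a reduced expression
    of [w] starting with x; Matsumoto's theorem then flips [x :: w] to a word starting with x x. *)
Lemma tits_reduced w : (forall w', flips w w' -> sqfree w') -> wreduced w.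
Proof.
elim: w => [_ //|x w IHw] sq.
have rw : wreduced w.
  apply: IHw => w' /(flips_cons x)/sq; exact: path_sorted.
move=> v ev; rewrite leqNgt; apply/negP => lt_v.
have lt : size v < size w.
  have := wp_parity ev => /=; have : size v <= size w by [].
  rewrite leq_eqVlt => /orP[/eqP->|//]; by case: odd.
have e : wp w = wp (x :: v) by rewrite /= ev /= mulgA ws_sq mul1g.
have [p [y [q [ew eq]]]] := wexchange rw e lt.
have e' : wp w = wp (x :: p ++ q) by rewrite /= -eq mulgA ws_sq mul1g.
have : flips (x :: w) [:: x, x & p ++ q].
  apply/flips_cons/matsumoto => //; move=> w'; rewrite -e' => /rw.
  by rewrite ew /= !size_cat /=; lia.
by move/sq; rewrite /sqfree /= eqxx.
Qed.

End NatCoxeter.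

(** * Alternating blocks *)

Section Blocks.
Local Open Scope nat_scope.
(* [pi] exchanges partners and fixes the other letters. *)
Variable pi : nat -> nat.
Hypothesis piK : involutive pi.
Implicit Types (x y c : nat) (V p q : seq nat) (B : seq (nat * nat)).

(** A canonical representative of the pair of [x], which makes belonging to the same pair an
    equation. *)
Definition cl x := minn x (pi x).

Lemma clE x y : (cl x == cl y) = (x == y) || (x == pi y).
Proof.
rewrite /cl; apply/eqP/orP => [e|[/eqP->//|/eqP->]]; last by rewrite piK minnC.
have : [|| x == y, x == pi y, pi x == y | pi x == pi y] by lia.
case/or4P => [->|->|/eqP<-|/eqP/(can_inj piK)->]; first by left.
- by right.
- by right; rewrite piK.
- by left.
Qed.

Lemma cl_pi x : cl (pi x) = cl x.
Proof. by apply/eqP; rewrite clE eqxx orbT. Qed.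

(* A block [(c, L)] stands for the alternating word [c, pi c, c, ...] of length
   [L]. *)
Definition bw B := flatten [seq alt b.1 (pi b.1) b.2 | b <- B].

Definition wf_block (b : nat * nat) := (0 < b.2) && ((pi b.1 == b.1) ==> (b.2 == 1)).

Definition wf B := all wf_block B && sorted (fun b b' => cl b.1 != cl b'.1) B.

Fixpoint dec V : seq (nat * nat) :=
  if V is x :: V' then
    if dec V' is (c, L) :: B then
      if (c == pi x) && (c != x) then (x, L.+1) :: B else (x, 1) :: (c, L) :: B
    else [:: (x, 1)]
  else [::].

Lemma bw_cat B B' : bw (B ++ B') = bw B ++ bw B'.
Proof. by rewrite /bw map_cat flatten_cat. Qed.

Lemma bw_dec V : bw (dec V) = V.
Proof.
elim: V => [//|x V IHV] /=; case E : (dec V) IHV => [|[c L] B] /= <- //.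
by case: ifP => [/andP[/eqP-> _]|_] //; rewrite /bw /= piK.
Qed.

Lemma dec_hd V c L B : dec V = (c, L) :: B -> exists V', V = c :: V'.
Proof.
case: V => [//|x V] /=; case: (dec V) => [|[d K] B'] /=.
  by case=> -> _ _; exists V.
by case: ifP => _ [-> _ _]; exists V.
Qed.

Lemma wf_cons b B : wf (b :: B) =
  [&& wf_block b, wf B & if B is b' :: _ then cl b.1 != cl b'.1 else true].
Proof.
rewrite /wf /=; case: B => [|b' B] /=; first by rewrite !andbT.
by rewrite -!andbA; do !bool_congr.
Qed.

Lemma dec_wf V : sqfree V -> wf (dec V).
Proof.
elim: V => [//|x V IHV] sV; have := IHV (path_sorted sV).
case E : (dec V) => [|[c L] B] wB; rewrite /= E.
  by rewrite wf_cons /wf_block /= implybT.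
have [V' eV] := dec_hd E; move: sV; rewrite eV /= => /andP[xc _].
move: (wB); rewrite wf_cons => /and3P[/andP[/= L0 wL] wB' hB].
case: ifP => [/andP[/eqP cx c_x]|nc].
  rewrite wf_cons wB' /wf_block /=.
  have -> : cl x = cl c by rewrite cx cl_pi.
  by rewrite hB andbT; apply/implyP => /eqP e; move: c_x; rewrite cx e eqxx.
rewrite wf_cons wB /wf_block /= implybT clE negb_or xc /=.
by apply: contraFN nc => /eqP e; rewrite {1}e piK eqxx eq_sym.
Qed.

Lemma bw_hd b B : 0 < b.2 -> exists V', bw (b :: B) = b.1 :: V'.
Proof. by case: b => c [//|L] _; rewrite /bw /=; eexists. Qed.

Lemma dec_alt c L B : pi c != c -> 0 < L ->
  (if B is b :: _ then cl c != cl b.1 else true) -> wf B -> dec (bw B) = B ->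
  dec (alt c (pi c) L ++ bw B) = (c, L) :: B.
Proof.
move=> pc; elim: L c pc => [//|[|L] IHL] c pc _ hB wB dB.
  rewrite /= dB; case: B hB {IHL wB dB} => [//|[d K] B] /=.
  rewrite clE negb_or => /andP[_ h]; have -> // : (d == pi c) = false.
  by apply: contraNF h => /eqP->; rewrite piK.
have := IHL (pi c); rewrite piK eq_sym => /(_ pc isT) ih.
rewrite -[alt c (pi c) L.+2]/(c :: alt (pi c) c L.+1) cat_cons.
have {}ih := ih _ wB dB; cbn [dec]; rewrite ih; last by rewrite cl_pi.
by rewrite eqxx pc.
Qed.

Lemma dec_bw B : wf B -> dec (bw B) = B.
Proof.
elim: B => [//|[c L] B IHB]; rewrite wf_cons => /and3P[/andP[/= L0 wL] wB hB].
rewrite /bw /= -/(bw B); case: (eqVneq (pi c) c) wL => [pc /eqP L1|pc _].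
  rewrite L1 /= IHB //; case: B hB {IHB wB} => [//|[d K] B] /=.
  rewrite clE negb_or => /andP[h _]; by rewrite pc eq_sym (negPf h).
by apply: dec_alt => //; apply: IHB.
Qed.

Lemma wf_catr B B' : wf (B ++ B') -> wf B'.
Proof.
rewrite /wf all_cat => /andP[/andP[_ ->]] /=; case: B => [//|b B] /=.
by rewrite cat_path => /andP[_ /path_sorted].
Qed.

Lemma bw_sqfree B : wf B -> sqfree (bw B).
Proof.
elim: B => [//|[c L] B IHB]; rewrite wf_cons => /and3P[/andP[/= L0 wL] wB hB].
rewrite /bw /= -/(bw B); move: (IHB wB) => sB.
have hne d : cl d = cl c -> hd (bw B) != d.+1.
  move=> dc; case: B hB wB {IHB sB} => [//|b B] hB.
  rewrite wf_cons => /and3P[/andP[b0 _] _ _].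
  have [V' ->] := bw_hd B b0; rewrite /= eqSS eq_sym.
  by apply: contraNneq hB => <-; rewrite dc.
case: (eqVneq (pi c) c) wL => [pc /eqP->|pc _] /=.
  by apply: sqfree_cons => //; apply: hne.
elim: L c pc hne {L0 hB} => [//|L IHL] c pc hne /=.
have pc' : pi (pi c) != pi c by rewrite piK eq_sym.
have := IHL _ pc'; rewrite piK => ih.
apply: sqfree_cons; first by apply: ih => d; rewrite cl_pi; apply: hne.
case: L {IHL ih} => [|L] /=; [exact: hne | by rewrite eqSS].
Qed.

Lemma locate B p q : wf B -> bw B = p ++ q -> q != [::] ->
  exists B1 c L B2 i, [/\ B = B1 ++ (c, L) :: B2, i < L,
    p = bw B1 ++ alt c (pi c) i &
    q = (if odd i then alt (pi c) c (L - i) else alt c (pi c) (L - i)) ++ bw B2].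
Proof.
elim: B p => [|[c L] B IHB] p; first by case: p => [|? ?] //= _ <-.
rewrite wf_cons => /and3P[/andP[/= L0 _] wB _]; rewrite /bw /= -/(bw B) => e q0.
case: (ltnP (size p) L) => [lt_p|le_p].
  exists [::], c, L, B, (size p).
  have eL : L = size p + (L - size p) by rewrite subnKC // ltnW.
  move: e; rewrite {1}eL alt_cat -catA => /eqP; rewrite eqseq_cat ?size_alt //.
  by move=> /andP[/eqP <- /eqP <-]; split; rewrite // size_alt.
have ep : p = alt c (pi c) L ++ drop L p.
  have := congr1 (take L) e; rewrite take_size_cat ?size_alt // takel_cat //.
  by move=> ->; rewrite cat_take_drop.
move: e; rewrite ep -catA => /eqP; rewrite eqseq_cat // eqxx => /eqP e.
have [B1 [d [K [B2 [i [-> lt_i eD eq]]]]]] := IHB _ wB e q0.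
by exists ((c, L) :: B1), d, K, B2, i; split; rewrite // /bw /= -catA eD.
Qed.

Lemma bw_single B y v q : wf B -> bw B = [:: y, v & q] -> cl y != cl v ->
  exists2 B', B = (y, 1) :: B' & bw B' = v :: q.
Proof.
case: B => [//|[c [|[|L]]] B]; rewrite wf_cons => /and3P[/andP[/= L0 _] wB _] //.
  by case=> -> e _; exists B.
by rewrite /bw /= => -[-> <- _]; rewrite cl_pi eqxx.
Qed.

Lemma bw_singles B x y k q : wf B -> bw B = alt y x k.+1 ++ q -> cl x != cl y ->
  exists B', B = [seq (z, 1) | z <- alt y x k] ++ B' /\
    bw B' = (if odd k then x else y) :: q.
Proof.
elim: k B x y => [|k IHk] B x y wB e xy; first by exists B; rewrite e.
have yx : cl y != cl x by rewrite eq_sym.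
have [B' eB eB'] := bw_single wB e yx; rewrite eB wf_cons in wB.
have [_ wB' _] := and3P wB; have [B'' [eB'' e'']] := IHk B' y x wB' eB' yx.
by exists B''; rewrite eB eB'' e'' /=; case: odd.
Qed.

Lemma cl_alt c i : cl (if odd i then pi c else c) = cl c.
Proof. by case: odd; rewrite ?cl_pi. Qed.

Lemma alt_other c i L : (if odd i then alt (pi c) c L else alt c (pi c) L) =
  alt (if odd i then pi c else c) (pi (if odd i then pi c else c)) L.
Proof. by case: odd; rewrite ?piK. Qed.

Lemma wf_adj B1 b b' B2 : wf (B1 ++ [:: b, b' & B2]) -> cl b.1 != cl b'.1.
Proof. by move/wf_catr; rewrite wf_cons => /and3P[]. Qed.

(** Neighbouring blocks belong to different pairs, so an alternating subword on partners cannot run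
    over the end of a block. *)
Lemma locate_block B p q x k : wf B -> pi x != x -> 0 < k ->
  bw B = p ++ alt x (pi x) k ++ q ->
  exists B1 c L B2 i, [/\ B = B1 ++ (c, L) :: B2, i + k <= L,
    p = bw B1 ++ alt c (pi c) i & x = if odd i then pi c else c].
Proof.
move=> wB px k0 e; have ne : alt x (pi x) k ++ q != [::] by case: (k) k0.
have [B1 [c [L [B2 [i [eB lt_i ep eq]]]]]] := locate wB e ne.
exists B1, c, L, B2, i; rewrite alt_other in eq.
have ex : x = if odd i then pi c else c.
  have L0 : 0 < L - i by lia.
  by move: eq; case: (k) k0 => // k' _; case: (L - i) L0 => // L' _ [].
split=> //; rewrite -ex in eq; rewrite leqNgt; apply/negP => lt_L.
have ek : k = (L - i) + (k - (L - i)) by lia.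
have k1 : 0 < k - (L - i) by lia.
move: eq; rewrite ek alt_cat -catA => /eqP; rewrite eqseq_cat //.
rewrite eqxx /= alt_other => /eqP.
case: B2 eB => [|[d K] B2] eB; first by case: (k - _) k1.
have [L0 | K0] := posnP K.
  by move: wB; rewrite eB => /wf_catr; rewrite !wf_cons L0 /wf_block /= andbF.
have [V' ->] := bw_hd B2 (K0 : 0 < (d, K).2); case: (k - _) k1 => // k' _ [ed _].
move: wB; rewrite eB => /wf_adj /=; rewrite -ed.
by case: odd; rewrite ?cl_pi ex cl_alt eqxx.
Qed.

Section Thin.
Variable M : nat -> nat -> option nat.
Hypothesis Msym : forall x y, M x y = M y x.
Hypothesis Mge5 : forall x y m : nat, x != y -> M x y = Some m -> 5 <= m.

Let bl B i := nth (0, 0) B i.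

(* The three conditions leave no room for a braid move other than the exchange of
   the letters of a single full block. *)
Definition thinK B := forall i, i.+2 < size B -> (bl B i.+1).2 = 1 ->
  pi (bl B i.+1).1 != (bl B i.+1).1 -> cl (bl B i).1 != cl (bl B i.+2).1.

Definition thinS B := forall x y m, x != y -> pi x = x -> pi y = y ->
  M x y = Some m -> forall i, i + m.-1 <= size B ->
  ~ forall j, j < m.-1 -> bl B (i + j) = (if odd j then y else x, 1).

Definition thinL B := forall i, i < size B -> pi (bl B i).1 != (bl B i).1 ->
  exists2 m, M (bl B i).1 (pi (bl B i).1) = Some m & (bl B i).2 <= m.

(** Blocks of length 1 must agree exactly, because [thinK] and [thinS] inspect only those; of the
    other blocks only the pair matters. *)
Definition brel (b b' : nat * nat) :=
  [/\ cl b.1 = cl b'.1, 0 < b'.2 & b.2 = 1 \/ b'.2 = 1 -> b = b'].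

Definition bsim B B' := size B = size B' /\
  forall i, i < size B -> brel (bl B i) (bl B' i).

Lemma pi_fix_cl x y : cl x = cl y -> pi x = x -> y = x.
Proof.
move=> /eqP; rewrite clE => /orP[/eqP->//|/eqP e] px.
by rewrite -[y]piK -e px.
Qed.

Lemma bsim_wf B B' : bsim B B' -> wf B -> wf B'.
Proof.
case=> sB rB /andP[/allP aB /(sortedP (0, 0)) sortB]; apply/andP; split.
  apply/(all_nthP (0, 0)) => i; rewrite -sB => lt_i.
  have [e L0 h] := rB i lt_i; rewrite /wf_block; apply/andP; split=> //.
  have /andP[_ /implyP w] := aB _ (mem_nth (0, 0) lt_i).
  apply/implyP => /eqP px; have e1 := pi_fix_cl (esym e) px.
  have /eqP L1 : (bl B i).2 == 1 by apply: w; rewrite -/(bl B i) e1 px.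
  by rewrite -/(bl B' i) -(h (or_introl L1)) L1.
apply/(sortedP (0, 0)) => i; rewrite -sB => lt_i.
have [e _ _] := rB i (ltnW lt_i); have [e' _ _] := rB _ lt_i.
by rewrite -/(bl B' i) -/(bl B' i.+1) -e -e'; apply: sortB.
Qed.

Lemma bsim_K B B' : bsim B B' -> thinK B -> thinK B'.
Proof.
case=> sB rB kB i; rewrite -sB => lt_i L1.
have [e0 _ _] := rB i (ltnW (ltnW lt_i)); have [e2 _ _] := rB _ lt_i.
have [_ _ h] := rB _ (ltnW lt_i); rewrite -e0 -e2.
by have eb := h (or_intror L1); rewrite -eb in L1 *; apply: kB.
Qed.

Lemma bsim_S B B' : bsim B B' -> thinS B -> thinS B'.
Proof.
case=> sB rB hS x y m xy px py Mxy i; rewrite -sB => le_i h.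
apply: (hS x y m xy px py Mxy i le_i) => j lt_j; have hj := h j lt_j.
have lt_ij : i + j < size B by apply: leq_trans le_i; rewrite ltn_add2l.
by have [_ _ e] := rB _ lt_ij; rewrite e // hj; right.
Qed.

Lemma nth_alt (x y d : nat) k i : i < k ->
  nth d (alt x y k) i = if odd i then y else x.
Proof.
elim: k x y i => [//|k IHk] x y [|i] //=; rewrite ltnS => /IHk->.
by case: odd.
Qed.

Lemma bl_cat B1 B2 j : bl (B1 ++ B2) (size B1 + j) = bl B2 j.
Proof. by rewrite /bl nth_cat ltnNge leq_addr /= addKn. Qed.

(** Between letters that are not partners, every inner letter of the subword is a block of its own.
    Four letters suffice for both x and y to occur as such a block with neighbours of equal class,
    so by [thinK] neither has a partner; then the two outer letters are single blocks as well, and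
    the run contradicts [thinS]. *)
Lemma thin_alt_partner B p q (x y : nat) k m : wf B -> thinK B -> thinS B ->
  bw B = p ++ alt x y k ++ q -> x != y -> M x y = Some m -> 4 <= k ->
  m.-1 <= k -> y = pi x.
Proof.
move=> wB kB hS e xy Mxy k4 mk; case: (eqVneq y (pi x)) => // ypx; exfalso.
have xycl : cl x != cl y.
  rewrite clE negb_or xy /=; apply: contraNneq ypx => ->; by rewrite piK.
have ne : alt x y k ++ q != [::] by case: (k) k4.
have [B1 [c [L [B2 [i [eB lt_i _ eq]]]]]] := locate wB e ne.
have [k' ek] : exists k', k = k'.+2 by exists k.-2; lia.
have [ex eL eB2] : [/\ x = if odd i then pi c else c, L - i = 1 &
    bw B2 = alt y x k'.+1 ++ q].
  move: eq; rewrite alt_other ek; case eLi : (L - i) => [|[|l]]; first lia.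
    by case=> -> <-.
  by case=> ezx ey _; rewrite ey -ezx eqxx in ypx.
have wB2 : wf B2.
  by move: wB; rewrite eB => /wf_catr; rewrite wf_cons => /and3P[].
have [B3 [eB2' eB3]] := bw_singles wB2 eB2 xycl.
have [z [Lz [B4 eB4]]] : exists z Lz B4, B3 = (z, Lz) :: B4.
  by case: (B3) eB3 => [//|[z Lz] B4] _; exists z, Lz, B4.
have wB3 : wf B3 by move: wB2; rewrite eB2' => /wf_catr.
have ez : z = if odd k' then x else y.
  move: wB3 eB3; rewrite eB4 wf_cons => /and3P[/andP[Lz0 _] _ _].
  by have [V' ->] := bw_hd B4 Lz0 => -[].
have clc : cl c = cl x by rewrite ex cl_alt.
set s := size B1.
have blB j : j <= k'.+1 -> bl B (s + j) =
    if j is j'.+1 then if j' < k' then (if odd j' then x else y, 1) else (z, Lz)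
    else (c, L).
  move=> le_j; rewrite eB bl_cat eB2' eB4; case: j le_j => [//|j'] le_j /=.
  rewrite /bl nth_cat size_map size_alt; case: ltnP => h.
    by rewrite (nth_map 0) ?size_alt // nth_alt.
  by have -> : j' - k' = 0 by lia.
have sB : s + k'.+2 <= size B.
  by rewrite eB size_cat eB2' eB4 /= size_cat /= size_map size_alt /s; lia.
have k'2 : 2 <= k' by lia.
have b0 : bl B s = (c, L) by rewrite -[s]addn0 blB.
have b1 : bl B s.+1 = (y, 1).
  by rewrite -[s.+1]addn1 blB //; have -> : 0 < k' by lia.
have b2 : bl B s.+2 = (x, 1).
  by rewrite -[s.+2]addn2 blB; [have -> : 1 < k' by lia | lia].
have b3 : (bl B s.+3).1 = y.
  rewrite -addn3 blB; last lia.
  case: ltnP => h //=; rewrite ez; by have -> : k' = 2 by lia.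
have py : pi y = y.
  apply/eqP/negPn/negP => npy; have := kB s; rewrite b0 b1 b2 /= clc eqxx.
  have lt : s.+2 < size B by lia.
  by move=> /(_ lt erefl npy).
have px : pi x = x.
  apply/eqP/negPn/negP => npx; have := kB s.+1; rewrite b1 b2 b3 /= eqxx.
  have lt : s.+3 < size B by lia.
  by move=> /(_ lt erefl npx).
have cx : c = x := pi_fix_cl (esym clc) px.
have L1 : L = 1.
  have : wf_block (c, L).
    by move: wB; rewrite eB => /wf_catr; rewrite wf_cons => /and3P[].
  by rewrite /wf_block /= cx px eqxx => /andP[_ /eqP].
have Lz1 : Lz = 1.
  have : wf_block (z, Lz) by move: wB3; rewrite eB4 wf_cons => /and3P[].
  have pz : pi z = z by rewrite ez; case: odd.
  by rewrite /wf_block /= pz eqxx => /andP[_ /eqP].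
apply: (hS x y m xy px py Mxy s); first lia.
move=> j lt_j; rewrite blB; last lia.
case: j lt_j => [|j] lt_j; first by rewrite cx L1.
case: ltnP => h; first by rewrite /=; case: odd.
have -> : j = k' by lia.
by rewrite ez Lz1 /=; case: odd.
Qed.

Definition thin B := [/\ wf B, thinK B, thinS B & thinL B].

Definition fliprel B B' := size B = size B' /\ forall i, i < size B ->
  bl B' i = bl B i \/
  [/\ pi (bl B i).1 != (bl B i).1,
      M (bl B i).1 (pi (bl B i).1) = Some (bl B i).2 &
      bl B' i = (pi (bl B i).1, (bl B i).2)].

Lemma frel_refl B : fliprel B B.
Proof. by split=> // i _; left. Qed.

Lemma frel_trans B B' B'' : fliprel B B' -> fliprel B' B'' -> fliprel B B''.
Proof.
case=> s r [s' r']; split=> [|i lt_i]; first by rewrite s.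
have := r i lt_i; have := r' i; rewrite -s => /(_ lt_i).
case=> [->//|[p' M' ->]] [e|[p1 M1 e]].
  by right; rewrite e in p' M' *; split.
by left; rewrite e /= piK; case: (bl B i).
Qed.

Lemma bl_wf B i : wf B -> i < size B -> wf_block (bl B i).
Proof. by move=> /andP[/all_nthP a _]; apply: a. Qed.

Lemma frel_bsim B B' : wf B -> fliprel B B' -> bsim B B'.
Proof.
move=> wB [s r]; split=> // i lt_i; have /andP[L0 _] := bl_wf wB lt_i.
case: (r i lt_i) => [->|[p1 M1 ->]]; split=> //=; first by rewrite cl_pi.
rewrite eq_sym in p1; have := Mge5 p1 M1; lia.
Qed.

Lemma frel_thin B B' : fliprel B B' -> thin B -> thin B'.
Proof.
move=> r [wB kB hS hL]; have b := frel_bsim wB r.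
split; [exact: bsim_wf b wB | exact: bsim_K b kB | exact: bsim_S b hS |].
case: r => s r i; rewrite -s => lt_i.
case: (r i lt_i) => [->|[p1 M1 ->]]; first exact: hL.
by move=> _ /=; exists (bl B i).2; rewrite // piK Msym.
Qed.

(** The flipped subword lies inside one block, and by [thinL] it fills that block. *)
Lemma thin_flip B w : thin B -> flip M (bw B) w ->
  exists2 B', w = bw B' & fliprel B B'.
Proof.
move=> tB; have [wB kB hS hL] := tB; move e : (bw B) => v f.
case: f e => p x y m q xy Mxy e.
have m5 := Mge5 xy Mxy.
have ey : y = pi x by apply: (thin_alt_partner wB kB hS e xy Mxy); lia.
have px : pi x != x by rewrite -ey eq_sym.
have m0 : 0 < m by lia.
rewrite ey in e Mxy *.
have [B1 [c [L [B2 [i [eB le_L ep ex]]]]]] := locate_block wB px m0 e.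
have pc : pi c != c.
  by move: px; rewrite ex; case: odd; rewrite // piK eq_sym.
have Mc : M c (pi c) = Some m.
  by move: Mxy; rewrite ex; case: odd; rewrite // piK Msym.
have [| |m' Mm' le_m'] := hL (size B1).
- by rewrite eB size_cat /=; lia.
- by rewrite -[size B1]addn0 eB bl_cat.
have bB1 : bl B (size B1) = (c, L) by rewrite -[size B1]addn0 eB bl_cat.
move: Mm' le_m'; rewrite bB1 /= Mc => -[<-] le_m.
have i0 : i = 0 by lia.
have Lm : L = m by lia.
rewrite i0 /= cats0 in ep ex; rewrite ep ex in e *.
have eq : q = bw B2.
  move: e; rewrite eB bw_cat => /eqP; rewrite eqseq_cat // eqxx /=.
  by rewrite /bw /= Lm eqseq_cat // eqxx => /eqP.
exists (B1 ++ (pi c, m) :: B2); first by rewrite bw_cat /bw /= piK eq.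
split; first by rewrite eB !size_cat.
move=> j _; rewrite /bl eB !nth_cat; case: ltnP => h; first by left.
case: (j - size B1) => [|k] /=; last by left.
by right; rewrite Lm.
Qed.

Lemma thin_flips B w : thin B -> flips M (bw B) w ->
  exists2 B', w = bw B' & fliprel B B'.
Proof.
move=> tB; move e : (bw B) => v f; elim: f B tB e => [u|u v' w' f _ IH] B tB e.
  by exists B; rewrite ?e //; apply: frel_refl.
rewrite -e in f; have [B' eB' r] := thin_flip tB f.
have [B'' -> r'] := IH B' (frel_thin r tB) (esym eB').
by exists B''; last exact: frel_trans r r'.
Qed.

Lemma thin_reduced B : thin B -> wreduced M (bw B).
Proof.
move=> tB; apply: tits_reduced => // [x y m xy /(Mge5 xy)|w' /(thin_flips tB)].
  lia.
by case=> B' -> r; have [wB' _ _ _] := frel_thin r tB; apply: bw_sqfree.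
Qed.

Lemma thin_long B p q (x y : nat) m : thin B -> x != y -> M x y = Some m ->
  bw B = p ++ alt x y m.-1 ++ q ->
  y = pi x /\ exists i, [/\ i < size B, cl (bl B i).1 = cl x &
    m.-1 <= (bl B i).2].
Proof.
move=> [wB kB hS _] xy Mxy e; have m5 := Mge5 xy Mxy.
have ey : y = pi x by apply: (thin_alt_partner wB kB hS e xy Mxy); lia.
split=> //; have px : pi x != x by rewrite -ey eq_sym.
have m0 : 0 < m.-1 by lia.
rewrite ey in e; have [B1 [c [L [B2 [i [eB le_L _ ex]]]]]] := locate_block wB px m0 e.
exists (size B1); rewrite eB -{2 3}[size B1]addn0 !bl_cat size_cat /=; split; try lia.
by rewrite ex cl_alt.
Qed.

End Thin.

End Blocks.

Section BlockNeighbours.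
Local Open Scope nat_scope.
Variable pi : nat -> nat.
Hypothesis piK : involutive pi.

Lemma hd_next b B d : wf pi (b :: B) -> cl pi d = cl pi b.1 ->
  hd (bw pi B) != d.+1.
Proof.
case: B => [//|b' B]; rewrite wf_cons => /and3P[_ wB h] db.
move: wB; rewrite wf_cons => /and3P[/andP[b0 _] _ _].
have [V' ->] := bw_hd pi B b0; rewrite /= eqSS.
by apply: contraNneq h => e; rewrite -db e.
Qed.

Lemma hd_prev_rcons B c L : 0 < L ->
  hd (rev (bw pi (rcons B (c, L)))) = (if odd L then c else pi c).+1.
Proof.
move=> L0; rewrite -cats1 bw_cat rev_cat /bw /= cats0 rev_alt.
by case: L L0 => // L _; case: odd.
Qed.

Lemma hd_prev B1 b B2 d : wf pi (B1 ++ b :: B2) -> cl pi d = cl pi b.1 ->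
  hd (rev (bw pi B1)) != d.+1.
Proof.
case/lastP: B1 => [//|B1 [c L]]; rewrite cat_rcons => w db.
have /= cb := wf_adj w.
have /andP[/= L0 _] : wf_block pi (c, L).
  by move/wf_catr: w; rewrite wf_cons => /and3P[].
rewrite hd_prev_rcons // eqSS; apply: contraNneq cb => e.
by rewrite -db -e; case: odd; rewrite ?cl_pi.
Qed.

End BlockNeighbours.

Lemma kc_exists x y z : x != y -> y != z -> x != z -> exists o, kc o x y z.
Proof.
move=> xy yz xz; have /orP[h|h] := kc_total true xy yz xz; first by exists true.
by exists false; rewrite -[false]/(~~ true) kc_opp -kc_rot.
Qed.

Definition swap2 (a b z : nat) := if z == a then b else if z == b then a else z.

Lemma swap2K a b : involutive (swap2 a b).
Proof.
move=> z; rewrite /swap2; case: (eqVneq z a) => [->|za].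
  by rewrite eqxx; case: eqP.
case: (eqVneq z b) => [->|zb]; first by rewrite eqxx.
by rewrite (negPf za) (negPf zb).
Qed.

(** * Partners of letters in a non-crossing word *)

Section Link.
Local Open Scope nat_scope.
Variable M : nat -> nat -> option nat.
Hypothesis Msym : forall x y, M x y = M y x.
Hypothesis Mge5 : forall x y m : nat, x != y -> M x y = Some m -> 5 <= m.
Variable V : seq nat.
Hypotheses (Vsq : sqfree V) (Vnc : noncrossing (gprod us V)).

Definition thr2 o (a b L : nat) := thr V o a b L \/ thr V o b a L.

Lemma thr2_sym o a b L : thr2 o a b L -> thr2 o b a L.
Proof. by case; [right | left]. Qed.

Lemma block_syl (pi : nat -> nat) B1 c L B2 : involutive pi ->
  wf pi (B1 ++ (c, L) :: B2) -> bw pi (B1 ++ (c, L) :: B2) = V -> pi c != c ->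
  exists o o', syl V o o' c (pi c) L (rev (bw pi B1)) (bw pi B2).
Proof.
move=> piK w eV pc; have w2 := wf_catr w.
have hX d : cl pi d = cl pi c -> hd (rev (bw pi B1)) != d.+1.
  by move=> dc; apply: (hd_prev piK w).
have hY d : cl pi d = cl pi c -> hd (bw pi B2) != d.+1.
  by move=> dc; apply: (hd_next w2).
have pcl := cl_pi piK c.
have [o ho] : exists o, kc o (pi c).+1 (hd (rev (bw pi B1))) c.+1.
  by apply: kc_exists; rewrite ?hX // eq_sym hX.
have [o' ho'] : exists o', kc o' (if odd L then pi c else c).+1 (hd (bw pi B2))
    (if odd L then c else pi c).+1.
  case: odd; apply: kc_exists; rewrite ?hY //; first by rewrite eq_sym hY.
    by rewrite eq_sym hY.
  by rewrite eqSS eq_sym.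
exists o, o'; split=> //.
by rewrite revK -eV bw_cat.
Qed.

Definition long (x y : nat) := x <> y /\ exists2 m, M x y = Some m &
  exists p q, V = p ++ alt x y m.-1 ++ q \/ V = p ++ alt y x m.-1 ++ q.

Lemma long_sym x y : long x y -> long y x.
Proof.
case=> xy [m Mm [p [q h]]]; split; first exact/nesym.
by exists m; [rewrite Msym | exists p, q; case: h; [right | left]].
Qed.

Lemma long_thr a b m : long a b -> M a b = Some m ->
  exists o L, m.-1 <= L /\ thr2 o a b L.
Proof.
suff main (x y : nat) p q : x != y -> M x y = Some m -> V = p ++ alt x y m.-1 ++ q ->
    exists o L, m.-1 <= L /\ thr2 o x y L.
  move=> [/eqP ab [m' Mm [p [q h]]]] Mab.
  have em : m' = m by move: Mab; rewrite Mm => -[].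
  subst m'; case: h => eV; first exact: main eV.
  have ba : b != a by rewrite eq_sym.
  have Mba : M b a = Some m by rewrite Msym.
  have [o [L [le_L h]]] := main b a p q ba Mba eV.
  by exists o, L; split=> //; apply: thr2_sym.
move=> xy Mxy eV; have m5 := Mge5 xy Mxy; have m0 : 0 < m.-1 by lia.
(* Pairing x with y alone turns the maximal alternating subwords on these two letters into
   blocks. *)
have piK := swap2K x y; have px : swap2 x y x = y by rewrite /swap2 eqxx.
have w := dec_wf piK Vsq; have e := bw_dec piK V.
have px' : swap2 x y x != x by rewrite px eq_sym.
have [|B1 [c [L [B2 [i [eB le_L _ ex]]]]]] := @locate_block _ piK _ p q x _ w px' m0.
  by rewrite px e.
have pc : swap2 x y c != c.
  by move: px'; rewrite {2 3}ex; case: odd; rewrite // piK eq_sym.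
rewrite eB in w e; have [o [o' s]] := block_syl piK w e pc.
have L3 : 3 <= L by lia.
rewrite eq_sym in pc; have oo' := syl_same_dir Vsq Vnc pc s L3; subst o'.
exists o, L; split; first by lia.
have [cx|cy] : c = x \/ c = y.
  move: ex; case: odd => ex; last by left.
  by right; rewrite -[c]piK -ex px.
  by left; rewrite cx px in s; exists (rev (bw (swap2 x y) B1)), (bw (swap2 x y) B2).
have py : swap2 x y y = x by rewrite /swap2 eqxx; case: eqP.
by right; rewrite cy py in s; exists (rev (bw (swap2 x y) B1)), (bw (swap2 x y) B2).
Qed.

(** From m - 1 <= L0 <= L + 2 for the long subword. Since m >= 5 this rules out L = 0 and L = 1,
    which the next two lemmas exploit. *)
Lemma long_window a b m o L : long a b -> M a b = Some m -> thr2 o a b L ->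
  m <= L + 3.
Proof.
move=> lab Mab h; have [/eqP ab _] := lab; have m5 := Mge5 ab Mab.
have [o0 [L0 [le_L h0]]] := long_thr lab Mab.
suff : L0 <= L + 2 by lia.
have L2 : 2 <= L0 by lia.
case: h => h.
  have oo := thr_dir Vsq Vnc ab h h0 L2; subst o0.
  exact: (thr_window Vsq Vnc ab h h0).
rewrite eq_sym in ab; have h0' := thr2_sym h0.
have oo := thr_dir Vsq Vnc ab h h0' L2; subst o0.
exact: (thr_window Vsq Vnc ab h h0').
Qed.

Lemma long_dir a b o o' L L' : long a b -> thr2 o a b L -> thr2 o' a b L' ->
  o = o'.
Proof.
move=> lab h h'; have [/eqP ab [m Mab _]] := lab; have m5 := Mge5 ab Mab.
have [o0 [L0 [le_L h0]]] := long_thr lab Mab.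
have L2 : 2 <= L0 by lia.
have ba : b != a by rewrite eq_sym.
suff main o1 L1 : thr2 o1 a b L1 -> o1 = o0 by rewrite (main _ _ h) (main _ _ h').
case=> h1; first exact: (thr_dir Vsq Vnc ab h1 h0 L2).
exact: (thr_dir Vsq Vnc ba h1 (thr2_sym h0) L2).
Qed.

(* The side of the line through the keys of [a] and [b] on which [h] lies. *)
Definition sd (a b h : nat) := kc true a.+1 h b.+1.

(** On different sides, the point between [X] and [Y] would be an alternating subword of length 0
    with both ends turning in one direction. *)
Lemma long_adj a b X Y : long a b -> V = rev X ++ Y ->
  hd X != a.+1 -> hd X != b.+1 -> hd Y != a.+1 -> hd Y != b.+1 ->
  sd a b (hd X) = sd a b (hd Y).
Proof.
move=> lab eV Xa Xb Ya Yb; have [/eqP ab [m Mab _]] := lab.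
have m5 := Mge5 ab Mab; apply/eqP/negPn/negP => ne.
suff [o h] : exists o, thr2 o a b 0 by have := long_window lab Mab h; lia.
exists (sd a b (hd Y)); left; exists X, Y; split=> //=;
  by move: ne Xa Xb Ya Yb ab; rewrite /sd /kc; case: ifP; lia.
Qed.

(** With both neighbours on the same side, the letter [a] would be such a subword of length 1. *)
Lemma long_single a b X Y : long a b -> V = rev X ++ a :: Y ->
  hd X != a.+1 -> hd X != b.+1 -> hd Y != a.+1 -> hd Y != b.+1 ->
  sd a b (hd X) <> sd a b (hd Y).
Proof.
move=> lab eV Xa Xb Ya Yb e; have [/eqP ab [m Mab _]] := lab.
have m5 := Mge5 ab Mab.
suff [o h] : exists o, thr2 o a b 1 by have := long_window lab Mab h; lia.
exists (~~ sd a b (hd Y)); left; exists X, Y; split=> //=;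
  by move: e Xa Xb Ya Yb ab; rewrite /sd /kc; case: ifP; lia.
Qed.

Lemma long_infix3 x z : long x z -> exists p q, V = p ++ [:: z; x; z] ++ q.
Proof.
move=> [/eqP xz [m Mxz [p [q h]]]]; have := Mge5 xz Mxz.
case: m h {Mxz} => [|[|[|[|[|m]]]]] // h _; case: h => -> /=.
  by exists (rcons p x), (alt x z m ++ q); rewrite cat_rcons.
by exists p, (alt x z m.+1 ++ q).
Qed.

(** The subword on x and z contains z x z, where x has the same letter on both sides; [long_single]
    for the pair x, y excludes this. *)
Lemma long_uniq x y z : long x y -> long x z -> y = z.
Proof.
move=> lxy lxz; apply/eqP/negPn/negP => yz.
have [p [q eV]] := long_infix3 lxz; have [/eqP xz _] := lxz.
apply: (@long_single x y (z :: rev p) (z :: q) lxy) => //=; rewrite ?eqSS 1?eq_sym //.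
by rewrite rev_cons revK cat_rcons eV.
Qed.

Definition partner x : nat :=
  if pselect (exists y, long x y) is left h then sval (cid h) else x.

Lemma partnerE x y : long x y -> partner x = y.
Proof.
move=> lxy; rewrite /partner; case: pselect => [h|[]]; last by exists y.
by case: cid => z /= lxz; apply: long_uniq lxz lxy.
Qed.

Lemma partner_long x : partner x != x -> long x (partner x).
Proof.
rewrite /partner; case: pselect => [h _|_]; last by rewrite eqxx.
by case: cid => y /=.
Qed.

Lemma partnerK : involutive partner.
Proof.
move=> x; case: (eqVneq (partner x) x) => [e|/partner_long/long_sym]; first by rewrite !e.
exact: partnerE.
Qed.

Lemma long_ncl x y z : long x y -> cl partner z != cl partner x -> z != x /\ z != y.
Proof.
by move=> lxy; rewrite (clE partnerK) (partnerE lxy) negb_or => /andP[].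
Qed.

(** Distinct partners u and v occur next to each other in [V], so [long_adj] applies between
    them. *)
Lemma long_side a b u v : long a b -> cl partner u != cl partner a ->
  cl partner u = cl partner v -> sd a b u.+1 = sd a b v.+1.
Proof.
move=> lab ua /esym/eqP; rewrite (clE partnerK) => /orP[/eqP->//|/eqP ev].
case: (eqVneq (partner u) u) => [eu|nu]; first by rewrite ev eu.
have [ua1 ub1] := long_ncl lab ua.
have [va1 vb1] : v != a /\ v != b.
  by apply: (long_ncl lab); rewrite ev (cl_pi partnerK).
have luv := partner_long nu; rewrite -ev in luv.
have [p [q eV]] := long_infix3 luv.
symmetry; apply: (@long_adj a b (v :: rev p) ([:: u; v] ++ q)) => //=.
by rewrite rev_cons revK cat_rcons eV.
Qed.

Let B := dec partner V.

Lemma dec_wfV : wf partner B.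
Proof. exact/dec_wf/Vsq/partnerK. Qed.

Lemma bw_decV : bw partner B = V.
Proof. exact/bw_dec/partnerK. Qed.

Lemma dec_split i : i < size B ->
  B = take i B ++ nth (0, 0) B i :: drop i.+1 B.
Proof. by move=> lt_i; rewrite -drop_nth // cat_take_drop. Qed.

(** A single letter with a partner has its neighbours on different sides, whereas letters of one
    class lie on the same side. *)
Lemma dec_thinK : thinK partner B.
Proof.
move=> i lt_i L1 pc; set c := (nth _ _ i.+1).1 in pc *.
have lc := partner_long pc.
have e1 := dec_split (ltnW (ltnW lt_i)); have e2 := dec_split (ltnW lt_i).
have e3 := dec_split lt_i.
have w := dec_wfV; have ec : nth (0, 0) B i.+1 = (c, 1) by rewrite /c -L1; case: nth.
rewrite ec in e2; have w2 := w; rewrite e2 in w2.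
have eV : V = rev (rev (bw partner (take i.+1 B))) ++
    c :: bw partner (drop i.+2 B).
  by rewrite revK -bw_decV {1}e2 bw_cat.
have hX d : cl partner d = cl partner c -> hd (rev (bw partner (take i.+1 B))) != d.+1.
  by move=> dc; apply: (hd_prev partnerK w2).
have hY d : cl partner d = cl partner c -> hd (bw partner (drop i.+2 B)) != d.+1.
  by move=> dc; apply: (hd_next (wf_catr w2)).
have pcc := cl_pi partnerK c.
have := long_single lc eV (hX _ erefl) (hX _ pcc) (hY _ erefl) (hY _ pcc).
apply: contra_not_neq => e.
move: (hX) (hY); rewrite (drop_nth (0, 0) lt_i) (take_nth (0, 0)); last by lia.
set b0 := nth _ _ i in e *; set b2 := nth _ _ i.+2 in e *.
have /andP[b00 _] : wf_block partner b0 by apply: bl_wf => //; lia.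
have /andP[b20 _] : wf_block partner b2 by apply: bl_wf.
move: b00 e; case: b0 => c0 L0 /= b00 e.
have [V' ->] := bw_hd partner (drop i.+3 B) b20.
rewrite hd_prev_rcons //= => hX' hY'.
have ce : cl partner (if odd L0 then c0 else partner c0) = cl partner c0.
  by case: odd; rewrite ?(cl_pi partnerK).
apply: (long_side lc); rewrite ce e //; apply/negP => /eqP e'.
by have := hY' _ e'; rewrite eqxx.
Qed.

Lemma dec_thinS : thinS partner M B.
Proof.
move=> x y m xy px py Mxy i le_i h.
have eB : take m.-1 (drop i B) = [seq (z, 1) | z <- alt x y m.-1].
  have st : size (take m.-1 (drop i B)) = m.-1 by rewrite size_takel // size_drop; lia.
  apply: (@eq_from_nth _ (0, 0)); rewrite st ?size_map ?size_alt // => j lt_j.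
  by rewrite nth_take // nth_drop h // (nth_map 0) ?size_alt // nth_alt.
have lxy : long x y.
  split; first exact/eqP; exists m => //.
  exists (bw partner (take i B)), (bw partner (drop m.-1 (drop i B))); left.
  rewrite -{1}bw_decV -{1}(cat_take_drop i B) -{1}(cat_take_drop m.-1 (drop i B)).
  rewrite !bw_cat eB; congr (_ ++ (_ ++ _)).
  rewrite /bw -map_comp; elim: (alt _ _ _) => [//|z s IHs] /=; congr (_ :: _).
  exact: IHs.
by move: xy; rewrite -(partnerE lxy) px eqxx.
Qed.

Definition normalized := forall (x y m : nat) p q, x != y -> M x y = Some m ->
  V <> p ++ alt x y m.+2 ++ q.

Lemma normalized_block i : normalized -> i < size B ->
  let b := nth (0, 0) B i in partner b.1 != b.1 ->
  exists2 m, M b.1 (partner b.1) = Some m & b.2 <= m.+1.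
Proof.
move=> nV lt_i b pb; have lb := partner_long pb.
have [_ [m Mm _]] := lb; exists m => //; rewrite leqNgt; apply/negP => lt_m.
rewrite eq_sym in pb.
apply: (nV b.1 (partner b.1) m (bw partner (take i B))
  ((if odd m.+2 then alt (partner b.1) b.1 (b.2 - m.+2)
    else alt b.1 (partner b.1) (b.2 - m.+2)) ++ bw partner (drop i.+1 B)) pb Mm).
rewrite -{1}bw_decV {1}(dec_split lt_i) bw_cat; congr (_ ++ _).
by rewrite catA -alt_cat subnKC.
Qed.

(** The condition singles out length m + 1. There the braid relation on the first m letters makes
    the last two equal, which leaves m - 1 letters beginning with the partner. *)
Definition shrink (b : nat * nat) : nat * nat :=
  if (partner b.1 != b.1) && (M b.1 (partner b.1) == Some b.2.-1)
  then (partner b.1, b.2.-2) else b.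

Let Bs := [seq shrink b | b <- B].

Lemma shrink_bsim : bsim partner B Bs.
Proof.
split=> [|i lt_i]; first by rewrite size_map.
have /andP[b0 _] := bl_wf dec_wfV lt_i.
rewrite (nth_map (0, 0)) // /shrink; set b := nth _ _ i in b0 *.
case: ifP => [/andP[pb /eqP Mm]|_] //; rewrite eq_sym in pb.
by have := Mge5 pb Mm; split=> /=; rewrite ?(cl_pi partnerK) //; lia.
Qed.

Lemma shrink_thin : normalized -> thin partner M Bs.
Proof.
move=> nV; have bs := shrink_bsim; split.
- exact: (bsim_wf partnerK bs dec_wfV).
- exact: (bsim_K bs dec_thinK).
- exact: (bsim_S bs dec_thinS).
move=> i; rewrite size_map => lt_i; rewrite (nth_map (0, 0)) //.
have := normalized_block nV lt_i; set b := nth _ _ i => hb.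
rewrite /shrink; case: ifP => [/andP[pb /eqP Mm]|h] /= pb'.
  by exists b.2.-1; [rewrite partnerK Msym | lia].
have [m Mm le_m] := hb pb'; exists m => //.
move: h; rewrite pb' Mm /=; case: eqP => // ne _.
case: (ltngtP b.2 m.+1) => [|/=|eb]; [by [] | lia |].
by case: ne; rewrite eb.
Qed.

Lemma shrink_wp : gprod (ws M) (bw partner Bs) = gprod (ws M) V.
Proof.
rewrite -[in RHS]bw_decV /Bs; have := dec_wfV; elim: (B) => [//|b C IHC].
rewrite wf_cons => /and3P[/andP[b0 _] wC _].
rewrite /bw /= !gprod_cat -!/(bw _ _) (IHC wC); congr (_ * _)%g.
rewrite /shrink; case: ifP => // /andP[pb /eqP Mm].
rewrite eq_sym in pb; have m5 := Mge5 pb Mm.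
case: b pb Mm m5 {b0} => c [|[|k]] //= pb Mm m5.
rewrite partnerK !gprod_alt -[RHS]/(galt _ _ k.+2) galtSr (ws_braid pb Mm) galtSr.
rewrite -mulgA /=; case: (odd k); by rewrite /= ws_sq mulg1.
Qed.

Lemma thinBs_reduced : normalized -> wreduced M (bw partner Bs).
Proof. by move=> nV; apply: (thin_reduced partnerK) (shrink_thin nV). Qed.

End Link.

(** * The effect of half twist powers on words *)

Lemma gprod_alt_cancel (c d L N : nat) : ~~ odd N ->
  gprod us (alt c d L) *
    gprod us (if odd L then alt c d N else alt d c N) =
  gprod us (if (L <= N)%N then alt d c (N - L) else alt c d (L - N)).
Proof.
move=> oN; case: leqP => [le_L|lt_L].
  have -> : (if odd L then alt c d N else alt d c N) =
      rev (alt c d L) ++ alt d c (N - L).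
    by rewrite rev_alt -{1 2}(subnKC le_L) !alt_cat; case: odd.
  by rewrite gprod_cat gprod_rev mulVKg.
have -> : alt c d L = alt c d (L - N) ++ rev (if odd L then alt c d N else alt d c N).
  rewrite -{1}(subnK (ltnW lt_L)) alt_cat oddB ?(ltnW lt_L) // (negPf oN) addbF.
  by case: odd; rewrite rev_alt (negPf oN).
by rewrite gprod_cat gprod_rev mulgVK.
Qed.

Section TwistWalk.
Variables (a b : nat) (o : bool) (m : nat) (phi : {multiplicative ucox -> ucox}).
Hypothesis ab : a < b.
Let q := urot a b o m.
Hypothesis phiE : phi \o us = utwist a b q.

Let phi_us x : phi (us x) = utwist a b q x.
Proof. by rewrite -phiE. Qed.

(* While a word is read, the image under the twist is carried along up to the
   side [st] of the line through [a] and [b] on which one currently is. *)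
Definition zeta (st : bool) : ucox := if st then q else 1.

Let inP c d := (c = a /\ d = b) \/ (c = b /\ d = a).

Lemma rho_alt : gprod us (alt a b m.*2) = (us a * us b) ^+ m.
Proof.
rewrite gprod_alt; elim: (m) => [//|k IHk].
by rewrite doubleS galtSS IHk expgS.
Qed.

Lemma rho_altV : gprod us (alt b a m.*2) = ((us a * us b) ^+ m)^-1.
Proof. by rewrite -rho_alt -gprod_rev rev_alt odd_double. Qed.

Lemma us_q_us c d : inP c d -> us c * q^-1 = q * us c.
Proof.
have conj x y : us x * y * us x = y^-1 -> us x * y^-1 = y * us x.
  by move=> <-; rewrite !mulgA us_sq mul1g.
move=> h; apply: conj; case: h => -[-> _].
  by rewrite /q /urot; case: o; rewrite ?invgK ?rot_conjV ?rot_conj.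
have qc : commute (us a * us b) q.
  by rewrite /q /urot; case: o; [apply: commuteV|]; apply: commuteX.
have aqa : us a * q * us a = q^-1.
  by rewrite /q /urot; case: o; rewrite ?invgK ?rot_conjV ?rot_conj.
have -> : us b * q * us b =
    (us a * us b)^-1 * (us a * q * us a) * (us a * us b).
  by rewrite invgM !usV !mulgA -!(mulgA _ (us a) (us a)) us_sq !mulg1.
by rewrite aqa -mulgA -(commuteV qc) mulKg.
Qed.

(** Every letter of the pair leads to the other side, so the factors [zeta] of consecutive letters
    telescope. *)
Lemma walk_in c d L st : inP c d ->
  phi (gprod us (alt c d L)) =
  zeta st * gprod us (alt c d L) * (zeta (st (+) odd L))^-1.
Proof.
elim: L c d st => [|L IHL] c d st cd.
  by rewrite /= morph1 addbF mulg1 mulgV.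
have dc : inP d c by case: cd => -[-> ->]; [right | left].
rewrite /= gmulfM (IHL d c (~~ st) dc) phi_us addbN addNb !mulgA.
congr (_ * _ * _).
have -> : utwist a b q c = q * us c.
  by rewrite /utwist; case: cd => -[-> _]; rewrite eqxx ?orbT.
rewrite /zeta; case: st => /=; first by rewrite mulg1.
by rewrite mul1g -(us_q_us cd) mulgVK.
Qed.

Lemma walk_out v : v != a -> v != b ->
  phi (us v) = zeta (sd a b v.+1) * us v * (zeta (sd a b v.+1))^-1.
Proof.
move=> va vb; rewrite phi_us /utwist (negPf va) (negPf vb) /=.
have -> : (a < v < b)%N = sd a b v.+1 by rewrite /sd /kc; lia.
by rewrite /zeta; case: ifP; rewrite // invg1 mulg1 mul1g.
Qed.

(** The correction due where a block ends on the unexpected side is an alternating word of length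
    2m. Thanks to the direction [o] it begins with the last letter of the block and cancels into it,
    which is how L becomes 2m - L. *)
Lemma corr_alt c d L h : inP c d -> h != a.+1 -> h != b.+1 ->
  kc o d.+1 h c.+1 ->
  (zeta (sd a b h (+) odd L))^-1 * zeta (~~ (sd a b h (+) odd L)) =
  gprod us (if odd L then alt c d m.*2 else alt d c m.*2).
Proof.
move=> cd ha hb k.
have -> : sd a b h = if (c == a) then ~~ o else o.
  move: k ha hb ab; rewrite /sd /kc; case: cd => -[-> ->].
    by rewrite eqxx; case: (o) => /=; lia.
  by move=> k ha hb hab; rewrite (gtn_eqF hab); move: k ha hb hab; case: (o) => /=; lia.
rewrite /zeta /q /urot; case: cd => -[-> ->]; rewrite ?eqxx ?(gtn_eqF ab);
  case: (odd L); case: (o);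
  rewrite /= ?invg1 ?mul1g ?mulg1 ?invgK ?rho_alt ?rho_altV //.
Qed.

End TwistWalk.

(** Each letter passed exchanges the two sides, hence the term [odd L]: crossing the axis amounts to
    turning in the same direction at both ends. *)
Lemma flag_parity a b c d L h h' o1 o2 : a < b ->
  (c = a /\ d = b) \/ (c = b /\ d = a) ->
  kc o1 d.+1 h c.+1 ->
  kc o2 (if odd L then d else c).+1 h' (if odd L then c else d).+1 ->
  (sd a b h (+) odd L != sd a b h') = (o1 == o2).
Proof.
move=> ab cd; rewrite /sd /kc; case: cd => -[-> ->]; case: (odd L);
  case: o1; case: o2 => /=; lia.
Qed.

Section ThetaBlocks.
Local Open Scope nat_scope.
Variable M : nat -> nat -> option nat.
Hypothesis Msym : forall x y, M x y = M y x.
Hypothesis Mge5 : forall x y m : nat, x != y -> M x y = Some m -> 5 <= m.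
Variable V : seq nat.
Hypotheses (Vsq : sqfree V) (Vnc : noncrossing (gprod us V)).
Variables (a b m : nat) (o : bool).
Hypotheses (ab : a < b) (lab : long M V a b).
Hypothesis o_dir : forall o' L, thr2 V o' a b L -> o' = o.

Let pi := partner M V.
Let piK : involutive pi := partnerK Msym Mge5 Vsq Vnc.
Let pa : pi a = b := partnerE Msym Mge5 Vsq Vnc lab.
Let pb : pi b = a.
Proof. by rewrite -pa piK. Qed.

Definition on_pair (c : nat) := (c == a) || (c == b).

Definition shift (x : nat * nat) : nat * nat :=
  if x.2 <= m.*2 then (pi x.1, m.*2 - x.2) else (x.1, x.2 - m.*2).

(* The block crosses from one side of the pair [a, b] to the other. *)
Definition flag B1 (x : nat * nat) B2 :=
  (sd a b (hd (rev (bw pi B1))) (+) odd x.2) != sd a b (hd (bw pi B2)).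

Fixpoint twist_blocks B1 B2 : seq (nat * nat) :=
  if B2 is x :: B' then
    (if on_pair x.1 && flag B1 x B' then shift x else x) :: twist_blocks (rcons B1 x) B'
  else [::].

Let B := dec pi V.

Lemma on_pair_cl c : on_pair c = (cl pi c == cl pi a).
Proof. by rewrite /on_pair (clE piK) pa. Qed.

Lemma on_pairP c : on_pair c -> (c = a /\ pi c = b) \/ (c = b /\ pi c = a).
Proof. by case/orP => /eqP->; [left | right]. Qed.

Lemma block_hds B1 c L B' : B = B1 ++ (c, L) :: B' -> on_pair c ->
  [/\ hd (rev (bw pi B1)) != a.+1, hd (rev (bw pi B1)) != b.+1,
      hd (bw pi B') != a.+1 & hd (bw pi B') != b.+1].
Proof.
move=> eB; rewrite on_pair_cl => /eqP cc.
have w : wf pi B by apply: dec_wf.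
have ba : cl pi b = cl pi a by rewrite -pa (cl_pi piK).
rewrite eB in w; have w2 := wf_catr w.
by split; rewrite ?(hd_prev piK w) ?(hd_next w2) //= ?ba cc.
Qed.

Lemma block_flag B1 c L B' : B = B1 ++ (c, L) :: B' -> on_pair c ->
  flag B1 (c, L) B' ->
  kc o (pi c).+1 (hd (rev (bw pi B1))) c.+1 /\ thr V o c (pi c) L.
Proof.
move=> eB hc fl; have [X1 X2 Y1 Y2] := block_hds eB hc.
have w : wf pi B by apply: dec_wf.
have e : bw pi B = V by apply: bw_dec.
rewrite eB in w e; have cd := on_pairP hc.
have pc : pi c != c by case: cd => -[-> ->]; lia.
have [o1 [o2 s]] := block_syl piK w e pc; have [_ k1 k2] := s.
have := flag_parity ab cd k1 k2; move: fl; rewrite /flag /= => -> /esym/eqP eo.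
subst o2; have t : thr V o1 c (pi c) L by exists (rev (bw pi B1)), (bw pi B').
suff eo : o1 = o by rewrite -eo.
apply: (o_dir (L := L)); case: cd t => -[-> ->]; [left | right]; by [].
Qed.

(** Three letters or more force equal directions at the two ends, hence a flag. *)
Lemma block_noflag B1 c L B' : B = B1 ++ (c, L) :: B' -> on_pair c ->
  ~~ flag B1 (c, L) B' -> L <= 2.
Proof.
move=> eB hc fl; rewrite leqNgt; apply/negP => L3.
have w : wf pi B by apply: dec_wf.
have e : bw pi B = V by apply: bw_dec.
rewrite eB in w e; have cd := on_pairP hc.
have pc : pi c != c by case: cd => -[-> ->]; lia.
have [o1 [o2 s]] := block_syl piK w e pc; have [_ k1 k2] := s.
have := flag_parity ab cd k1 k2.
rewrite eq_sym in pc; rewrite (syl_same_dir Vsq Vnc pc s L3) eqxx => h.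
by move: fl; rewrite /flag h.
Qed.

Variable phi : {multiplicative ucox -> ucox}.
Hypothesis phiE : phi \o us = utwist a b (urot a b o m).

Let zt := zeta a b o m.

(** [st] is the side on which the walk stands before [B2]. Blocks off the pair and the junctions
    between them stay on one side by [long_side] and [long_adj]; a block on the pair either ends on
    the side of its successor or is flagged and receives the correction. *)
Lemma theta_suffix B2 B1 st : B = B1 ++ B2 ->
  st = (if B2 is (c, _) :: _ then
          if on_pair c then sd a b (hd (rev (bw pi B1))) else sd a b c.+1
        else false) ->
  ((zt st)^-1 * phi (gprod us (bw pi B2)) = gprod us (bw pi (twist_blocks B1 B2)))%g.
Proof.
elim: B2 B1 st => [|[c L] B2 IHB] B1 st eB est.
  by rewrite est /= morph1 mulg1 invg1.
have w : wf pi B by apply: dec_wf.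
have /andP[/= L0 wL] : wf_block pi (c, L).
  by move: w; rewrite eB => /wf_catr; rewrite wf_cons => /and3P[].
have eB' : B = rcons B1 (c, L) ++ B2 by rewrite cat_rcons.
have eV : V = rev (rev (bw pi (rcons B1 (c, L)))) ++ bw pi B2.
  by rewrite revK -bw_cat -eB' /B bw_dec.
have bwE x C : bw pi (x :: C) = alt x.1 (pi x.1) x.2 ++ bw pi C by [].
rewrite bwE gprod_cat gmulfM [twist_blocks _ _]/= bwE gprod_cat.
have hdB2 : hd (bw pi B2) = if B2 is (c', _) :: _ then c'.+1 else 0.
  case: (B2) eB' w => [//|[c' L'] B2' -> w].
  have /andP[/= L'0 _] : wf_block pi (c', L').
    by move/wf_catr: w; rewrite wf_cons => /and3P[].
  by have [V' ->] := bw_hd pi B2' (L'0 : 0 < (c', L').2).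
have sd0 : sd a b 0 = false by rewrite /sd /kc; lia.
case: (boolP (on_pair c)) est => [hc|hc] /= est.
  have [X1 X2 Y1 Y2] := block_hds eB hc.
  have cd := on_pairP hc.
  have ih := IHB _ (sd a b (hd (bw pi B2))) eB'; rewrite -ih; last first.
    case: (B2) Y1 Y2 hdB2 => [|[c' L'] B2'] Y1 Y2 e; rewrite e ?sd0 //.
    by move: Y1 Y2; rewrite e /on_pair !eqSS => /negPf-> /negPf->.
  rewrite (walk_in phiE L st cd) -/(zt _) -!mulgA mulKg; rewrite -/zt.
  case: ifP => fl /=; last first.
    by move/negbT: fl; rewrite /flag negbK est => /eqP->; rewrite -/zt.
  have [k _] := block_flag eB hc fl.
  have -> : sd a b (hd (bw pi B2)) = ~~ (st (+) odd L).
    by move: fl; rewrite /flag est /= => ne; apply/eqP; move: ne;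
      case: (_ (+) _); case: (sd _ _ _).
  have := corr_alt (o := o) m ab L cd X1 X2 k; rewrite -est => cr.
  have := gprod_alt_cancel c (pi c) L (negbT (odd_double m)); rewrite -cr => cc.
  rewrite /shift /=; move: cc.
  case: leqP => _ /= cc; rewrite ?piK -cc -!mulgA; congr (_ * (_ * _))%g.
    by rewrite mulVKg.
  by rewrite mulVKg.
have ca : cl pi c != cl pi a by rewrite -on_pair_cl.
have walk w' : (forall v, v \in w' -> ~~ on_pair v /\ sd a b v.+1 = st) ->
    (phi (gprod us w') = zt st * gprod us w' * (zt st)^-1)%g.
  elim: w' => [|v w' IHw] hw; first by rewrite /= morph1 mulg1 mulgV.
  have [|hv sv] := hw v; first by rewrite inE eqxx.
  rewrite /= gmulfM IHw => [|v' hv']; last by apply: hw; rewrite inE hv' orbT.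
  move: hv; rewrite negb_or => /andP[va vb].
  by rewrite (walk_out ab phiE va vb) sv -/zt !mulgA mulgVK.
have side_pi : sd a b (pi c).+1 = st.
  rewrite est; symmetry; apply: (long_side Msym Mge5 Vsq Vnc lab ca).
  by rewrite (cl_pi piK).
have hpc : ~~ on_pair (pi c) by rewrite on_pair_cl (cl_pi piK).
rewrite walk => [|v]; last first.
  move=> hv; have : v = c \/ v = pi c.
    elim: (L) (c) (pi c) hv => [//|L' IHL] x y; rewrite inE => /orP[/eqP->|/IHL[]];
    by [left | right | left].
  by case=> ->.
have ih := IHB _ st eB'; rewrite -ih ?mulgA ?mulVg ?mul1g //; last first.
have hl : hd (rev (bw pi (rcons B1 (c, L)))) = (if odd L then c else pi c).+1.
  exact: hd_prev_rcons.
have sl : sd a b (hd (rev (bw pi (rcons B1 (c, L))))) = st.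
  by rewrite hl; case: odd.
case: (B2) hdB2 eB' eV => [|[c' L'] B2'] hdB2 eB' eV.
  rewrite -sl -sd0 -[0]/(hd [::]); apply: (long_adj Msym Mge5 Vsq Vnc lab eV) => //;
    rewrite hl eqSS; move: hc hpc; rewrite /on_pair !negb_or;
    by case: odd => /andP[? ?] /andP[? ?].
case: ifP => hc'; first by rewrite sl.
rewrite -hdB2 -sl; apply: (long_adj Msym Mge5 Vsq Vnc lab eV).
- by rewrite hl eqSS; move: hc hpc; rewrite /on_pair !negb_or;
    case: odd => /andP[? ?] /andP[? ?].
- by rewrite hl eqSS; move: hc hpc; rewrite /on_pair !negb_or;
    case: odd => /andP[? ?] /andP[? ?].
- by rewrite hdB2 eqSS; move/negbT: hc'; rewrite negb_or => /andP[].
- by rewrite hdB2 eqSS; move/negbT: hc'; rewrite negb_or => /andP[].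
Qed.

Lemma theta_blocks : phi (gprod us V) = gprod us (bw pi (twist_blocks [::] B)).
Proof.
have sd0 : sd a b 0 = false by rewrite /sd /kc; lia.
have eV : bw pi B = V by apply: bw_dec.
rewrite -(theta_suffix (B1 := [::]) (st := false)) //.
  by rewrite invg1 mul1g eV.
case eB : B eV => [//|[c L] B'] eV; case: ifP => // hc.
have w : wf pi B by apply: dec_wf.
have /andP[/= L0 _] : wf_block pi (c, L) by move: w; rewrite eB wf_cons => /and3P[].
have hV : hd V = c.+1.
  by rewrite -eV; have [V' ->] := bw_hd pi B' (L0 : 0 < (c, L).2).
have := long_adj Msym Mge5 Vsq Vnc lab (X := [::]) (Y := V) erefl isT isT.
rewrite hV !eqSS sd0 => -> //; move/negbT: hc; rewrite negb_or => /andP[] //.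
Qed.

Lemma size_twist_blocks B1 B2 : size (twist_blocks B1 B2) = size B2.
Proof. by elim: B2 B1 => //= x B2 IHB B1; rewrite IHB. Qed.

Lemma nth_twist_blocks B1 B2 i : i < size B2 -> nth (0, 0) (twist_blocks B1 B2) i =
  let x := nth (0, 0) B2 i in
  if on_pair x.1 && flag (B1 ++ take i B2) x (drop i.+1 B2) then shift x else x.
Proof.
elim: B2 B1 i => [//|x B2 IHB] B1 [|i] /= lt_i; first by rewrite cats0 drop0.
by rewrite IHB // cat_rcons.
Qed.

End ThetaBlocks.

(** * Normalizing the word of a coordinate *)

Lemma size_nf_gprod w : size (nf (gprod us w)) <= size w.
Proof.
elim: w => [|x w IHw]; first by rewrite /= nf1.
exact: leq_trans (size_nf_us _ _) _.
Qed.

Section Compare.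
Local Open Scope nat_scope.

Lemma sumn_lt (s s' : seq nat) i0 : size s = size s' ->
  (forall i, i < size s -> nth 0 s i <= nth 0 s' i) -> i0 < size s ->
  nth 0 s i0 < nth 0 s' i0 -> sumn s < sumn s'.
Proof.
elim: s s' i0 => [//|x s IHs] [//|x' s'] i0 [es] le lt_i lt.
have le0 := le 0 isT; have leS i : i < size s -> nth 0 s i <= nth 0 s' i := le i.+1.
case: i0 lt_i lt => [|i0] /= lt_i lt.
  suff : sumn s <= sumn s' by move: le0 lt => /=; lia.
  elim: s s' es leS {IHs le lt lt_i le0} => [//|y s IHs] [//|y' s'] [es] le /=.
  by have := le 0 isT; have := IHs s' es (fun i => le i.+1); rewrite /=; lia.
by have := IHs s' i0 es leS lt_i lt; move: le0 => /=; lia.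
Qed.

Variable M : nat -> nat -> option nat.
Hypothesis Msym : forall x y, M x y = M y x.
Hypothesis Mge5 : forall x y m : nat, x != y -> M x y = Some m -> 5 <= m.

Let Mge2 x y m : x != y -> M x y = Some m -> 2 <= m.
Proof. by move=> xy /(Mge5 xy); lia. Qed.

Definition braided (G : groupType) (g : nat -> G) := forall x y m : nat,
  x != y -> M x y = Some m -> galt (g x) (g y) m = galt (g y) (g x) m.

Lemma ws_braided : braided (ws M).
Proof. by move=> x y m; apply: ws_braid. Qed.

Definition uval mv l : seq nat := nf (hzs mv us l).

Lemma uval_sq mv l : sqfree (uval mv l).
Proof. exact: nf_sqfree. Qed.

Lemma uval_nc mv l : noncrossing (gprod us (uval mv l)).
Proof. by rewrite nfK; apply: noncrossing_value. Qed.

Lemma uval_ws mv l : gprod (ws M) (uval mv l) = hzs mv (ws M) l.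
Proof.
have [phi phiE] := us_lift (@ws_sq M).
have pE : phi \o us = ws M by apply/funext.
by rewrite -pE -gprod_morph nfK -hzs_morph.
Qed.

Lemma long_oriented V x : sqfree V -> noncrossing (gprod us V) ->
  partner M V x != x -> exists a b m o,
  [/\ a < b, long M V a b, M a b = Some m, on_pair a b x &
      forall o' L, thr2 V o' a b L -> o' = o].
Proof.
move=> sq nc px; have lx := partner_long px; set y := partner M V x in px lx.
have [a [b [ab [lab hx]]]] : exists a b, a < b /\ long M V a b /\ on_pair a b x.
  rewrite neq_ltn in px; case/orP: px => h.
    exists y, x; split=> //; split; first exact: long_sym.
    by rewrite /on_pair eqxx orbT.
  by exists x, y; rewrite /on_pair eqxx.
have [_ [m Mm _]] := lab; have [o [L [_ h]]] := long_thr Msym Mge5 sq nc lab Mm.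
exists a, b, m, o; split=> // o' L' h'.
exact: (long_dir Msym Mge5 sq nc lab h' h).
Qed.

(** The twist is prepended: in [ucox] it acts through its automorphism and rewrites [V] block by
    block, while a braided tuple is fixed by it before [mv] is applied. *)
Lemma twist_value mv l a b m o : let V := uval mv l in a < b ->
  long M V a b -> M a b = Some m -> (forall o' L, thr2 V o' a b L -> o' = o) ->
  exists mv',
    uval mv' l =
      nf (gprod us (bw (partner M V)
        (twist_blocks M V a b m [::] (dec (partner M V) V)))) /\
    forall (G : groupType) (g : nat -> G), braided g -> hzs mv' g l = hzs mv g l.
Proof.
move=> V ab lab Mm o_dir; have [mv0 [e0 id0]] := utwist_value ab o m.
have [_ [m' _ _]] := lab; have nab : a != b by rewrite neq_ltn ab.
exists (mv0 ++ mv); split; last first.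
  by move=> G g bg; rewrite hzs_cat id0 //; apply: bg.
have [phi [phiE _]] := hzs_lift mv0; rewrite e0 in phiE.
rewrite -(theta_blocks Msym Mge5 (uval_sq mv l) (@uval_nc mv l) ab lab o_dir phiE).
by rewrite /V /uval nfK hzs_cat e0 -phiE -hzs_morph.
Qed.

(** A subword of length >= m + 2 forces, by the window of 2, all flagged blocks on its pair to have
    length at least m. The twist therefore lengthens none of them and shortens that one, so the
    total length decreases. *)
Lemma normalize mv l : exists mv', normalized M (uval mv' l) /\
  forall (G : groupType) (g : nat -> G), braided g -> hzs mv' g l = hzs mv g l.
Proof.
have [n] := ubnP (size (uval mv l)); elim: n mv => // n IHn mv lt_n.
case: (pselect (normalized M (uval mv l))) => [nV|nV]; first by exists mv.
set V := uval mv l in lt_n nV.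
have sq := uval_sq mv l; have nc := @uval_nc mv l; rewrite -/V in sq nc.
have [x [y [m [p [q [xy [Mxy eV]]]]]]] : exists x y m p q,
    x != y /\ M x y = Some m /\ V = p ++ alt x y m.+2 ++ q.
  apply: contra_notP nV => h x y m p q xy Mxy eV.
  by apply: h; exists x, y, m, p, q.
have lxy : long M V x y.
  split; first exact/eqP; exists m => //.
  have e : m.+2 = m.-1 + (m.+2 - m.-1) by lia.
  exists p; eexists; left; rewrite eV e alt_cat -catA; reflexivity.
have pi_inv := partnerK Msym Mge5 sq nc.
have pxy := partnerE Msym Mge5 sq nc lxy; have px : partner M V x != x.
  by rewrite pxy eq_sym.
have [a [b [m' [o [ab lab Mab hx o_dir]]]]] := long_oriented sq nc px.
have em : m' = m.
  have [/eqP nab _] := lab; have pab := partnerE Msym Mge5 sq nc lab.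
  case/orP: hx => /eqP ex; first by move: Mab Mxy; rewrite -pab -pxy ex => -> [].
  by move: Mab Mxy; rewrite Msym -pxy ex -{3}pab pi_inv => -> [].
subst m'; have m5 := Mge5 xy Mxy.
have w := dec_wf pi_inv sq; have eB := bw_dec pi_inv V.
have [|B1 [c [L [B2 [i [eB1 le_L _ ex]]]]]] :=
    @locate_block _ pi_inv _ p q x m.+2 w px isT.
  by rewrite eB pxy.
have hc : on_pair a b c.
  rewrite (on_pair_cl Msym Mge5 sq nc lab).
  move: hx; rewrite (on_pair_cl Msym Mge5 sq nc lab) ex.
  by rewrite (cl_alt pi_inv).
have fl : flag M V a b B1 (c, L) B2.
  case: (boolP (flag M V a b B1 (c, L) B2)) => // nf0.
  have := block_noflag Msym Mge5 sq nc ab lab eB1 hc nf0; lia.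
have flag_thr C1 d K C2 : dec (partner M V) V = C1 ++ (d, K) :: C2 ->
    on_pair a b d -> flag M V a b C1 (d, K) C2 -> thr2 V o a b K.
  move=> e hd f; have [_ t] := block_flag Msym Mge5 sq nc ab lab o_dir e hd f.
  case: (on_pairP Msym Mge5 sq nc lab hd) t => -[-> ->] t; [by left | by right].
have t0 := flag_thr _ _ _ _ eB1 hc fl.
have nab : a != b by rewrite neq_ltn ab.
have low K : thr2 V o a b K -> m <= K.
  move=> t; suff : L <= K + 2 by lia.
  case: t => t; first exact: (thr_window sq nc nab t t0).
  by apply: (thr_window sq nc _ t (thr2_sym t0)); rewrite eq_sym.
have [mv' [eV' idV']] := twist_value ab lab Mab o_dir.
have lt_V' : size (uval mv' l) < size V.
  rewrite eV' -/V; apply: leq_ltn_trans (size_nf_gprod _) _.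
  have sz C : size (bw (partner M V) C) = sumn [seq x.2 | x <- C].
    elim: C => [//|[d K] C IHC]; rewrite /bw /= size_cat size_alt; congr addn.
    exact: IHC.
  have -> : size V = sumn [seq x.2 | x <- dec (partner M V) V] by rewrite -sz eB.
  rewrite sz; set B := dec _ _ in eB1 w *.
  have nB j : j < size B -> nth 0 [seq x.2 | x <- twist_blocks M V a b m [::] B] j =
      let x := nth (0, 0) B j in
      if on_pair a b x.1 && flag M V a b (take j B) x (drop j.+1 B)
      then (shift M V m x).2 else x.2.
    move=> lt_j; rewrite (nth_map (0, 0)) ?size_twist_blocks //.
    by rewrite nth_twist_blocks //=; case: ifP.
  have sB1 : size B1 < size B by rewrite eB1 size_cat /=; lia.
  apply: (@sumn_lt _ _ (size B1)); rewrite ?size_map ?size_twist_blocks //.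
    move=> j lt_j; rewrite nB // (nth_map (0, 0)) //=.
    case: ifP => // /andP[hd f].
    have eBj := dec_split lt_j; case eb : (nth (0, 0) B j) hd f eBj => [d K] hd f eBj.
    have := low K (flag_thr _ _ _ _ eBj hd f).
    by rewrite /shift /=; case: (leqP K m.*2) => /=; lia.
  have nc0 : nth (0, 0) B (size B1) = (c, L).
    by rewrite eB1 nth_cat ltnn subnn.
  rewrite nB // (nth_map (0, 0)) // nc0 /= hc eB1 take_size_cat // drop_cat.
  have -> : (size B1).+1 < size B1 = false by lia.
  have -> : (size B1).+1 - size B1 = 1 by lia.
  rewrite /= drop0 fl /shift /=; case: (leqP L m.*2) => /=; lia.
have [|mv'' [nV'' idV'']] := IHn mv'; first by lia.
exists mv''; split=> // G g bg; by rewrite idV'' // idV'.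
Qed.

End Compare.

(** * Normalized words with the same value in the Coxeter group *)

Section CompareWords.
Local Open Scope nat_scope.
Variable M : nat -> nat -> option nat.
Hypothesis Msym : forall x y, M x y = M y x.
Hypothesis Mge5 : forall x y m : nat, x != y -> M x y = Some m -> 5 <= m.

Let Mge2 (x y m : nat) : x != y -> M x y = Some m -> 2 <= m.
Proof. by move=> xy /(Mge5 xy); lia. Qed.

Definition good V :=
  [/\ sqfree V, noncrossing (gprod us V) & normalized M V].

Notation Bk V := (dec (partner M V) V).
Notation Bs V := [seq shrink M V b | b <- dec (partner M V) V].

Lemma shrink_flips V V' : good V -> good V' ->
  gprod (ws M) V = gprod (ws M) V' ->
  flips M (bw (partner M V) (Bs V)) (bw (partner M V') (Bs V')).
Proof.
move=> [sq nc nV] [sq' nc' nV'] e.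
apply: (matsumoto Msym Mge2).
- exact: thinBs_reduced.
- exact: thinBs_reduced.
- by rewrite !shrink_wp.
Qed.

Lemma shrink_frel V V' : good V -> good V' ->
  gprod (ws M) V = gprod (ws M) V' ->
  exists2 B2, bw (partner M V') (Bs V') = bw (partner M V) B2 &
    fliprel (partner M V) M (Bs V) B2.
Proof.
move=> gV gV' e; have f := shrink_flips gV gV' e; have [sq nc nV] := gV.
apply: (thin_flips (partnerK Msym Mge5 sq nc) Msym Mge5) f.
exact: shrink_thin.
Qed.

Lemma nth_alt_infix (pi : nat -> nat) B i k : involutive pi -> i < size B ->
  k <= (nth (0, 0) B i).2 -> exists p q,
  bw pi B = p ++ alt (nth (0, 0) B i).1 (pi (nth (0, 0) B i).1) k ++ q.
Proof.
move=> piK lt_i; case eb : (nth _ _ i) => [c L] /= le_k.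
have eL : L = k + (L - k) by lia.
exists (bw pi (take i B)); eexists.
rewrite -{1}(cat_take_drop i B) (drop_nth (0, 0)) // eb bw_cat; congr (_ ++ _).
rewrite /bw /= {1}eL alt_cat -catA; reflexivity.
Qed.

(** A block of length >= m - 1 keeps that length under [shrink] and under flips, so it shows up in
    the shrunken word of [V']; that word is thin, and so its long alternating subwords join partners
    of [V']. *)
Lemma partner_sub V V' c : good V -> good V' ->
  gprod (ws M) V = gprod (ws M) V' ->
  partner M V c != c -> partner M V' c = partner M V c.
Proof.
move=> gV gV' e pc; have [sq nc nV] := gV; have [sq' nc' nV'] := gV'.
have [B2 eB2 [sB2 rB2]] := shrink_frel gV gV' e.
have piK := partnerK Msym Mge5 sq nc; have piK' := partnerK Msym Mge5 sq' nc'.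
have [_ [m Mm [p [q h]]]] := partner_long pc.
have cp : c != partner M V c by rewrite eq_sym.
have m5 := Mge5 cp Mm.
have [d [d0 dc]] : exists d, V = p ++ alt d (partner M V d) m.-1 ++ q /\
    cl (partner M V) d = cl (partner M V) c.
  case: h => h; first by exists c.
  by exists (partner M V c); rewrite piK cl_pi.
have pd : partner M V d != d.
  by apply: contraNneq pc => pd; rewrite (pi_fix_cl piK dc pd) pd.
have m0 : 0 < m.-1 by lia.
have wB := dec_wfV Msym Mge5 sq nc.
have [B1 [f [L [B3 [i [eB le_L _ ex]]]]]] :=
  locate_block piK wB pd m0 (etrans (bw_dec piK V) d0).
have fc : cl (partner M V) f = cl (partner M V) c.
  by rewrite -dc ex (cl_alt piK).
set s := size B1.
have lt_s : s < size (Bk V) by rewrite eB size_cat /=; lia.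
have ns : nth (0, 0) (Bk V) s = (f, L) by rewrite eB nth_cat ltnn subnn.
have pf : partner M V f != f.
  by apply: contraNneq pc => pf; rewrite (pi_fix_cl piK fc pf) pf.
have Mf : M f (partner M V f) = Some m.
  move/eqP: fc; rewrite (clE piK) => /orP[/eqP->//|/eqP->].
  by rewrite piK Msym.
have [f2 [K [e2 f2c le_K]]] : exists f2 K, [/\ nth (0, 0) B2 s = (f2, K),
    cl (partner M V) f2 = cl (partner M V) c & m.-1 <= K].
  have := rB2 s; rewrite size_map => /(_ lt_s).
  rewrite (nth_map (0, 0)) // ns.
  have [f1 [K [-> f1c le_K]]] : exists f1 K, [/\ shrink M V (f, L) = (f1, K),
      cl (partner M V) f1 = cl (partner M V) c & m.-1 <= K].
    rewrite /shrink /= pf Mf /=; case: eqP => [[eL]|_].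
      exists (partner M V f), L.-2; rewrite cl_pi //; split=> //; lia.
    by exists f, L; split=> //; lia.
  case=> [-> | [_ _ ->]]; first by exists f1, K.
  by exists (partner M V f1), K; rewrite cl_pi.
have lt_s2 : s < size B2 by rewrite -sB2 size_map.
have [|p2 [q2 e3]] := @nth_alt_infix _ B2 s m.-1 piK lt_s2; first by rewrite e2.
rewrite e2 /= in e3.
have pf2 : partner M V f2 != f2.
  by apply: contraNneq pc => p2f; rewrite (pi_fix_cl piK f2c p2f) p2f.
have Mf2 : M f2 (partner M V f2) = Some m.
  move/eqP: f2c; rewrite (clE piK) => /orP[/eqP->//|/eqP->].
  by rewrite piK Msym.
rewrite eq_sym in pf2.
have [ef2 _] := thin_long piK' Mge5 (shrink_thin Msym Mge5 sq' nc' nV') pf2 Mf2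
  (etrans eB2 e3).
move/eqP: f2c; rewrite (clE piK) => /orP[/eqP f2c|/eqP f2c].
  by rewrite -f2c ef2.
by move: ef2; rewrite f2c piK => {1}->; rewrite piK'.
Qed.

Lemma partner_eq V V' : good V -> good V' ->
  gprod (ws M) V = gprod (ws M) V' -> partner M V = partner M V'.
Proof.
move=> gV gV' e; apply/funext => c.
case: (eqVneq (partner M V c) c) => [ec|nc]; last by rewrite (partner_sub gV gV').
case: (eqVneq (partner M V' c) c) => [->//|nc'].
exact: (partner_sub gV' gV (esym e) nc').
Qed.

Section Same.
Variables V V' : seq nat.
Hypotheses (gV : good V) (gV' : good V').
Hypothesis eW : gprod (ws M) V = gprod (ws M) V'.
Let pi := partner M V.
Let B := dec pi V.
Let B' := dec pi V'.

Let piK : involutive pi.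
Proof. by have [sq nc _] := gV; apply: (partnerK Msym Mge5 sq nc). Qed.

Let frelB : fliprel pi M [seq shrink M V b | b <- B] [seq shrink M V b | b <- B'].
Proof.
have [sq nc nV] := gV; have [sq' nc' nV'] := gV'.
have [B2 eB2 rB2] := shrink_frel gV gV' eW; have pe := partner_eq gV gV' eW.
have tB := shrink_thin Msym Mge5 sq nc nV.
have tB' := shrink_thin Msym Mge5 sq' nc' nV'.
have [wB2 _ _ _] := frel_thin piK Msym Mge5 rB2 tB.
have [wB' _ _ _] := tB'; rewrite -pe in wB' eB2.
suff -> : [seq shrink M V b | b <- B'] = B2 by [].
rewrite -(dec_bw piK wB2) -eB2 (dec_bw piK wB').
by apply: eq_map => b; rewrite /shrink pe.
Qed.

Lemma compare_size : size B = size B'.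
Proof. by case: frelB; rewrite !size_map. Qed.

(** After shrinking, two blocks agree or are full and exchanged. Undoing the shrinking on either
    side leaves the lengths m - 1, m and m + 1, with L and 2m - L opposite each other. *)
Lemma compare_block i : i < size B ->
  let b := nth (0, 0) B i in let b' := nth (0, 0) B' i in
  b' = b \/ exists2 m, M b.1 (pi b.1) = Some m &
    [/\ pi b.1 != b.1, b' = (pi b.1, m.*2 - b.2), m.-1 <= b.2 & b.2 <= m.+1].
Proof.
move=> lt_i b b'; case: frelB => _ /(_ i); rewrite size_map => /(_ lt_i).
rewrite !(nth_map (0, 0)) -?compare_size // -/b -/b' /shrink -/pi.
have m5 (x m : nat) : pi x != x -> M x (pi x) = Some m -> 5 <= m.
  by rewrite eq_sym => px; apply: Mge5 px.
case: b b' => [c L] [c' L'] /=.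
case: (boolP ((pi c != c) && _)) => [/andP[pc /eqP Mc]|nb] /=;
  case: (boolP ((pi c' != c') && _)) => [/andP[pc' /eqP Mc']|nb'] /= [].
- case=> /(can_inj piK) ec; subst c'; move: Mc'; rewrite Mc => -[eL] eL'.
  left; have := m5 _ _ pc Mc => h5; congr (_, _); lia.
- rewrite piK Msym Mc => -[_ [h]]; have := m5 _ _ pc Mc; lia.
- case=> -> ->; right; exists L.-1 => //; have := m5 _ _ pc Mc.
  move=> h5; split=> //; try lia; congr (_, _); lia.
- rewrite piK Msym Mc => -[_ [h]]; have := m5 _ _ pc Mc; lia.
- case=> ec eL; have {ec} ec : c' = pi c by rewrite -ec piK.
  subst c'; move: pc' Mc'; rewrite piK Msym => pc' Mc'; right; exists L'.-1 => //.
  rewrite eq_sym in pc'; have := m5 _ _ pc' Mc'.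
  by move=> h5; split=> //; try lia; congr (_, _); lia.
- case=> pc Mc [/(can_inj piK) ec eL]; subst c'; move: Mc'; rewrite Mc => -[eL'].
  have := m5 _ _ pc Mc; lia.
- by case=> -> ->; left.
- case=> pc Mc [-> ->]; right; exists L => //.
  by split=> //; try lia; congr (_, _); lia.
Qed.

End Same.

End CompareWords.

(** * Twisting one word towards another *)

Lemma sd_kc a b c d h o : a < b -> (c = a /\ d = b) \/ (c = b /\ d = a) ->
  kc o d.+1 h c.+1 -> sd a b h = if c == a then ~~ o else o.
Proof.
move=> ab cd; rewrite /sd /kc; case: cd => -[-> ->];
  rewrite ?eqxx ?(gtn_eqF ab); case: o => /=; lia.
Qed.

Lemma split_nth (T : Type) (x0 : T) s i : (i < size s)%N ->
  s = take i s ++ nth x0 s i :: drop i.+1 s.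
Proof. by move=> lt_i; rewrite -drop_nth // cat_take_drop. Qed.

Section Step.
Local Open Scope nat_scope.
Variable M : nat -> nat -> option nat.
Hypothesis Msym : forall x y, M x y = M y x.
Hypothesis Mge5 : forall x y m : nat, x != y -> M x y = Some m -> 5 <= m.

Variables V V' : seq nat.
Hypotheses (gV : good M V) (gV' : good M V').
Hypothesis eW : gprod (ws M) V = gprod (ws M) V'.
Let pi := partner M V.
Let B := dec pi V.
Let B' := dec pi V'.
Notation bl := (nth (0, 0)).

Let piK : involutive pi.
Proof. by have [sq nc _] := gV; apply: (partnerK Msym Mge5 sq nc). Qed.

Let pi' : partner M V' = pi.
Proof. by rewrite /pi (partner_eq Msym Mge5 gV gV' eW). Qed.

Let sBB' : size B = size B' := compare_size Msym Mge5 gV gV' eW.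

Let wB : wf pi B.
Proof. by have [sq nc _] := gV; apply: (dec_wfV Msym Mge5 sq nc). Qed.

Let wB' : wf pi B'.
Proof. by have [sq nc _] := gV'; rewrite /B' -pi'; apply: (dec_wfV Msym Mge5 sq nc). Qed.

Let cmp i : i < size B -> bl B' i = bl B i \/
  exists2 m, M (bl B i).1 (pi (bl B i).1) = Some m &
    [/\ pi (bl B i).1 != (bl B i).1, bl B' i = (pi (bl B i).1, m.*2 - (bl B i).2),
        m.-1 <= (bl B i).2 & (bl B i).2 <= m.+1].
Proof. exact: (compare_block Msym Mge5 gV gV' eW). Qed.

Lemma compare_cl i : i < size B -> cl pi (bl B' i).1 = cl pi (bl B i).1.
Proof.
move=> lt_i; have [->//|[m _ [_ -> _ _]]] := cmp lt_i.
by rewrite cl_pi.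
Qed.

Lemma compare_bsim : bsim pi B B'.
Proof.
split=> // i lt_i; split; first by rewrite compare_cl.
  by rewrite sBB' in lt_i; have /andP[] := bl_wf wB' lt_i.
have [->//|[m Mm [pc -> le1 le2]]] := cmp lt_i.
rewrite eq_sym in pc; have := Mge5 pc Mm => m5 /= [] h; exfalso; lia.
Qed.

Variables (a b m : nat) (o o' : bool).
Hypotheses (ab : a < b) (lab : long M V a b) (lab' : long M V' a b).
Hypothesis Mab : M a b = Some m.
Hypothesis o_dir : forall d L, thr2 V d a b L -> d = o.
Hypothesis o_dir' : forall d L, thr2 V' d a b L -> d = o'.
Variable k : nat.
Hypotheses (lt_k : k < size B) (pair_k : on_pair a b (bl B k).1).
Hypothesis neq_k : bl B' k <> bl B k.

Let fl (C : seq (nat * nat)) U i :=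
  flag M U a b (take i C) (bl C i) (drop i.+1 C).

Let on_pairE c : on_pair a b c = (cl pi c == cl pi a).
Proof. by have [sq nc _] := gV; apply: (on_pair_cl Msym Mge5 sq nc lab). Qed.

Let adj i : i.+1 < size B -> cl pi (bl B i).1 != cl pi (bl B i.+1).1.
Proof. by move: wB => /andP[_ /(sortedP (0, 0)) h] /h. Qed.

(** The preceding blocks may differ in letters and lengths but not in class, and one class lies on
    one side. *)
Lemma side_prev i : i < size B -> on_pair a b (bl B i).1 ->
  sd a b (hd (rev (bw pi (take i B)))) = sd a b (hd (rev (bw pi (take i B')))).
Proof.
have [sq nc _] := gV.
case: i => [|i] lt_i; first by rewrite !take0.
rewrite on_pairE => /eqP ci; have := adj lt_i; rewrite ci => cn.
have lt_i0 : i < size B by lia.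
have lt_i' : i < size B' by rewrite -sBB'.
rewrite !(take_nth (0, 0)) //; have := compare_cl lt_i0.
have /andP[] := bl_wf wB lt_i0; have /andP[] := bl_wf wB' lt_i'.
case: (bl B i) cn => c L cn; case: (bl B' i) => c' L' /= L0' _ L0 _ cc.
rewrite !hd_prev_rcons //; apply: (long_side Msym Mge5 sq nc lab); rewrite -/pi.
  by case: odd; rewrite ?cl_pi.
by case: odd; case: odd; rewrite ?cl_pi.
Qed.

Lemma side_next i : i < size B -> on_pair a b (bl B i).1 ->
  sd a b (hd (bw pi (drop i.+1 B))) = sd a b (hd (bw pi (drop i.+1 B'))).
Proof.
have [sq nc _] := gV; move=> lt_i; rewrite on_pairE => /eqP ci.
case: (leqP (size B) i.+1) => [le_i|lt_i1].
  by rewrite !drop_oversize // -sBB'.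
have lt_i' : i.+1 < size B' by rewrite -sBB'.
have := adj lt_i1; rewrite ci eq_sym => cn.
rewrite (drop_nth (0, 0) lt_i1) (drop_nth (0, 0) lt_i').
have := compare_cl lt_i1.
have /andP[L0 _] := bl_wf wB lt_i1; have /andP[L0' _] := bl_wf wB' lt_i'.
have [v ->] := bw_hd pi (drop i.+2 B) L0.
have [v' ->] := bw_hd pi (drop i.+2 B') L0'.
by move=> /esym /(long_side Msym Mge5 sq nc lab) => h; apply: h.
Qed.

Lemma flag_compare i : i < size B -> on_pair a b (bl B i).1 ->
  bl B' i = bl B i -> fl B V i = fl B' V' i.
Proof.
by move=> lt_i h e; rewrite /fl /flag e pi' side_prev // side_next.
Qed.

(** At block [k] both words come from the same side but enter with exchanged letters. *)
Lemma dir_neq : o' = ~~ o.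
Proof.
have [sq nc _] := gV; have [sq' nc' _] := gV'.
have lt_k' : k < size B' by rewrite -sBB'.
have [//|[m' Mm' [pc e le1 le2]]] := cmp lt_k.
rewrite eq_sym in pc; have m5 := Mge5 pc Mm'.
have eB := dec_split lt_k.
have eB' := split_nth (0, 0) lt_k'; rewrite {1}/B' -pi' in eB'.
move: e eB eB' (pair_k) m5 le1 le2 pc.
rewrite -/B -/B' -/pi; case: (bl B k) => c L /= -> eB eB' hc m5 le1 le2 pc.
have hc' : on_pair a b (pi c) by move: hc; rewrite !on_pairE cl_pi.
have f1 : flag M V a b (take k B) (c, L) (drop k.+1 B).
  apply: contraT => nf0.
  have := block_noflag Msym Mge5 sq nc ab lab eB hc nf0; lia.
have f2 : flag M V' a b (take k B') (pi c, m'.*2 - L) (drop k.+1 B').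
  apply: contraT => nf0.
  have := block_noflag Msym Mge5 sq' nc' ab lab' eB' hc' nf0; lia.
have [k1 _] := block_flag Msym Mge5 sq nc ab lab o_dir eB hc f1.
have [k2 _] := block_flag Msym Mge5 sq' nc' ab lab' o_dir' eB' hc' f2.
have cd := on_pairP Msym Mge5 sq nc lab hc.
have cd' := on_pairP Msym Mge5 sq nc lab hc'.
rewrite pi' in k2.
have := side_prev lt_k; rewrite (surjective_pairing (bl B k)) => /(_ pair_k).
rewrite (sd_kc ab cd k1) (sd_kc ab cd' k2).
have ba : (b == a) = false by rewrite gtn_eqF.
by move: cd; rewrite -/pi => -[] [-> ->]; rewrite eqxx ba; case: (o); case: (o').
Qed.

(** An unflagged block has at most 2 < m - 1 letters, so it already agrees. A flagged block that
    agreed would turn in the same direction in both words, against [dir_neq]; hence every flagged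
    block differs, and the shift is exactly the difference. *)
Lemma twist_blocks_compare i : i < size B -> bl (twist_blocks M V a b m [::] B) i =
  if on_pair a b (bl B i).1 then bl B' i else bl B i.
Proof.
have [sq nc _] := gV; have [sq' nc' _] := gV'.
move=> lt_i; rewrite nth_twist_blocks //= -/(fl B V i); have ci := cmp lt_i.
have lt_i' : i < size B' by rewrite -sBB'.
have eB := dec_split lt_i.
have eB' := split_nth (0, 0) lt_i'; rewrite {1}/B' -pi' in eB'.
case: (boolP (on_pair a b _)) => //= hi; have fc := flag_compare lt_i hi.
have sp := side_prev lt_i hi; have cd := on_pairP Msym Mge5 sq nc lab hi.
rewrite -/B -/B' -/pi in eB eB' cd; move: ci eB eB' hi fc cd; rewrite /fl.
case eb : (bl B i) => [c L] /= ci eB eB' hi fc cd.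
case: ifP => f; last first.
  have := block_noflag Msym Mge5 sq nc ab lab eB hi (negbT f).
  case: ci => [->//|[m' Mm' [pc _ le1 _]]] le2.
  rewrite eq_sym in pc; have := Mge5 pc Mm'; lia.
case: ci => [e|[m' Mm' [pc -> le1 le2]]].
  exfalso; move/(_ e): fc; rewrite f e => /esym f2; rewrite e in eB'.
  have [k1 _] := block_flag Msym Mge5 sq nc ab lab o_dir eB hi f.
  have [k2 _] := block_flag Msym Mge5 sq' nc' ab lab' o_dir' eB' hi f2.
  rewrite pi' in k2; move: sp; rewrite (sd_kc ab cd k1) (sd_kc ab cd k2) dir_neq.
  by case: eqP => _; case: (o).
have em : m' = m.
  by move: Mm'; case: cd => -[-> ->]; rewrite ?(Msym b) Mab => -[].
rewrite eq_sym in pc; have := Mge5 pc Mm'; rewrite /shift /= em in le1 le2 *.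
by case: (leqP L m.*2) => //; lia.
Qed.

Let T := twist_blocks M V a b m [::] B.

Let sT : size T = size B. Proof. exact: size_twist_blocks. Qed.

Let bsimT : bsim pi B T.
Proof.
have [_ h] := compare_bsim; split=> // i lt_i; rewrite twist_blocks_compare //.
have := h i lt_i; have /andP[L0 _] := bl_wf wB lt_i.
by case: ifP => // _ [cc _ _]; split.
Qed.

Lemma step_wf : wf pi T.
Proof. exact: bsim_wf bsimT wB. Qed.

(** Every block of the twisted word is a block of [V] or of [V'], so none exceeds m + 1 letters. *)
Lemma step_normalized : normalized M (bw pi T).
Proof.
have [sq nc nV] := gV; have [sq' nc' nV'] := gV'.
have kT := bsim_K bsimT (@dec_thinK _ Msym Mge5 _ sq nc).
have tT := bsim_S bsimT (@dec_thinS _ Msym Mge5 _ sq nc).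
move=> x y n p q xy Mxy e; have n5 := Mge5 xy Mxy.
have n1 : n.-1 <= n.+2 by lia.
have n4 : 4 <= n.+2 by lia.
have ey := thin_alt_partner piK step_wf kT tT e xy Mxy n4 n1.
have px : pi x != x by rewrite -ey eq_sym.
rewrite ey in e Mxy.
have [C1 [c [L [C2 [i [eT le_L _ ex]]]]]] :=
  locate_block piK step_wf px (ltn0Sn n.+1) e.
have lt_s : size C1 < size B by rewrite -sT eT size_cat /=; lia.
have lt_s' : size C1 < size B' by rewrite -sBB'.
have := twist_blocks_compare lt_s; rewrite -/T eT nth_cat ltnn subnn /=.
have := normalized_block Msym Mge5 sq nc nV lt_s.
have := normalized_block Msym Mge5 sq' nc' nV'; rewrite pi' => /(_ _ lt_s').
rewrite -/pi -/B -/B' => /= h' h.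
have pc : pi c != c.
  by move: px; rewrite ex; case: odd => //; rewrite piK eq_sym.
have Mc : M c (pi c) = Some n.
  by move: Mxy; rewrite ex; case: odd => //; rewrite piK Msym.
by case: ifP => _ ec; rewrite -ec /= in h h';
  [case: (h' pc) | case: (h pc)] => n'; rewrite Mc => -[<-]; lia.
Qed.

Lemma step_closer i : i < size B -> bl T i = bl B i \/ bl T i = bl B' i.
Proof. by move=> lt_i; rewrite twist_blocks_compare //; case: ifP; [right | left]. Qed.

Lemma step_at : bl T k = bl B' k.
Proof. by rewrite twist_blocks_compare // pair_k. Qed.

End Step.

(** * Values in the Coxeter group determine values of braided tuples *)

Section Key.
Local Open Scope nat_scope.
Variable M : nat -> nat -> option nat.
Hypothesis Msym : forall x y, M x y = M y x.
Hypothesis Mge5 : forall x y m : nat, x != y -> M x y = Some m -> 5 <= m.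

Definition diff (B B' : seq (nat * nat)) :=
  count (fun i => nth (0, 0) B i != nth (0, 0) B' i) (iota 0 (size B)).

Lemma diff_lt B B' T k : size T = size B -> k < size B ->
  (forall i, i < size B ->
    nth (0, 0) T i = nth (0, 0) B i \/ nth (0, 0) T i = nth (0, 0) B' i) ->
  nth (0, 0) T k = nth (0, 0) B' k -> nth (0, 0) B k != nth (0, 0) B' k ->
  diff T B' < diff B B'.
Proof.
move=> sT lt_k hT tk bk; rewrite /diff sT.
have kI : k \in iota 0 (size B) by rewrite mem_iota.
have cE f := seq.permP (perm_to_rem kI) f.
rewrite (cE (fun i => _ != _)) (cE (fun i => nth _ B i != _)) /= tk eqxx bk add0n.
rewrite add1n ltnS.
have sub i : i \in rem k (iota 0 (size B)) -> i < size B.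
  by move/mem_rem; rewrite mem_iota.
elim: (rem _ _) sub => [//|i s IHs] sub /=.
apply: leq_add; last by apply: IHs => j js; apply: sub; rewrite inE js orbT.
have [->//|->] := hT i (sub i (mem_head _ _)); by rewrite eqxx.
Qed.

Lemma good_val mv l : normalized M (uval mv l) -> good M (uval mv l).
Proof. by move=> h; split=> //; [apply: uval_sq | apply: uval_nc]. Qed.

(** Induction on the number of differing blocks, both words being cut along the partners of the
    first, which are also those of the second. With no difference left the words coincide, and
    [value_uniq] applies. *)
Lemma normalized_value_uniq mv l mv' l' :
  normalized M (uval mv l) -> normalized M (uval mv' l') ->
  hzs mv (ws M) l = hzs mv' (ws M) l' ->
  forall (G : groupType) (g : nat -> G), braided M g -> hzs mv g l = hzs mv' g l'.
Proof.
have [N] := ubnP (diff (dec (partner M (uval mv l)) (uval mv l))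
  (dec (partner M (uval mv l)) (uval mv' l'))).
elim: N mv => // N IHN mv lt_N nV nV' e.
have gV := good_val nV; have gV' := good_val nV'.
have eW : gprod (ws M) (uval mv l) = gprod (ws M) (uval mv' l') by rewrite !uval_ws.
have [sq nc _] := gV; have [sq' nc' _] := gV'.
have pe := partner_eq Msym Mge5 gV gV' eW.
have piK := partnerK Msym Mge5 sq nc.
have sBB' := compare_size Msym Mge5 gV gV' eW.
set V := uval mv l in lt_N nV gV eW sq nc pe piK sBB' *.
set V' := uval mv' l' in lt_N nV' gV' eW sq' nc' pe sBB' *.
set B := dec (partner M V) V in lt_N sBB' *.
set B' := dec (partner M V) V' in lt_N sBB' *.
case: (pselect (exists2 k, k < size B & nth (0, 0) B' k <> nth (0, 0) B k));
    last first.
  move=> h G g _; apply: value_uniq; rewrite -[LHS]nfK -[RHS]nfK.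
  rewrite -!/(uval _ _) -/V -/V' -(bw_dec piK V) -(bw_dec piK V') -/B -/B'.
  congr (gprod _ (bw _ _)); apply: (@eq_from_nth _ (0, 0) _ _ sBB') => i lt_i.
  by apply: contrapT => ne; apply: h; exists i => //; apply/nesym.
case=> k lt_k neq_k.
have [//|[m0 M0 [pc _ _ _]]] := compare_block Msym Mge5 gV gV' eW lt_k.
have [a [b [m [o [ab lab Mab hc o_dir]]]]] := long_oriented Msym Mge5 sq nc pc.
have pa := partnerE Msym Mge5 sq nc lab.
have pa' : partner M V' a != a by rewrite -pe pa eq_sym neq_ltn ab.
have [a1 [b1 [m1 [o' [ab1 lab1 _ ha o_dir']]]]] :=
  long_oriented Msym Mge5 sq' nc' pa'.
have pa1 := partnerE Msym Mge5 sq' nc' lab1; rewrite -pe in pa1.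
have [ea eb] : a1 = a /\ b1 = b.
  case/orP: ha => /eqP e1; first by rewrite -pa1 -e1 pa.
  by have := pa; rewrite e1 -pa1 piK => e2; lia.
rewrite ea eb in lab1 o_dir'.
have [mv1 [eV1 id1]] := twist_value Msym Mge5 ab lab Mab o_dir.
have wT := step_wf Msym Mge5 gV gV' eW ab lab lab1 Mab o_dir o_dir' lt_k hc neq_k.
have nT := step_normalized Msym Mge5 gV gV' eW ab lab lab1 Mab o_dir o_dir'
  lt_k hc neq_k.
have cT := step_closer Msym Mge5 gV gV' eW ab lab lab1 Mab o_dir o_dir'
  lt_k hc neq_k.
have kT := step_at Msym Mge5 gV gV' eW ab lab lab1 Mab o_dir o_dir'
  lt_k hc neq_k.
rewrite -/V -/B in eV1 wT nT cT kT *.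
set T := twist_blocks _ _ _ _ _ _ _ in eV1 wT nT cT kT.
rewrite nf_gprod in eV1; last exact: bw_sqfree wT.
have e1 : hzs mv1 (ws M) l = hzs mv' (ws M) l'.
  by rewrite id1 //; apply: ws_braided.
move=> G g bg; rewrite -id1 //; apply: IHN => //; rewrite ?eV1 //.
have g1 : good M (uval mv1 l) by apply: good_val; rewrite eV1.
have eW1 : gprod (ws M) (uval mv1 l) = gprod (ws M) V' by rewrite !uval_ws.
have := partner_eq Msym Mge5 g1 gV' eW1; rewrite eV1 -pe => ->.
rewrite (dec_bw piK wT); rewrite ltnS in lt_N; apply: leq_trans lt_N.
apply: (@diff_lt _ _ _ k) => //; first exact: size_twist_blocks.
by apply/eqP/nesym.
Qed.

Theorem braided_value_uniq mv l mv' l' : hzs mv (ws M) l = hzs mv' (ws M) l' ->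
  forall (G : groupType) (g : nat -> G), braided M g -> hzs mv g l = hzs mv' g l'.
Proof.
move=> e G g bg; have wb := @ws_braided M.
have [mv1 [n1 id1]] := normalize Msym Mge5 mv l.
have [mv2 [n2 id2]] := normalize Msym Mge5 mv' l'.
rewrite -(id1 G g bg) -(id2 G g bg); apply: normalized_value_uniq => //.
by rewrite id1 // id2.
Qed.

End Key.

(** * Hurwitz groups and the canonical map *)

Section Rotation.
Variable G : groupType.
Implicit Types x y : G.

Definition rot2 (p : G * G) : G * G := (p.2, p.2^-1 * p.1 * p.2).

Lemma rot2_iter x y k : iter k.*2 rot2 (x, y) =
  (x ^ (x * y) ^+ k, y ^ (x * y) ^+ k).
Proof.
elim: k => [|k IHk]; first by rewrite expg0 !conjg1.
rewrite doubleS 2!iterS IHk /rot2 /= -!(conjVg, conjMg) expgS !conjgM.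
have -> : x ^ x = x by rewrite conjgE mulKg.
by congr (_ ^ _, _ ^ _); rewrite !conjgE ?invgM ?invgK !mulgA ?mulgK.
Qed.

Lemma galt_even x y k : galt x y k.*2 = (x * y) ^+ k.
Proof. by elim: k => [//|k IHk]; rewrite doubleS /= IHk mulgA expgS. Qed.

Lemma galt_odd x y k : galt x y k.*2.+1 = (x * y) ^+ k * x.
Proof.
by elim: k => [|k IHk]; [rewrite /= mulg1 expg0 mul1g
  | rewrite doubleS 2!/(galt _ _ _.+2) /= -/(galt _ _ _.+1) IHk expgS !mulgA].
Qed.

(** This restates a braid relation through conjugations alone, the operation that the generators of
    a Hurwitz group respect. *)
Lemma galt_rot2 x y m : galt x y m = galt y x m <-> (iter m rot2 (x, y)).1 = x.
Proof.
have swap k : (y * x) ^+ k = ((x * y) ^+ k) ^ x.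
  by rewrite conjXg; congr (_ ^+ _); rewrite /conjg -mulgA mulKg.
have fixc (u c z : G) : c * u = z * c <-> z ^ c = u.
  rewrite conjgE; split=> e; first by rewrite -e mulKg.
  by rewrite -e mulgA mulgV mul1g.
rewrite -(odd_double_half m); set k := m./2; case: odd; last first.
  rewrite add0n !galt_even rot2_iter /= swap -(fixc x ((x * y) ^+ k) x) conjgE.
  split=> e; last by rewrite e mulKg.
  by rewrite {2}e mulgA mulgV mul1g.
rewrite add1n iterS rot2_iter !galt_odd swap [X in _ <-> X]/=.
rewrite -(fixc x ((x * y) ^+ k) y).
suff -> : (x * y) ^+ k ^ x * y = y * (x * y) ^+ k by [].
by rewrite conjgE -!mulgA -expgSr expgS -mulgA mulKg.
Qed.

End Rotation.

Arguments rot2 {G} p.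

Lemma iter_rot2_morph (G H : groupType) (phi : G -> H) (x y : G) k :
  (forall j, let p := iter j rot2 (x, y) in
    phi (p.2^-1 * p.1 * p.2) = (phi p.2)^-1 * phi p.1 * phi p.2) ->
  iter k rot2 (phi x, phi y) =
  (phi (iter k rot2 (x, y)).1, phi (iter k rot2 (x, y)).2).
Proof. by move=> h; elim: k => [//|k IHk]; rewrite !iterS IHk /rot2 /= h. Qed.

Section Extend.
Variables (G : groupType) (n : nat).
Implicit Types (h : {ffun 'I_n -> G}) (d : nat -> G).

Definition extend d h : nat -> G := fun l => if insub l is Some k then h k else d l.

Lemma extendE d h (k : 'I_n) : extend d h k = h k.
Proof. by rewrite /extend valK. Qed.

Lemma extend_letter d h (l : 'I_n.-1 * bool) :
  extend d (hurwitz_letter l h) = hz (val l.1, ~~ l.2) (extend d h).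
Proof.
case: l => i b; apply/funext => l.
have eh : extend d h i.+1 = h (hi i) by rewrite -(extendE d).
have el : extend d h i = h (lo i) by rewrite -(extendE d).
case: (ltnP l n) => [lt_l|le_l]; last first.
  have out h' : extend d h' l = d l by rewrite /extend insubF // ltnNge le_l.
  rewrite /hz /=; have lt_i := hi_subproof i; have -> : (l == i.+1) = false by lia.
  have -> : (l == i) = false by lia.
  by case: b; rewrite !out.
rewrite -[l]/(val (Ordinal lt_l)) extendE /hurwitz_letter /hz /= eh el.
have -> : (l == i) = (Ordinal lt_l == lo i) by [].
have -> : (l == i.+1) = (Ordinal lt_l == hi i) by [].
by case: b; rewrite ffunE /=; case: ifP => // _; case: ifP => // _;
  rewrite -(extendE d h).
Qed.

Definition moves (w : word 'I_n.-1) := rev [seq (val l.1, ~~ l.2) | l <- w].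

Lemma extend_word d h w : extend d (hurwitz_word w h) = hzs (moves w) (extend d h).
Proof.
elim: w => [//|l w IHw].
rewrite [LHS]/= extend_letter IHw /moves map_cons rev_cons -cats1 hzs_cat.
by [].
Qed.

Lemma hurwitz_word_hzs d h w (k : 'I_n) :
  hurwitz_word w h k = hzs (moves w) (extend d h) k.
Proof. by rewrite -extend_word extendE. Qed.

End Extend.

Lemma hurwitz_letter_morph (G H : groupType) n (phi : {multiplicative G -> H})
    (l : 'I_n.-1 * bool) (h : {ffun 'I_n -> G}) :
  [ffun k => phi (hurwitz_letter l h k)] = hurwitz_letter l [ffun k => phi (h k)].
Proof.
case: l => i []; apply/ffunP => k; rewrite /hurwitz_letter /= !ffunE.
  by case: ifP => // _; case: ifP => // _; rewrite !gmulfM morphV.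
by case: ifP => _; [rewrite !gmulfM morphV | case: ifP].
Qed.

Lemma hurwitz_word_morph (G H : groupType) n (phi : {multiplicative G -> H})
    (w : word 'I_n.-1) (h : {ffun 'I_n -> G}) :
  [ffun k => phi (hurwitz_word w h k)] = hurwitz_word w [ffun k => phi (h k)].
Proof. by elim: w => [//|l w IHw]; rewrite /= hurwitz_letter_morph IHw. Qed.

Section HurwitzGroup.
Variables (G : groupType) (n : nat) (g : {ffun 'I_n -> G}).
Implicit Types (h : {ffun 'I_n -> G}) (i : 'I_n.-1) (k : 'I_n).

Definition hgen (r : G) : hurwitzGroup g :=
  if insub r is Some r' then hurwitz_gen r' else 1.

Lemma hgenE (r : Hur g) : hgen (val r) = hurwitz_gen r.
Proof. by rewrite /hgen valK. Qed.

Lemma orbit_sigma i h : hurwitz_orbit g h -> hurwitz_orbit g (hurwitz_sigma i h).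
Proof. by rewrite -hurwitz_act_gen; apply: hurwitz_orbit_act. Qed.

Lemma orbit_word w : hurwitz_orbit g (hurwitz_word w g).
Proof. by exists (pres_class _ w); rewrite hurwitz_actE. Qed.

Lemma orbit_sigmaV i h : hurwitz_orbit g h -> hurwitz_orbit g (hurwitz_sigmaV i h).
Proof.
case=> b ->; exists (pres_class _ ((i, false) :: repr b)).
by rewrite hurwitz_actE.
Qed.

Lemma orbit_Hur h k : hurwitz_orbit g h -> h k \in Hur g.
Proof. by move=> gh; rewrite inE; exists h => //; exists k. Qed.

(** The defining relations concern the first two positions only. With j = i - 1, the tuple obtained
    by sigma_j and then sigma_i carries the entries of positions i, i + 1 unchanged at positions j,
    j + 1, and induction on i applies. *)
Lemma hgen_conj h i : hurwitz_orbit g h ->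
  hgen ((h (hi i))^-1 * h (lo i) * h (hi i)) =
  (hgen (h (hi i)))^-1 * hgen (h (lo i)) * hgen (h (hi i)).
Proof.
have [m] := ubnP (i : nat); elim: m i h => // m IHm i h lt_m gh.
case: (posnP i) => [i0|i_gt0].
  pose r1 : Hur g := exist _ (h (lo i)) (orbit_Hur (lo i) gh).
  pose r2 : Hur g := exist _ (h (hi i)) (orbit_Hur (hi i) gh).
  pose r : Hur g := exist _ ((h (hi i))^-1 * h (lo i) * h (hi i)) (Hur_conj i gh).
  rewrite -[h (lo i)]/(val r1) -[h (hi i)]/(val r2) -[X in hgen X]/(val r) !hgenE.
  have /PresRel/pres_classP := @HurwitzRel _ _ g h i r1 r2 r gh i0 erefl erefl erefl.
  by rewrite !pres_class_eval !word_eval_cat word_eval_winv /= !mulg1 mulgA.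
have lt_j : i.-1 < n.-1 by have := ltn_ord i; lia.
pose j := Ordinal lt_j.
have ji : hi j = lo i by apply: val_inj => /=; lia.
have jl : (lo i == lo j) = false by apply/negbTE; rewrite -val_eqE /=; lia.
have jh : (hi i == lo j) = false by apply/negbTE; rewrite -val_eqE /=; lia.
have jj : (lo j == lo i) = false by rewrite eq_sym.
have jjh : (lo j == hi i) = false by rewrite eq_sym.
have lt_jm : j < m by rewrite /=; lia.
have := IHm j (hurwitz_sigma i (hurwitz_sigma j h)) lt_jm
  (orbit_sigma i (orbit_sigma j gh)).
rewrite !hurwitz_sigmaE ji !eqxx jj jjh jh hi_neq_lo.
by rewrite ?hurwitz_sigmaE ?eqxx ?ji ?eqxx ?jh ?hi_neq_lo.
Qed.

Lemma hgen_word w : [ffun k => hgen (hurwitz_word w g k)] =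
  hurwitz_word w [ffun k => hgen (g k)].
Proof.
elim: w => [//|[i b] w IHw]; rewrite /= -IHw; have gh := orbit_word w.
set h := hurwitz_word w g in gh *; rewrite /hurwitz_letter.
apply/ffunP => k; case: b; rewrite /= !ffunE.
  by case: ifP => // _; case: ifP => // _; rewrite hgen_conj.
have := hgen_conj i (orbit_sigmaV i gh).
rewrite !hurwitz_sigmaVE !eqxx hi_neq_lo !mulgA mulVg mul1g mulgVK => e.
case: ifP => _; last by case: ifP.
by rewrite e !mulgA mulgV mul1g mulgK.
Qed.

(** The move sigma at k' - 1 carries the later entry one place to the left without changing it. *)
Lemma orbit_adjacent h (k k' : 'I_n) : hurwitz_orbit g h -> k < k' ->
  exists h' i, [/\ hurwitz_orbit g h', h' (lo i) = h k & h' (hi i) = h k'].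
Proof.
have [m] := ubnP (k' : nat); elim: m k' h => // m IHm k' h lt_m gh lt_k.
have lt_i : k'.-1 < n.-1 by have := ltn_ord k'; lia.
pose i := Ordinal lt_i; have ek : k' = hi i by apply: val_inj => /=; lia.
case: (ltnP k (lo i)) => [lt_ki|le_ik]; last first.
  have ek0 : k = lo i by apply: val_inj; move: le_ik => /=; lia.
  by exists h, i; rewrite ek ek0.
have lt_im : lo i < m by rewrite /=; lia.
have [h' [j [gh' e1 e2]]] := IHm (lo i) _ lt_im (orbit_sigma i gh) lt_ki.
rewrite /= in lt_ki; exists h', j; split=> //;
  rewrite ?e1 ?e2 hurwitz_sigmaE ?eqxx ?ek //.
have -> : (k == lo i) = false by apply/negbTE; rewrite -val_eqE /=; lia.
by have -> : (k == hi i) = false by apply/negbTE; rewrite -val_eqE /=; lia.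
Qed.

(** Once the two entries are adjacent, repeated sigma moves realise [rot2] inside the orbit, so its
    periodicity passes to the generators of the Hurwitz group. *)
Lemma hgen_braid (k k' : 'I_n) m : k < k' ->
  galt (g k) (g k') m = galt (g k') (g k) m ->
  galt (hgen (g k)) (hgen (g k')) m = galt (hgen (g k')) (hgen (g k)) m.
Proof.
move=> lt_k /galt_rot2 e; apply/galt_rot2.
have g0 : hurwitz_orbit g g by apply: (orbit_word [::]).
have [h [i [gh e1 e2]]] := orbit_adjacent g0 lt_k; rewrite -e1 -e2 in e *.
pose hk j := iter j (hurwitz_sigma i) h.
have gk j : hurwitz_orbit g (hk j) by elim: j => //= j; apply: orbit_sigma.
have hkE j : iter j rot2 (h (lo i), h (hi i)) = (hk j (lo i), hk j (hi i)).
  elim: j => [//|j IHj]; rewrite iterS IHj /rot2 /hk /=.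
  by rewrite !hurwitz_sigmaE !eqxx hi_neq_lo.
rewrite iter_rot2_morph => [|j]; first by rewrite e.
by rewrite hkE /=; apply: hgen_conj.
Qed.

End HurwitzGroup.

Section Dual.
Variables (n : nat) (Gamma : coxeterGraph n) (mu : {perm 'I_n}).
Hypothesis m_ge5 : forall (i j : 'I_n) (k : nat),
  i != j -> cox_m Gamma i j = Some k -> 5 <= k.

(** The Coxeter matrix indexed by positions instead of vertices, which absorbs [mu]; indices beyond
    n carry no braid relation. *)
Definition pos_m (x y : nat) : option nat :=
  if insub x is Some i then
    if insub y is Some j then cox_m Gamma (mu i) (mu j) else None
  else None.

Lemma cox_m_sym i j : cox_m Gamma i j = cox_m Gamma j i.
Proof.
by rewrite /cox_m edge_sym; case: ifP => // e; rewrite label_sym // edge_sym.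
Qed.

Lemma pos_m_sym x y : pos_m x y = pos_m y x.
Proof.
by rewrite /pos_m; case: insub => [i|]; case: insub => [j|] //; apply: cox_m_sym.
Qed.

Lemma pos_m_ord (i j : 'I_n) : pos_m i j = cox_m Gamma (mu i) (mu j).
Proof. by rewrite /pos_m !valK. Qed.

Lemma pos_mP (x y m : nat) : pos_m x y = Some m ->
  exists i j : 'I_n, [/\ x = i, y = j & cox_m Gamma (mu i) (mu j) = Some m].
Proof.
rewrite /pos_m; case: insubP => // i _ <-; case: insubP => // j _ <- e.
by exists i, j.
Qed.

Lemma pos_m_ge5 (x y m : nat) : x != y -> pos_m x y = Some m -> 5 <= m.
Proof.
move=> xy /pos_mP[i [j [ex ey]]]; apply: m_ge5; rewrite (inj_eq perm_inj).
by apply: contraNneq xy => ij; rewrite ex ey ij.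
Qed.

Let s := coxeter_tuple Gamma mu.

Lemma cox_gen_braid (i j : 'I_n) m : i != j -> cox_m Gamma i j = Some m ->
  galt (cox_gen Gamma i) (cox_gen Gamma j) m =
  galt (cox_gen Gamma j) (cox_gen Gamma i) m.
Proof.
move=> ij Mij; rewrite -!word_eval_alt -!pres_class_eval.
exact/pres_classP/PresRel/CoxeterBraid/ArtinBraid.
Qed.

Lemma artin_gen_braid (i j : 'I_n) m : i != j -> cox_m Gamma i j = Some m ->
  galt (artin_gen Gamma i) (artin_gen Gamma j) m =
  galt (artin_gen Gamma j) (artin_gen Gamma i) m.
Proof.
move=> ij Mij; rewrite -!word_eval_alt -!pres_class_eval.
exact/pres_classP/PresRel/ArtinBraid.
Qed.

Lemma cox_to_ncox : exists chi : {multiplicative coxeterGroup Gamma -> ncox pos_m},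
  forall k : 'I_n, chi (s k) = ws pos_m k.
Proof.
pose f (i : 'I_n) := ws pos_m (mu^-1 i).
have [u v r|chi chiE] := @pres_lift _ (@coxeter_rel n Gamma) _ f.
  case: r => [{}u {}v [i j m ij Mij]|i].
    rewrite !word_eval_alt; apply: ws_braid.
      by rewrite val_eqE (inj_eq perm_inj).
    by rewrite pos_m_ord !permKV.
  by rewrite /= mulg1 /f ws_sq.
by exists chi => k; rewrite /s ffunE chiE /f permK.
Qed.

Let t : {ffun 'I_n -> artinGroup Gamma} := [ffun k => artin_gen Gamma (mu k)].

(** What makes the inverse map well defined: pushed forward to [ncox], the equality meets
    [braided_value_uniq], applied to the tuple of Artin generators. *)
Lemma hurwitz_word_artin w w' (k k' : 'I_n) :
  hurwitz_word w s k = hurwitz_word w' s k' ->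
  hurwitz_word w t k = hurwitz_word w' t k'.
Proof.
move=> e; have [chi chiE] := cox_to_ncox.
pose g : nat -> artinGroup Gamma := extend (fun=> 1) t.
have bg : braided pos_m g.
  move=> x y m xy /pos_mP[i [j [ex ey Mij]]]; rewrite ex ey /g !extendE !ffunE.
  apply: artin_gen_braid => //; rewrite (inj_eq perm_inj).
  by apply: contraNneq xy => ij; rewrite ex ey ij.
rewrite !(hurwitz_word_hzs (fun=> 1)).
apply: (braided_value_uniq pos_m_sym pos_m_ge5) bg.
pose h : {ffun 'I_n -> ncox pos_m} := [ffun k : 'I_n => ws pos_m k].
have eh : ws pos_m = extend (ws pos_m) h.
  by apply/funext => x; rewrite /extend; case: insubP => // i _ <-; rewrite ffunE.
have es : h = [ffun k => chi (s k)] by apply/ffunP => i; rewrite ffunE [RHS]ffunE chiE.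
rewrite eh -!hurwitz_word_hzs es -!hurwitz_word_morph !ffunE.
by rewrite e.
Qed.

Lemma artin_to_dual :
  exists phi : {multiplicative artinGroup Gamma -> dualArtinGroup Gamma mu},
  is_canonical phi.
Proof.
have [u v [i j m ij Mij]|phi phiE] :=
    @pres_lift _ (@artin_rel n Gamma) _ (dual_gen Gamma mu); last by exists phi.
rewrite !word_eval_alt.
have dE k : dual_gen Gamma mu k = hgen s (s (mu^-1 k)).
  by rewrite -[dual_gen _ _ k]hgenE /= /s ffunE permKV.
have b (k k' : 'I_n) m' : galt (s k) (s k') m' = galt (s k') (s k) m' -> k != k' ->
    galt (hgen s (s k)) (hgen s (s k')) m' = galt (hgen s (s k')) (hgen s (s k)) m'.
  move=> e; rewrite -val_eqE neq_ltn => /orP[lt|lt]; first exact: hgen_braid.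
  by symmetry; apply: hgen_braid.
rewrite !dE; apply: b; last by rewrite (inj_eq perm_inj).
by rewrite /s !ffunE !permKV; apply: cox_gen_braid.
Qed.

Lemma dual_to_artin :
  exists psi : {multiplicative dualArtinGroup Gamma mu -> artinGroup Gamma},
  forall (r : Hur s) w k, val r = hurwitz_word w s k ->
    psi (hurwitz_gen r) = hurwitz_word w t k.
Proof.
have ex (r : Hur s) : exists x, val r = hurwitz_word x.1 s x.2.
  have := valP r; rewrite inE => -[h [b ->] [k e]].
  by exists (repr b, k).
pose f (r : Hur s) := hurwitz_word (sval (cid (ex r))).1 t (sval (cid (ex r))).2.
have fE (r : Hur s) w k : val r = hurwitz_word w s k -> f r = hurwitz_word w t k.
  by move=> e; apply: hurwitz_word_artin; case: (cid (ex r)) => x /= <-.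
have [u v [h i r1 r2 r [b eh] i0 e1 e2 e]|psi psiE] :=
    @pres_lift _ (@hurwitz_rel _ _ s) _ f.
  rewrite !word_eval_cat word_eval_winv /= !mulg1; set w := repr b.
  have {}eh : h = hurwitz_word w s := eh; rewrite {}eh in e1 e2.
  (* The conjugate is the coordinate [hi i] after one further sigma move. *)
  rewrite (fE _ _ _ e1) (fE _ _ _ e2) (fE r ((i, true) :: w) (hi i)).
    by rewrite /= hurwitz_sigmaE hi_neq_lo eqxx mulgA.
  by rewrite e e1 e2 /= hurwitz_sigmaE hi_neq_lo eqxx.
by exists psi => r w k /fE <-; apply: psiE.
Qed.

End Dual.

Theorem theoremA (n : nat) (Gamma : coxeterGraph n) (mu : {perm 'I_n})
  (m_ge5 : forall (i j : 'I_n) (k : nat),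
     i != j -> cox_m Gamma i j = Some k -> 5 <= k) :
  exists phi : {multiplicative artinGroup Gamma -> dualArtinGroup Gamma mu},
    is_canonical phi /\ bijective phi.
Proof.
have [phi phiE] := artin_to_dual Gamma mu; exists phi; split=> //.
have [psi psiE] := dual_to_artin mu m_ge5.
exists psi.
  have := @pres_hom_eq _ _ _ (psi \o phi : {multiplicative _ -> _}) idfun.
  move=> h; apply: h => i; rewrite /= -[pres_gen _ i]/(artin_gen Gamma i) phiE.
  by rewrite (psiE _ [::] (mu^-1 i)) /= ?ffunE permKV.
have := @pres_hom_eq _ _ _ (phi \o psi : {multiplicative _ -> _}) idfun.
move=> h; apply: h => r; rewrite /= -[pres_gen _ r]/(hurwitz_gen r).
have := valP r; rewrite inE => -[h' [b eh] [k e]].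
have {}eh : h' = hurwitz_word (repr b) (coxeter_tuple Gamma mu) := eh.
rewrite eh in e; rewrite (psiE _ _ _ e) -hgenE e.
(* [phi] takes the translate of the Artin tuple to the translate of the tuple of the [s_i], which
   [hgen_word] identifies with the generators of the translated coordinates. *)
have := hurwitz_word_morph phi (repr b) [ffun k => artin_gen Gamma (mu k)].
move/ffunP/(_ k); rewrite ffunE => ->.
have /ffunP/(_ k) := hgen_word (coxeter_tuple Gamma mu) (repr b).
rewrite ffunE => ->; congr (hurwitz_word _ _ k); apply/ffunP => l.
rewrite !ffunE phiE -[dual_gen _ _ _]hgenE //=.
Qed.
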